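(* There exists an integer $n'$ such that every tree with $n\ge n'$ vertices is neighborhood-prime.
   Context: All graphs are finite and simple; $[n]=\{1,\dots,n\}$; $N(v)$ is the set of neighbors of $v$. A neighborhood-prime labeling of a graph $G$ of order $n$ is a bijection $f:V(G)\to[n]$ such that for every vertex $v$ of degree greater than $1$, $\gcd\{f(u):u\in N(v)\}=1$; a graph is neighborhood-prime if it has such a labeling. *)

(* Defs.v *)
From mathcomp Require Import all_boot.
Set Implicit Arguments.
Unset Strict Implicit.
Unset Printing Implicit Defensive.

(* A graph on the finite vertex type T is given by its adjacency relation. *)
Definition simple_graph (T : finType) (e : rel T) : Prop :=
  symmetric e /\ irreflexive e.

Definition neighbors (T : finType) (e : rel T) (v : T) : {set T} :=
  [set u | e v u].

Definition degree (T : finType) (e : rel T) (v : T) : nat := #|neighbors e v|.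

Definition connected_graph (T : finType) (e : rel T) : Prop :=
  0 < #|T| /\ forall x y : T, connect e x y.

(* The bound on the size excludes [:: x; y] with x and y adjacent, which is an
   e-cycle for path.v because e is symmetric. *)
Definition acyclic_graph (T : finType) (e : rel T) : Prop :=
  forall c : seq T, 2 < size c -> ~ ucycle e c.

Definition is_tree (T : finType) (e : rel T) : Prop :=
  [/\ simple_graph e, connected_graph e & acyclic_graph e].

(* The set {1, ..., n}, with n = #|T|, is represented by 'I_n shifted by one:
   the label of the vertex u is (f u).+1. *)
Definition neighborhood_prime_labeling (T : finType) (e : rel T)
    (f : T -> 'I_#|T|) : Prop :=
  bijective f /\
  forall v : T, 1 < degree e v ->
    \big[gcdn/0]_(u in neighbors e v) (f u).+1 = 1.

Definition neighborhood_prime (T : finType) (e : rel T) : Prop :=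
  exists f : T -> 'I_#|T|, neighborhood_prime_labeling e f.

(* Main.v *)
Require Import Defs.
From mathcomp Require Import all_boot.
From mathcomp Require Import all_order all_algebra perm.
From mathcomp Require Import zify ring lra.
Set Implicit Arguments.
Unset Strict Implicit.
Unset Printing Implicit Defensive.

Import Order.TTheory GRing.Theory Num.Theory.

(** A vertex of degree greater than one is satisfied as soon as two of its
    neighbours have coprime labels. Choosing one such pair at each vertex (the
    two first children of a branching vertex, or else its parent and its only
    child) defines a forest on the same vertices, with the later vertex of each
    pair as a child of the earlier one. In this forest the branchings are bounded
    by twice the number of roots (mate_few_kids). So it is enough to label every
    large forest of this kind by 1, ..., n with coprime labels on all edges
    (forest_labelling).

    The primes that can spoil an edge are treated in three ways. Let y be about
    log log n.

    The prime 2: the even labels go to an independent set I of n/2 vertices.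

    The odd primes below y: the code of a label has one bit for each of them,
    true for the multiples of the prime, and labels with complementary codes
    share none of them (code_coprime). The buckets, given by a parity and a code,
    are equally large (count_bucket). A small set of vertices cuts the forest into
    small pieces (cut_forest). Each piece gets a code, complemented on one side
    of its bipartition, in such a way that every bucket has about as many slots
    as labels (spread_codes). The cut vertices get labels without small prime
    factors, found by Legendre's sieve (pool_ge).

    The primes from y on: a label a is tame if the sum of 1/p over its prime
    factors p at least y is at most 1/D, with D a constant. A tame label shares
    such a prime with about one D-th of a bucket at most (bucket_share_le). The
    other labels are exponentially rare in y (untame_rare); they are placed first,
    on vertices whose neighbours are all treated like cut vertices.

    Then a set Q of candidates is set aside: it is independent, its vertices have
    degree at most two, every vertex has at most two neighbours in Q, and Q takes
    up a fixed proportion of each bucket's slots, more than the tame labels can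
    block. All other vertices choose labels in the order of their indices; each
    of them sees at most its parent and a few of the rare labels (greedy_stage).
    The remaining labels are put on Q arbitrarily, keeping parity and code
    (fill_stage), and the conflicts on Q are removed by swaps inside the classes
    (swap_repair, assembly).

    The set I and the candidates come from a dichotomy. If the forest has few
    roots, it is nearly a union of paths, and either side of its bipartition has
    about half of the vertices (few_roots_candidates). If it has many roots, its
    trees are numerous and each provides a leaf or an isolated vertex
    (many_roots_candidates). *)


(** * Periodic predicates *)

Lemma count_periodic_window (A : pred nat) L x :
  (forall a, A (a + L) = A a) ->
  count A (iota x L) = count A (iota 0 L).
Proof.
move=> perA; elim: x => // x IHx; rewrite -IHx.
have := congr1 (count A) (iotaD x L 1); rewrite addn1 /= count_cat /= perA.
by lia.
Qed.

Lemma count_periodic_mul (A : pred nat) L x q :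
  (forall a, A (a + L) = A a) ->
  count A (iota x (q * L)) = q * count A (iota 0 L).
Proof.
move=> perA; elim: q x => // q IHq x.
by rewrite mulSn iotaD count_cat IHq count_periodic_window // mulSn.
Qed.

Lemma count_iota_leq (A : pred nat) x m n :
  m <= n -> count A (iota x m) <= count A (iota x n).
Proof. by move=> le_mn; rewrite -(subnKC le_mn) iotaD count_cat leq_addr. Qed.

Lemma count_periodic_ge (A : pred nat) L x n :
  (forall a, A (a + L) = A a) ->
  count A (iota 0 L) * (n %/ L) <= count A (iota x n).
Proof.
move=> perA; rewrite mulnC -(count_periodic_mul x _ perA).
by apply: count_iota_leq; rewrite leq_divM.
Qed.

Lemma count_periodic_le (A : pred nat) L x n :
  0 < L -> (forall a, A (a + L) = A a) ->
  count A (iota x n) <= count A (iota 0 L) * (n %/ L).+1.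
Proof.
move=> L_gt0 perA; rewrite mulnC -(count_periodic_mul x _ perA).
by apply: count_iota_leq; rewrite ltnW // ltn_ceil.
Qed.

Lemma count_iota_card (A : pred nat) n :
  count A (iota 0 n) = #|[set i : 'I_n | A i]|.
Proof.
rewrite -sum1_count -sum1_card -{1}(subn0 n) -/(index_iota 0 n) big_mkord.
by apply: eq_bigl => i; rewrite inE.
Qed.

(** The Chinese remainder theorem as independence: conditions modulo coprime
    numbers multiply. *)
Lemma count_chinese (A B : pred nat) m p :
  0 < m -> 0 < p -> coprime m p ->
  count (fun a => A (a %% m) && B (a %% p)) (iota 0 (m * p)) =
  count A (iota 0 m) * count B (iota 0 p).
Proof.
move=> m_gt0 p_gt0 co_mp; rewrite !count_iota_card -cardsX.
pose h (a : 'I_(m * p)) : 'I_m * 'I_p :=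
  (Ordinal (ltn_pmod a m_gt0), Ordinal (ltn_pmod a p_gt0)).
have h_inj : injective h.
  move=> a b [eq_m eq_p]; apply: val_inj => /=.
  have := chinese_remainder co_mp a b; rewrite eq_m eq_p !eqxx /=.
  by rewrite !modn_small // => /eqP.
have h_bij : bijective h.
  by apply: inj_card_bij => //; rewrite card_prod !card_ord.
rewrite -(on_card_preimset (f := h)); last exact: onW_bij.
by congr #|pred_of_set _|; apply/setP=> a; rewrite !inE.
Qed.

(** * Codes modulo the small primes *)

Fixpoint code_period (ps : seq nat) : nat :=
  if ps is p :: ps' then code_period ps' * p * 2 else 2.

(** One bit per prime p: whether the residue of the label modulo p lies in the
    lower half. An odd number of residues has no exact half, so the lower half
    is taken alternately with (p - 1)/2 and (p + 1)/2 elements, according to an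
    extra factor 2 of the period; over a full period both bits are then equally
    frequent. A multiple of p always has the bit true, so two labels with
    opposite bits are never both multiples of p. *)
Fixpoint code (ps : seq nat) (a : nat) : seq bool :=
  if ps is p :: ps' then
    (a %% p < p./2 + odd (a %/ (code_period ps' * p))) :: code ps' a
  else [::].

Definition rough (ps : seq nat) (a : nat) : bool := all (fun p => ~~ (p %| a)) ps.

(** Pairwise coprimality is asked against the whole period of the remaining
    primes, which is the form the Chinese remainder theorem uses. *)
Fixpoint odd_coprimes (ps : seq nat) : bool :=
  if ps is p :: ps' then
    [&& odd p, 2 < p, coprime (code_period ps') p & odd_coprimes ps']
  else true.

Lemma size_code ps a : size (code ps a) = size ps.
Proof. by elim: ps => //= p ps ->. Qed.

Lemma code_period_gt0 ps : odd_coprimes ps -> 0 < code_period ps.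
Proof. by elim: ps => //= p ps IH /and4P[_ p_gt2 _ /IH]; rewrite !muln_gt0; lia. Qed.

Lemma odd_code_period ps : odd (code_period ps) = false.
Proof. by case: ps => //= p ps; rewrite !oddM andbF. Qed.

Lemma odd_addM a m k : ~~ odd m -> odd (a + k * m) = odd a.
Proof. by move=> /negbTE ev; rewrite oddD oddM ev andbF addbF. Qed.

Lemma codeDM ps a k : odd_coprimes ps -> code ps (a + k * code_period ps) = code ps a.
Proof.
elim: ps a k => //= p ps IH a k /and4P[_ p_gt2 _ ok].
have L_gt0 := code_period_gt0 ok; congr (_ :: _).
  rewrite (_ : a + _ = (k * 2) * (code_period ps * p) + a); last by ring.
  rewrite divnMDl ?muln_gt0 ?L_gt0 //; last by lia.
  by rewrite mulnA modnMDl muln2 oddD odd_double.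
by rewrite (_ : k * _ = (k * p * 2) * code_period ps) ?IH //; ring.
Qed.

Lemma roughDM ps a k : rough ps (a + k * code_period ps) = rough ps a.
Proof.
elim: ps a k => //= p ps IH a k; rewrite (_ : k * _ = (k * p * 2) * code_period ps); last by ring.
rewrite IH; congr (~~ _ && _); rewrite dvdn_addl //.
by rewrite (_ : _ * _ = p * (k * 2 * code_period ps)) ?dvdn_mulr //; ring.
Qed.

Definition bucket (ps : seq nat) (b : bool) (u : seq bool) : pred nat :=
  fun a => (odd a == b) && (code ps a == u).

Lemma bucket_period ps b u a k : odd_coprimes ps ->
  bucket ps b u (a + k * code_period ps) = bucket ps b u a.
Proof. by move=> ok; rewrite /bucket codeDM // odd_addM // odd_code_period. Qed.

Lemma count_lt_iota m k : k <= m -> count (fun x => x < k) (iota 0 m) = k.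
Proof.
move=> le_km; rewrite -(subnKC le_km) iotaD count_cat add0n.
have -> : count (fun x => x < k) (iota 0 k) = k.
  rewrite -[RHS](size_iota 0 k); apply/eqP; rewrite -all_count.
  by apply/allP => x; rewrite mem_iota.
have -> : count (fun x => x < k) (iota k (m - k)) = 0; last by rewrite addn0.
apply/eqP; rewrite -leqn0 leqNgt -has_count.
by apply/hasPn => x; rewrite mem_iota -leqNgt => /andP[].
Qed.

(** One more prime splits the new period into two halves, on which the residue
    classes modulo p are read with the two roundings of p/2; each half is a
    product by the Chinese remainder theorem. *)
Lemma count_code_cons ps p (A : pred nat) (B : bool -> pred nat) :
  odd_coprimes (p :: ps) -> (forall a k, A (a + k * code_period ps) = A a) ->
  count (fun a => A a && B (odd (a %/ (code_period ps * p))) (a %% p))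
    (iota 0 (code_period (p :: ps))) =
  count A (iota 0 (code_period ps)) *
    (count (B false) (iota 0 p) + count (B true) (iota 0 p)).
Proof.
move=> /and4P[_ p_gt2 co_p /code_period_gt0 L_gt0] perA /=.
set L := code_period ps; have Lp_gt0: 0 < L * p by rewrite muln_gt0 L_gt0; lia.
have modA a : A (a %% L) = A a by rewrite {2}(divn_eq a L) addnC perA.
rewrite muln2 -addnn iotaD count_cat mulnDr; congr (_ + _).
  rewrite -(count_chinese A (B false)) //; last by lia.
  apply: eq_in_count => a; rewrite mem_iota => /andP[_ lt_a].
  by rewrite divn_small // modA.
rewrite -(count_chinese A (B true)) //; last by lia.
rewrite add0n -[X in iota X _]addn0 iotaDl count_map; apply: eq_in_count => a.
rewrite mem_iota => /andP[_ lt_a].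
have E1 : (L * p + a) %/ (L * p) = 1 by rewrite -{1}(mul1n (L * p)) divnMDl // divn_small.
have E2 : (L * p + a) %% p = a %% p by rewrite modnMDl.
have E3 : A (L * p + a) = A a by rewrite addnC mulnC perA.
by rewrite /= E1 E2 E3 modA.
Qed.

(** All 2 ^ (1 + size ps) buckets have the same number of elements in a period:
    the alternation in the code makes each new bit split every bucket evenly. *)
Lemma count_bucket ps b u : odd_coprimes ps -> size u = size ps ->
  count (bucket ps b u) (iota 0 (code_period ps)) = \prod_(p <- ps) p.
Proof.
elim: ps u => [|p ps IH] u ok_ps.
  by case: u => // _; rewrite big_nil; case: b.
case: u => //= c u [sz_u]; have /and4P[odd_p p_gt2 co_p ok] := ok_ps.
pose B (e : bool) x := (x < p./2 + e) == c.
have eqB a : bucket (p :: ps) b (c :: u) a =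
    bucket ps b u a && B (odd (a %/ (code_period ps * p))) (a %% p).
  by rewrite /bucket /B /= eqseq_cons -andbA; congr (_ && _); rewrite andbC.
rewrite (eq_count eqB) count_code_cons // => [|a k]; last exact: bucket_period.
rewrite IH // big_cons mulnC; congr (_ * _).
have p_half := odd_double_half p; rewrite odd_p in p_half.
have cB (e : bool) : count (fun x => (x < p./2 + e) == c) (iota 0 p) =
    if c then p./2 + e else p - (p./2 + e).
  have le_ep: p./2 + e <= p by case: e; lia.
  have := count_lt_iota le_ep; have := count_predC (fun x => x < p./2 + e) (iota 0 p).
  rewrite size_iota; case: (c) => sz lt.
    by rewrite -[RHS]lt; apply: eq_count => x /=; rewrite eqb_id.
  have -> : count (fun x => (x < p./2 + e) == false) (iota 0 p) =
            count (predC (fun x => x < p./2 + e)) (iota 0 p).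
    by apply: eq_count => x /=; rewrite eqbF_neg.
  lia.
rewrite (cB false : count (B false) _ = _) (cB true : count (B true) _ = _).
by case: (c); lia.
Qed.

(** The residue 0 is lost only to the bit true, once for each of the two
    roundings, so at least p - 2 of the p residues remain. *)
Lemma count_bucket_rough ps b u : odd_coprimes ps -> size u = size ps ->
  \prod_(p <- ps) (p - 2) <=
  count (fun a => bucket ps b u a && rough ps a) (iota 0 (code_period ps)).
Proof.
elim: ps u => [|p ps IH] u ok_ps.
  by case: u => // _; rewrite big_nil; case: b.
case: u => //= c u [sz_u]; have /and4P[odd_p p_gt2 co_p ok] := ok_ps.
pose B (e : bool) x := ((x < p./2 + e) == c) && (0 < x).
have eqB a : bucket (p :: ps) b (c :: u) a && rough (p :: ps) a =
    (bucket ps b u a && rough ps a) &&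
    B (odd (a %/ (code_period ps * p))) (a %% p).
  rewrite /bucket /= eqseq_cons /B -lt0n /dvdn.
  by do 2!case: (_ == _); rewrite ?andbF //=; case: (code _ _ == _); rewrite //= andbC.
rewrite (eq_count eqB) (count_code_cons (A := fun a => bucket ps b u a && rough ps a)) //; last first.
  by move=> a k; rewrite bucket_period // roughDM.
rewrite big_cons mulnC leq_mul ?IH //.
have p_half := odd_double_half p; rewrite odd_p in p_half.
have cB (e : bool) : (if c then p./2 + e - 1 else p - (p./2 + e)) <=
    count (fun x => ((x < p./2 + e) == c) && (0 < x)) (iota 0 p).
  have le_ep: p./2 + e <= p by case: e; lia.
  have := count_lt_iota le_ep; have := count_predC (fun x => x < p./2 + e) (iota 0 p).
  rewrite size_iota; case: (c) => sz lt.
    have := count_predUI (fun x => x < p./2 + e) (fun x => 0 < x) (iota 0 p).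
    have := count_predC (fun x => 0 < x) (iota 0 p).
    have -> : count (predC (fun x => 0 < x)) (iota 0 p) = 1.
      rewrite (eq_count (a2 := fun x => x < 1)) ?count_lt_iota //; first by lia.
      by move=> x /=; lia.
    have := count_size (predU (fun x => x < p./2 + e) (fun x => 0 < x)) (iota 0 p).
    rewrite size_iota (eq_count (a1 := fun x => ((x < p./2 + e) == true) && (0 < x))
      (a2 := predI (fun x => x < p./2 + e) (fun x => 0 < x))); last by move=> x /=; rewrite eqb_id.
    lia.
  apply: leq_trans (_ : count (predC (fun x => x < p./2 + e)) (iota 0 p) <= _); first by lia.
  by apply: sub_count => x /=; lia.
apply: leq_trans (leq_add (cB false : _ <= count (B false) _) (cB true : _ <= count (B true) _)).
by case: (c); lia.
Qed.

(** Codes turn coprimality at the small primes into a condition that any proper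
    2-colouring of a piece of the forest satisfies. *)
Lemma code_coprime ps a b p : odd_coprimes ps -> p \in ps ->
  code ps b = map negb (code ps a) -> p %| a -> ~~ (p %| b).
Proof.
elim: ps => // q ps IH /and4P[odd_q q_gt2 _ ok] /=.
rewrite inE => /orP[/eqP->|p_ps] [eq_hd eq_tl]; last exact: IH.
move=> /eqP a0; apply/negP => /eqP b0; move: eq_hd; rewrite a0 b0.
by rewrite !addn_gt0 (_ : 0 < q./2) //; lia.
Qed.

(** * Descending lists of primes *)

Fixpoint descending (P : pred nat) (y : nat) : seq nat :=
  if y is y'.+1 then
    if P y' then y' :: descending P y' else descending P y'
  else [::].

Lemma mem_descending P y q : (q \in descending P y) = P q && (q < y).
Proof.
elim: y => [|y IH] /=; first by rewrite andbF.
case: ifP => Py; rewrite ?inE IH ltnS (leq_eqVlt q y).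
  by have [->|] := eqVneq q y; rewrite ?Py.
by have [->|] := eqVneq q y; rewrite ?Py ?andbF.
Qed.

Lemma sorted_descending P y : sorted gtn (descending P y).
Proof.
elim: y => //= y IH; case: ifP => // _ /=; rewrite path_min_sorted //.
by apply/allP => q; rewrite mem_descending => /andP[_].
Qed.

Lemma gtn_trans : transitive gtn.
Proof. by move=> a b c /= ab bc; apply: ltn_trans bc ab. Qed.

Lemma uniq_desc qs : sorted gtn qs -> uniq qs.
Proof. by apply: sorted_uniq; [exact: gtn_trans | move=> x; rewrite /= ltnn]. Qed.

Lemma size_desc_lt q qs : path gtn q qs -> all (leq 2) (q :: qs) -> size qs + 2 <= q.
Proof.
move=> sqs /andP[q2 ge2]; have lt_q := order_path_min gtn_trans sqs.
have: size qs <= size (iota 2 (q - 2)).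
  apply: uniq_leq_size; first exact: uniq_desc (path_sorted sqs).
  by move=> x xqs; have /= := allP ge2 x xqs; have /= := allP lt_q x xqs; rewrite mem_iota; lia.
by rewrite size_iota; lia.
Qed.

(** * A sieve lower bound *)

(** Along an arithmetic progression the indices in one residue class form again
    an arithmetic progression; this is the recursion step of the sieve. *)
Lemma count_class (A : pred nat) q i0 k : 0 < q -> i0 < q ->
  count (fun i => (i %% q == i0) && A i) (iota 0 k) =
  count (fun j => A (i0 + j * q)) (iota 0 ((k + (q - 1 - i0)) %/ q)).
Proof.
move=> q_gt0 lt_i0; elim: k => [|k IH]; first by rewrite divn_small //; lia.
rewrite -addn1 iotaD count_cat IH /= add0n addn0.
have [kE|/eqP kE] := eqVneq (k %% q) i0; last first.
  rewrite /= addn0; congr (count _ (iota 0 _)).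
  have := divn_eq k q; have := ltn_pmod k q_gt0.
  set a := k %/ q; set b := k %% q => ltb ->.
  have [ltbi|leib] := ltnP b i0.
    rewrite -!addnA !divnMDl // !divn_small //; lia.
  rewrite (_ : a * q + b + _ = a.+1 * q + (b - 1 - i0)); last by lia.
  rewrite (_ : a * q + b + 1 + _ = a.+1 * q + (b - i0)); last by lia.
  by rewrite !divnMDl // !divn_small //; lia.
have kD := divn_eq k q; rewrite kE in kD.
rewrite (_ : k + (q - 1 - i0) = (k %/ q) * q + (q - 1)); last by lia.
rewrite (_ : k + 1 + (q - 1 - i0) = (k %/ q).+1 * q + 0); last by lia.
have lt_q1 : q - 1 < q by rewrite subn1 ltn_predL.
rewrite !divnMDl // (divn_small lt_q1) div0n.
rewrite !addn0 -[in RHS]addn1 iotaD count_cat /= add0n addn0.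
by rewrite addnC in kD; rewrite -kD.
Qed.

Definition sieved (qs : seq nat) : pred nat := fun a => all (fun q => ~~ (q %| a)) qs.

Definition sieve_density (qs : seq nat) : rat := (\prod_(q <- qs) (1 - q%:R^-1))%R.

Lemma sieve_density_bounds qs : all (leq 2) qs -> (0 <= sieve_density qs <= 1)%R.
Proof.
rewrite /sieve_density; elim: qs => [|q qs IH] /=; first by rewrite big_nil.
move=> /andP[q2 /IH /andP[ge0 le1]]; rewrite big_cons.
have q1: (0 <= 1 - (q%:R : rat)^-1 <= 1)%R.
  have q0: (0 < q%:R :> rat)%R by rewrite ltr0n; lia.
  rewrite subr_ge0 invf_le1 // ler1n (leq_trans _ q2) //=.
  by rewrite lerBlDr lerDl invr_ge0 ltW.
move: q1 => /andP[q1 q1']; rewrite mulr_ge0 //=.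
by rewrite -[leRHS](mulr1 1%R) ler_pM.
Qed.

(** Legendre's sieve: sieving by one more prime subtracts a count of the same
    shape in a sparser progression, so the error at most doubles, plus one. *)
Lemma sieve_error qs d r k :
  all prime qs -> uniq qs -> all (coprime d) qs ->
  (`|(count (fun i => sieved qs (r + i * d)%N) (iota 0 k))%:R - k%:R * sieve_density qs|
     <= (2 ^ size qs)%:R - 1 :> rat)%R.
Proof.
elim: qs d r k => [|q qs IH] d r k /=.
  by rewrite /sieve_density big_nil count_predT size_iota mulr1 !subrr normr0.
move=> /andP[pr_q pr_qs] /andP[q_notin uq] /andP[co_dq co_d].
have q_gt0 := prime_gt0 pr_q.
have [i0 lt_i0 i0P] : exists2 i0, i0 < q & forall i, (q %| r + i * d) = (i %% q == i0).
  (* i0 solves the congruence r + i0 * d = 0 modulo q. *)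
  case: (@egcdnP d q) => [|u' v' Euv _]; first by case: (d) co_dq pr_q => //; rewrite /coprime gcd0n => /eqP->.
  rewrite (eqP co_dq) in Euv.
  pose i0 := (q - (r * u') %% q) %% q.
  have i0q : q %| r + i0 * d.
    have: q %| r * u' + i0.
      by rewrite /dvdn modnDmr -modnDml subnKC ?modnn // ltnW // ltn_pmod.
    move=> dv; have: q %| (r * u' + i0) * d by rewrite dvdn_mulr.
    rewrite mulnDl -mulnA Euv mulnDr muln1 (_ : _ + r + _ = r + i0 * d + r * (v' * q)); last by lia.
    by rewrite dvdn_addl // mulnA dvdn_mull.
  have lt_i0 : i0 < q by rewrite ltn_pmod.
  exists i0 => // j.
  apply/idP/eqP => [iq|iE]; last first.
    rewrite (divn_eq j q) iE mulnDl addnCA -mulnA mulnCA.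
    by rewrite dvdn_addr // dvdn_mulr.
  have same j1 j2 : j1 <= j2 -> q %| r + j1 * d -> q %| r + j2 * d -> j1 %% q = j2 %% q.
    move=> le_j dv1 dv2; apply/esym/eqP; rewrite eqn_mod_dvd //.
    rewrite -(Gauss_dvdl _ (_ : coprime q d)) 1?coprime_sym // mulnBl.
    by rewrite -(subnDl r) dvdn_sub.
  by rewrite -(modn_small lt_i0); case/orP: (leq_total j i0) => /same E; [|apply: esym]; apply: E.
set S := count _ _; set A := sieved qs.
have SE : S + count (fun j => A (r + (i0 + j * q) * d)) (iota 0 ((k + (q - 1 - i0)) %/ q)) =
    count (fun i => A (r + i * d)) (iota 0 k).
  rewrite -(count_class (fun i => A (r + i * d))) // /S.
  rewrite -(count_predUI _ _ (iota 0 k)) [X in _ + X](_ : _ = 0) ?addn0; last first.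
    apply/eqP; rewrite -leqn0 leqNgt -has_count; apply/hasPn => i _; rewrite /= /sieved /= i0P; by case: (_ == i0); rewrite /= ?andbF.
  by apply: eq_count => i; rewrite /= /A /sieved /= i0P; case: (_ == i0); rewrite /= ?orbF.
have := IH d r k pr_qs uq co_d.
have co_dqs : all (coprime (d * q)) qs.
  apply/allP => x xqs; rewrite coprimeMl (allP co_d) //=.
  have pr_x := allP pr_qs x xqs; rewrite prime_coprime // dvdn_prime2 //.
  by apply: contraNneq q_notin => ->.
have := IH (d * q) (r + i0 * d) ((k + (q - 1 - i0)) %/ q) pr_qs uq co_dqs.
rewrite (eq_count (a2 := fun j => A (r + (i0 + j * q) * d))); last first.
  by move=> j; rewrite /A; congr (sieved _ _); lia.
rewrite -SE -/A; set S' := count _ _; set k' := _ %/ q.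
rewrite /sieve_density big_cons -/(sieve_density qs).
have /andP[pi0 pi1] : (0 <= sieve_density qs <= 1)%R.
  by apply: sieve_density_bounds; apply/allP => x /(allP pr_qs)/prime_gt1.
set pi := sieve_density qs in pi0 pi1 *; set e : rat := ((2 ^ size qs)%N%:R)%R.
have qR : (0 < q%:R :> rat)%R by rewrite ltr0n.
have k'b : (`|k'%:R - k%:R / q%:R| <= 1 :> rat)%R.
  have k'q : k' * q <= k + (q - 1 - i0) by rewrite leq_divM.
  have k'q1 : k + (q - 1 - i0) < k'.+1 * q by rewrite ltn_ceil.
  have h1 : k' * q <= k + q by clear -k'q lt_i0; lia.
  have h2 : k <= k' * q + q by clear -k'q1 lt_i0; lia.
  have qN0 : (q%:R != 0 :> rat)%R by rewrite lt0r_neq0.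
  rewrite ler_distl; apply/andP; split.
    rewrite lerBlDr -(ler_pM2r qR) divfK // mulrDl mul1r.
    by rewrite -natrM -natrD ler_nat.
  by rewrite -(ler_pM2r qR) mulrDl divfK // mul1r -natrM -natrD ler_nat.
have -> : ((2 ^ (size qs).+1)%N%:R = 2 * e :> rat)%R by rewrite expnS natrM.
have bnd : (`|k'%:R * pi - k%:R / q%:R * pi| <= 1 :> rat)%R.
  by rewrite -mulrBl normrM (ger0_norm pi0) -[leRHS]mulr1 ler_pM.
rewrite natrD => hB hA.
have -> : (S%:R - k%:R * ((1 - q%:R^-1) * pi) =
   (S%:R + S'%:R - k%:R * pi) - (S'%:R - k'%:R * pi) - (k'%:R * pi - k%:R / q%:R * pi) :> rat)%R by ring.
apply: le_trans (ler_normB _ _) _; apply: le_trans (lerD (ler_normB _ _) (lexx _)) _.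
by lra.
Qed.

(** In descending order the product telescopes, since the i-th smallest element
    is at least i + 1. *)
Lemma sieve_density_ge qs : sorted gtn qs -> all (leq 2) qs ->
  ((size qs).+1%:R^-1 <= sieve_density qs)%R.
Proof.
elim: qs => [|q qs IH] sqs ge2; first by rewrite /sieve_density big_nil invr1.
have ge_q := size_desc_lt sqs ge2; have /andP[q2 ge2'] := ge2.
rewrite /sieve_density big_cons -/(sieve_density qs).
have := IH (path_sorted sqs) ge2'; set pi := sieve_density qs; set m := size qs in ge_q * => pim.
rewrite /= -/m; have m1 : (0 < m.+1%:R :> rat)%R by rewrite ltr0n.
have qm : (m.+2%:R <= q%:R :> rat)%R by rewrite ler_nat; lia.
have q0 : (0 < q%:R :> rat)%R by rewrite ltr0n; lia.
have m2 : (0 < m.+2%:R :> rat)%R by rewrite ltr0n.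
apply: le_trans (_ : (1 - m.+2%:R^-1) * m.+1%:R^-1 <= _)%R.
  rewrite le_eqVlt; apply/orP; left; apply/eqP.
  have -> : (m.+2%:R = m.+1%:R + 1 :> rat)%R by rewrite natr1.
  move: (m.+1%:R)%R m1 => x m1.
  have x1 : (x + 1 != 0)%R by rewrite lt0r_neq0 // addr_gt0.
  by field; rewrite ?x1 lt0r_neq0 //; lra.
apply: ler_pM => //; first by rewrite subr_ge0 invf_le1 // ler1n.
  by rewrite invr_ge0 ltW.
by rewrite lerB // lef_pV2 // posrE.
Qed.

(** The error of Legendre's sieve is exponential in the number of primes; it is
    used with 2 ^ size qs a power of n of exponent less than one. *)
Lemma count_odd_sieved qs k :
  sorted gtn qs -> all prime qs -> all odd qs ->
  k <= (size qs).+1 * (count (fun i => sieved qs (1 + i * 2)) (iota 0 k) + 2 ^ size qs).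
Proof.
move=> sqs pr_qs odd_qs; have co2 : all (coprime 2) qs.
  by apply/allP => x /(allP odd_qs); rewrite coprime2n.
have ge2 : all (leq 2) qs by apply/allP => x /(allP pr_qs)/prime_gt1.
have := sieve_error 1 k pr_qs (uniq_desc sqs) co2.
have := sieve_density_ge sqs ge2; set pi := sieve_density _.
set S := count _ _ => pi_ge; rewrite ler_distl => /andP[hS _].
have m1 : (0 < (size qs).+1%:R :> rat)%R by rewrite ltr0n.
rewrite -(ler_nat rat) natrM natrD.
have kpi : (k%:R / (size qs).+1%:R <= k%:R * pi :> rat)%R by rewrite ler_wpM2l.
rewrite mulrC -ler_pdivrMr //.
move: hS kpi; move: (_ / _)%R (k%:R * pi)%R (S%:R)%R ((2 ^ size qs)%:R)%R => a b c d.
by move=> hS kpi; lra.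
Qed.

(** * Rareness of the labels that are not tame *)

Definition reciprocal_sum (y a : nat) : rat :=
  (\sum_(p <- primes a | (y <= p)%N) p%:R^-1)%R.

(** A tame label can meet a common prime factor at least y with only about one
    label in D. *)
Definition tame (D y a : nat) : bool := (reciprocal_sum y a <= D%:R^-1)%R.

(** The multiplicative weight whose average measures how often the sum of z / q
    over the prime divisors q is large: an exponential moment without the
    exponential. *)
Definition weight (z : rat) (qs : seq nat) (a : nat) : rat :=
  (\prod_(q <- qs | (q %| a)%N) (1 + z / q%:R))%R.

Lemma sum_multiples (F : nat -> rat) q N : 0 < q ->
  (\sum_(1 <= a < N.+1 | (q %| a)%N) F a = \sum_(1 <= b < (N %/ q).+1) F (q * b)%N)%R.
Proof.
move=> q_gt0; elim: N => [|N IH]; first by rewrite div0n !big_geq.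
rewrite big_mkcond big_nat_recr //= -big_mkcond IH divnS //.
case: ifP => dv; last by rewrite addr0.
rewrite add1n [in RHS]big_nat_recr //=; congr (_ + F _)%R.
have <- : N.+1 %/ q = (N %/ q).+1 by rewrite divnS // dv.
by rewrite mulnC divnK.
Qed.

(** Expanding the factor at q gives the sum over all a plus z / q times the sum
    over the multiples of q, a q-th of the range. *)
Lemma weight_sum z qs N : (0 <= z)%R -> all prime qs -> uniq qs ->
  (\sum_(1 <= a < N.+1) weight z qs a <= N%:R * \prod_(q <- qs) (1 + z / q%:R ^+ 2))%R.
Proof.
move=> z_ge0; elim: qs N => [|q qs IH] N /=.
  move=> _ _; rewrite big_nil mulr1 (eq_bigr (fun=> 1%R)) => [|a _]; last by rewrite /weight big_nil.
  by rewrite big_const_nat subn1 /= iter_addr addr0.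
move=> /andP[pr_q pr_qs] /andP[q_notin uq]; have q_gt0 := prime_gt0 pr_q.
have qR : (0 < q%:R :> rat)%R by rewrite ltr0n.
have Pi_ge0 : (0 <= \prod_(q <- qs) (1 + z / q%:R ^+ 2))%R.
  by apply: prodr_ge0 => i _; rewrite addr_ge0 // mulr_ge0 // invr_ge0 exprn_ge0.
rewrite (eq_bigr (fun a => weight z qs a + (z / q%:R) * (if (q %| a)%N then weight z qs a else 0)))%R; last first.
  move=> a _; rewrite /weight big_cons; case: ifP => _; last by rewrite mulr0 addr0.
  by rewrite mulrDl mul1r.
rewrite big_split /= -mulr_sumr -big_mkcond /= sum_multiples //.
rewrite (eq_bigr (F1 := fun b => weight z qs (q * b)%N) (weight z qs)) => [|b _]; last first.
  rewrite /weight [LHS]big_seq_cond [RHS]big_seq_cond; apply: eq_bigl => x.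
  have [xqs|//] := boolP (x \in qs); rewrite /= Euclid_dvdM ?(allP pr_qs) //.
  rewrite dvdn_prime2 ?pr_q ?(allP pr_qs) //.
  by have [xq|//] := eqVneq x q; rewrite -xq xqs in q_notin.
rewrite big_cons.
have hN := IH N pr_qs uq; have hNq := IH (N %/ q) pr_qs uq.
set S := (\sum_(1 <= a < N.+1) _)%R in hN *.
set S' := (\sum_(1 <= a < (N %/ q).+1) _)%R in hNq *.
set Pi := (\prod_(j <- qs) _)%R in hN hNq Pi_ge0 *.
rename hN into hS; rename hNq into hS'.
have le_Nq : ((N %/ q)%:R <= N%:R / q%:R :> rat)%R.
  by rewrite ler_pdivlMr // -natrM ler_nat leq_divM.
have h1 : (S' <= N%:R / q%:R * Pi)%R.
  by apply: le_trans hS' _; rewrite ler_wpM2r.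
have h2 : (z / q%:R * S' <= z / q%:R * (N%:R / q%:R * Pi))%R.
  by rewrite ler_wpM2l // divr_ge0.
apply: le_trans (lerD hS h2) _.
by rewrite le_eqVlt; apply/orP; left; apply/eqP; field; rewrite lt0r_neq0.
Qed.

Lemma prod1D_le (xs : seq rat) : all (fun x => 0 <= x)%R xs ->
  ((\prod_(x <- xs) (1 + x)) * (1 - \sum_(x <- xs) x) <= 1)%R.
Proof.
move=> ge0; elim: xs ge0 => [|x xs IH] /=; first by rewrite !big_nil subr0 mulr1.
move=> /andP[x0 xs0]; rewrite !big_cons; have := IH xs0.
have : (1 <= \prod_(x <- xs) (1 + x))%R.
  rewrite big_seq; elim/big_ind: _ => // [a b a1 b1|i i_xs]; last by rewrite lerDl; exact: (allP xs0).
  by rewrite -[leLHS]mulr1 ler_pM.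
have : (0 <= \sum_(x <- xs) x)%R by rewrite big_seq sumr_ge0 // => i /(allP xs0).
move: (\prod_(_ <- _) _)%R (\sum_(_ <- _) _)%R => p s s0 p1 h.
apply: le_trans h; rewrite -subr_ge0.
have -> : (p * (1 - s) - (1 + x) * p * (1 - (x + s)) = p * (x * x + x * s))%R by ring.
by rewrite !mulr_ge0 ?addr_ge0 ?mulr_ge0 // (le_trans _ p1).
Qed.

Lemma bernoulli (x : rat) m : (0 <= x)%R -> (1 + m%:R * x <= (1 + x) ^+ m)%R.
Proof.
move=> x0; elim: m => [|m IH]; first by rewrite mul0r addr0 expr0.
rewrite exprS; apply: le_trans (_ : (1 + x) * (1 + m%:R * x) <= _)%R.
  by rewrite -subr_ge0 -natr1; have -> : ((1 + x) * (1 + m%:R * x) - (1 + (m%:R + 1) * x) = m%:R * (x * x))%R;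
    [ring | rewrite !mulr_ge0].
by rewrite ler_pM2l // ltr_pwDl.
Qed.

(** Grouping bounded terms into blocks of total between M and 2M turns a large
    sum into a large product. *)
Lemma prod1D_ge (M : rat) (xs : seq rat) : (0 < M)%R ->
  all (fun x => 0 <= x <= M)%R xs ->
  exists k, (\sum_(x <- xs) x < M * (2 * k%:R + 1))%R /\
            ((1 + M) ^+ k <= \prod_(x <- xs) (1 + x))%R.
Proof.
move=> M0 xsP.
suff [k [r [r0 rM sumP prodP]]] : exists k (r : rat), [/\ 0 <= r, r < M,
    \sum_(x <- xs) x <= 2 * M * k%:R + r
    & (1 + M) ^+ k * (1 + r) <= \prod_(x <- xs) (1 + x)]%R.
  exists k; split; first by lra.
  apply: le_trans prodP; rewrite ler_peMr ?lerDl // exprn_ge0 //; lra.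
elim: xs xsP => [|x xs IH] /=.
  by exists 0, 0%R; rewrite !big_nil expr0 !mulr0 !addr0 mulr1.
move=> /andP[/andP[x0 xM] /IH[k [r [r0 rM sumP prodP]]]]; rewrite !big_cons.
have M1 : (0 <= (1 + M) ^+ k)%R by rewrite exprn_ge0 //; lra.
have step : ((1 + x) * ((1 + M) ^+ k * (1 + r)) <= (1 + x) * \prod_(x <- xs) (1 + x))%R.
  by rewrite ler_wpM2l //; lra.
have [lt_rM|le_Mr] := ltP (r + x)%R M.
  exists k, (r + x)%R; split => //; try lra.
  apply: le_trans step; rewrite mulrCA ler_wpM2l //; nra.
exists k.+1, 0%R; split => //; first by rewrite -natr1; lra.
apply: le_trans step; rewrite addr0 mulr1 exprSr mulrCA ler_wpM2l //; nra.
Qed.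

Definition primes_from (y X : nat) : seq nat := descending (fun q => prime q && (y <= q)) X.

Lemma sum_inv_sqr y k : 2 <= y ->
  (\sum_(q <- primes_from y (y + k)) (q%:R ^+ 2)^-1
     <= (y - 1)%N%:R^-1 - (y + k - 1)%N%:R^-1 :> rat)%R.
Proof.
move=> y2; elim: k => [|k IH].
  rewrite addn0 (_ : primes_from y y = [::]) ?big_nil ?subrr //.
  apply/eqP; rewrite -size_eq0 -leqn0 leqNgt -has_predT; apply/hasPn => q.
  by rewrite mem_descending => /andP[/andP[_ ]]; rewrite leqNgt => /negPf->.
rewrite addnS /primes_from /= -/(primes_from _ _).
have step : (((y + k)%N%:R ^+ 2)^-1 <= (y + k - 1)%N%:R^-1 - (y + k)%N%:R^-1 :> rat)%R.
  have -> : y + k = (y + k - 1).+1 by lia.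
  have : 0 < y + k - 1 by lia.
  rewrite subn1 /= subn1 /=; move: (y + k).-1 => m m0.
  have m0R : (0 < m%:R :> rat)%R by rewrite ltr0n.
  rewrite -natr1; move: (m%:R)%R m0R => x x0.
  have x1 : (0 < x + 1)%R by lra.
  have -> : (x^-1 - (x + 1)^-1 = (x * (x + 1))^-1)%R.
    by field; rewrite !lt0r_neq0.
  rewrite lef_pV2 ?posrE ?mulr_gt0 ?exprn_gt0 //; nra.
have le : ((y + k - 1)%N%:R^-1 - (y + k)%N%:R^-1 >= 0 :> rat)%R.
  by apply: le_trans step; rewrite invr_ge0 exprn_ge0.
rewrite (_ : (y + k).+1 - 1 = y + k); last by lia.
case: ifP => _; last by lra.
by rewrite big_cons; lra.
Qed.

Lemma sum_inv_sqr_le y X : 2 <= y ->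
  (\sum_(q <- primes_from y X) (q%:R ^+ 2)^-1 <= (y - 1)%N%:R^-1 :> rat)%R.
Proof.
move=> y2; have [lt_Xy|le_yX] := ltnP X y; last first.
  have := sum_inv_sqr (X - y) y2; rewrite subnKC // => /le_trans; apply.
  by rewrite lerBlDr lerDl invr_ge0.
rewrite (_ : primes_from y X = [::]) ?big_nil ?invr_ge0 //.
apply/eqP; rewrite -size_eq0 -leqn0 leqNgt -has_predT; apply/hasPn => q.
by rewrite mem_descending; lia.
Qed.

Lemma reciprocal_sumE y a N : a <= N -> 0 < a ->
  reciprocal_sum y a =
  (\sum_(q <- primes_from y N.+1 | (q %| a)%N) q%:R^-1)%R.
Proof.
move=> le_aN a_gt0; rewrite /reciprocal_sum -big_filter -[RHS]big_filter; apply: perm_big.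
apply: uniq_perm; rewrite ?filter_uniq ?primes_uniq ?(uniq_desc (sorted_descending _ _)) //.
move=> q; rewrite !mem_filter mem_descending mem_primes a_gt0 /= ltnS.
have [pr|] := boolP (prime q); last by rewrite ?andbF.
have [dv|] := boolP (q %| a); last by rewrite ?andbF.
by rewrite (leq_trans (dvdn_leq a_gt0 dv)) ?andbT.
Qed.

(** Markov's inequality for the weight with z = M * y. The average weight is at
    most 16 ^ M, because the sum of 1 / q ^ 2 over q at least y is of order
    1 / y; a label that is not tame has weight at least (2 * K) ^ y, because its
    terms z / q are at most M and add up to at least M * y / D. *)
Lemma untame_rare D K : 0 < D -> 0 < K ->
  exists y1, forall y, y1 <= y -> forall N,
    K ^ y * count (fun a => ~~ tame D y a) (iota 1 N) <= N.
Proof.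
move=> D0 K0; pose M := ((2 * K) ^ (4 * D)).-1.
have M1 : M.+1 = (2 * K) ^ (4 * D) by rewrite prednK // expn_gt0 muln_gt0 K0.
have M0 : 0 < M.
  have : 2 <= M.+1; last by [].
  rewrite M1; apply: leq_trans (_ : 2 ^ 1 <= _) => //.
  apply: leq_trans (_ : 2 ^ (4 * D) <= _); first by rewrite leq_exp2l //; lia.
  by rewrite leq_exp2r; lia.
exists (4 * M + 2 * D + 3) => y le_y N.
have y_gt0 : 0 < y by lia.
pose z : rat := ((M * y)%N%:R)%R.
have z0 : (0 <= z)%R by rewrite ler0n.
pose qs := primes_from y N.+1.
have qsP q : q \in qs -> prime q /\ y <= q.
  by rewrite mem_descending => /andP[/andP[]].
have pr_qs : all prime qs by apply/allP => q /qsP[].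
have := weight_sum N z0 pr_qs (uniq_desc (sorted_descending _ _)).
have Pi_le : (\prod_(q <- qs) (1 + z / q%:R ^+ 2) <= (16 ^ M)%N%:R)%R.
  (* The term z / q ^ 2 is cut into 2 * M equal parts, so that the parts add up
     to less than one over all q. *)
  pose x q : rat := (y%:R / 2 / q%:R ^+ 2)%R.
  have x0 q : (0 <= x q)%R by rewrite !divr_ge0 // exprn_ge0.
  apply: le_trans (_ : \prod_(q <- qs) (1 + x q) ^+ (2 * M) <= _)%R.
    apply: ler_prod => q _; apply/andP; split.
      by rewrite addr_ge0 // divr_ge0 // exprn_ge0.
    apply: le_trans (bernoulli (2 * M) (x0 q)); rewrite lerD2l /x /z !natrM.
    by rewrite le_eqVlt; apply/orP; left; apply/eqP; move: (_^-1)%R => i; field.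
  rewrite prodrXl (_ : 16 ^ M = 4 ^ (2 * M)); last by rewrite expnM.
  rewrite natrX.
  have sum_x : (\sum_(q <- qs) x q <= 3 / 4)%R.
    rewrite /x -mulr_sumr; apply: le_trans (_ : y%:R / 2 * (y - 1)%N%:R^-1 <= _)%R.
      by rewrite ler_wpM2l ?sum_inv_sqr_le //; [rewrite divr_ge0 | lia].
    have -> : (y%:R = (y - 1)%N%:R + 1 :> rat)%R by rewrite natr1 subn1 prednK.
    have : (2 <= (y - 1)%N%:R :> rat)%R by rewrite (ler_nat _ 2); lia.
    move: ((y - 1)%N%:R : rat)%R => w w2; have w0 : (0 < w)%R by lra.
    by rewrite ler_pdivrMr //; lra.
  have xs_ge0 : all (fun x => 0 <= x)%R [seq x q | q <- qs].
    by rewrite all_map; apply/allP => q _ /=.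
  have h := prod1D_le xs_ge0; rewrite !big_map in h.
  have P1 : (1 <= \prod_(q <- qs) (1 + x q))%R.
    elim/big_ind: _ => // [a b a1 b1|i _]; last by rewrite lerDl.
    by rewrite -[leLHS]mulr1 ler_pM.
  apply: lerXn2r; rewrite ?nnegrE ?(le_trans _ P1) //.
  move: h P1 sum_x; move: (\sum_(_ <- _) _)%R (\prod_(_ <- _) _)%R => s p; nra.
have wild_weight a : 0 < a <= N -> ~~ tame D y a -> (((2 * K) ^ y)%N%:R <= weight z qs a :> rat)%R.
  move=> /andP[a0 aN]; rewrite /tame -ltNge (reciprocal_sumE y aN a0) -/qs => wild_a.
  pose xs := [seq (z / q%:R)%R | q <- qs & q %| a].
  have M0R : (0 < M%:R :> rat)%R by rewrite ltr0n.
  have xsP : all (fun x => 0 <= x <= M%:R)%R xs.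
    rewrite all_map; apply/allP => q; rewrite mem_filter => /andP[_ /qsP[/prime_gt0 q0 yq]] /=.
    rewrite divr_ge0 //= ler_pdivrMr ?ltr0n // -natrM ler_nat leq_mul2l yq orbT //.
  have [k [sumP prodP]] := prod1D_ge M0R xsP.
  apply: le_trans (_ : (1 + M%:R) ^+ k <= _)%R; last first.
    by apply: le_trans prodP _; rewrite big_map big_filter.
  rewrite addrC natr1 -natrX ler_nat M1 -expnM leq_pexp2l ?muln_gt0 ?K0 //.
  have : (y%:R / D%:R < 2 * k%:R + 1 :> rat)%R.
    rewrite -(ltr_pM2l M0R); apply: le_lt_trans sumP.
    rewrite big_map big_filter -mulr_sumr mulrA -natrM -/z ler_wpM2l //.
    exact: ltW.
  have D0R : (0 < D%:R :> rat)%R by rewrite ltr0n.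
  rewrite ltr_pdivrMr // -natrM natr1 -natrM ltr_nat => ltk.
  have : 2 * D <= y by lia.
  nia.
move=> h.
have cnt : (((2 * K) ^ y * count (fun a => ~~ tame D y a) (iota 1 N))%N%:R <=
    \sum_(1 <= a < N.+1) weight z qs a)%R.
  have w0 a : (0 <= weight z qs a)%R by apply: prodr_ge0 => q _; rewrite addr_ge0 // divr_ge0.
  rewrite (bigID (tame D y)) /= -[leLHS]add0r lerD ?sumr_ge0 //.
  rewrite -sum1_count natrM natr_sum mulr_sumr /index_iota subn1 /=.
  rewrite big_seq_cond [leRHS]big_seq_cond; apply: ler_sum => a /andP[].
  by rewrite mem_iota mulr1 => a_iota ?; apply: wild_weight => //; lia.
have := le_trans cnt (le_trans h (ler_wpM2l (ler0n _ _) Pi_le)).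
rewrite -natrM ler_nat expnMn => {}h.
have : 16 ^ M <= 2 ^ y by rewrite (_ : 16 ^ M = 2 ^ (4 * M)); [rewrite leq_exp2l //; lia | rewrite expnM].
have : 0 < 2 ^ y by rewrite expn_gt0.
by move: (2 ^ y) (16 ^ M) (K ^ y) h => a b c; move: (count _ _) => d h a0 ba; nia.
Qed.

(** * Counting labels *)

Definition small_primes (y : nat) : seq nat := descending (fun q => prime q && odd q) y.

Lemma mem_small_primes y q : (q \in small_primes y) = [&& prime q, odd q & q < y].
Proof. by rewrite mem_descending andbA. Qed.

Lemma size_descending P y : size (descending P y) <= y.
Proof. by elim: y => //= y IH; case: ifP => _ //=; apply: leq_trans IH _. Qed.

Lemma coprime_period ps q : prime q -> odd q -> all prime ps -> q \notin ps ->
  coprime (code_period ps) q.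
Proof.
move=> pr_q odd_q; elim: ps => [|p ps IH] /=; first by rewrite coprime2n.
move=> /andP[pr_p pr_ps]; rewrite inE negb_or => /andP[qp q_ps].
by rewrite !coprimeMl IH // coprime2n odd_q andbT /= coprime_sym prime_coprime // dvdn_prime2.
Qed.

Lemma odd_coprimes_small y : odd_coprimes (small_primes y).
Proof.
rewrite /small_primes; elim: y => //= y IH; case: ifP => //= /andP[pr_y odd_y].
rewrite odd_y IH andbT coprime_period //=.
- by have := prime_gt1 pr_y; case: y odd_y {IH pr_y} => [|[|[]]].
- by apply/allP => q; rewrite mem_descending => /andP[/andP[]].
by rewrite mem_descending ltnn andbF.
Qed.

Lemma coprime_small_period y q : prime q -> 2 < q -> y <= q ->
  coprime (code_period (small_primes y)) q.
Proof.
move=> pr_q q2 yq; apply: coprime_period => //.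
- by have [q_eq2|//] := even_prime pr_q; rewrite q_eq2 in q2.
- by apply/allP => p; rewrite mem_small_primes => /and3P[].
by rewrite mem_small_primes ltnNge yq !andbF.
Qed.

Lemma code_periodE ps : code_period ps = 2 * 2 ^ size ps * \prod_(p <- ps) p.
Proof.
by elim: ps => [|p ps IH] /=; rewrite ?big_nil // big_cons IH expnS; lia.
Qed.

(** The product of (p - 2) / p telescopes over all odd numbers, so the rough
    labels make up at least one part in y + 1 of each bucket. *)
Lemma prod_small_le y : \prod_(p <- small_primes y) p <= y.+1 * \prod_(p <- small_primes y) (p - 2).
Proof.
suff: \prod_(p <- small_primes y) p <= (if y < 2 then 1 else 2 * y./2 - 1) * \prod_(p <- small_primes y) (p - 2).
  by move/leq_trans; apply; rewrite leq_mul2r; case: ifP => _; lia.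
rewrite /small_primes; elim: y => [|y IH] /=; first by rewrite !big_nil.
case: ifP => [/andP[pr_y odd_y]|_]; last first.
  apply: leq_trans IH _; rewrite leq_mul2r; apply/orP; right.
  by case: ifP; case: ifP; lia.
rewrite !big_cons; have y2 : 2 < y.
  by have := prime_gt1 pr_y; case: y odd_y {IH pr_y} => [|[|[]]].
rewrite (_ : y < 2 = false) in IH; last by lia.
rewrite (_ : y.+1 < 2 = false); last by lia.
rewrite (_ : 2 * (uphalf y) - 1 = y); last by lia.
rewrite leq_mul2l; apply/orP; right; apply: leq_trans IH _.
by rewrite leq_mul2r; apply/orP; right; lia.
Qed.

Lemma code_period_le y : 0 < y -> code_period (small_primes y) <= 2 * (2 * y) ^ y.
Proof.
move=> y0; rewrite code_periodE -mulnA leq_mul2l /= expnMn leq_mul //.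
  by rewrite leq_exp2l // size_descending.
apply: leq_trans (_ : y ^ size (small_primes y) <= _); last first.
  by rewrite leq_pexp2l // size_descending.
have: {in small_primes y, forall p, p <= y}.
  by move=> p; rewrite mem_small_primes => /and3P[_ _ /ltnW].
elim: small_primes => [|p ps IH] le_y; first by rewrite big_nil.
rewrite big_cons expnS leq_mul ?le_y ?mem_head // IH // => q q_ps.
by rewrite le_y // inE q_ps orbT.
Qed.

Lemma bucket_ge y b u x n : size u = size (small_primes y) ->
  \prod_(p <- small_primes y) p * (n %/ code_period (small_primes y)) <=
  count (bucket (small_primes y) b u) (iota x n).
Proof.
move=> sz_u; have ok := odd_coprimes_small y.
rewrite -(count_bucket b ok sz_u); apply: count_periodic_ge => a.
by rewrite -{1}[code_period _]mul1n bucket_period.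
Qed.

Lemma bucket_le y b u x n : size u = size (small_primes y) ->
  count (bucket (small_primes y) b u) (iota x n) <=
  \prod_(p <- small_primes y) p * (n %/ code_period (small_primes y)).+1.
Proof.
move=> sz_u; have ok := odd_coprimes_small y.
rewrite -(count_bucket b ok sz_u); apply: count_periodic_le => [|a].
  exact: code_period_gt0.
by rewrite -{1}[code_period _]mul1n bucket_period.
Qed.

Lemma bucket_rough_ge y b u x n : size u = size (small_primes y) ->
  \prod_(p <- small_primes y) p * (n %/ code_period (small_primes y)) <=
  y.+1 * count (fun a => bucket (small_primes y) b u a && rough (small_primes y) a) (iota x n).
Proof.
move=> sz_u; have ok := odd_coprimes_small y.
pose A a := bucket (small_primes y) b u a && rough (small_primes y) a.
have perA a : A (a + code_period (small_primes y)) = A a.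
  by rewrite /A -{1 2}[code_period _]mul1n bucket_period // roughDM.
have := count_periodic_ge x n perA; have := count_bucket_rough b ok sz_u; have := prod_small_le y.
rewrite -/A; set P := \prod_(p <- _) p; set Q := \prod_(p <- _) (p - 2); set h := n %/ _.
set c0 := count A (iota 0 _); set c1 := count A _ => hP hQ hc; apply: leq_trans (_ : y.+1 * Q * h <= _); first by rewrite leq_mul2r hP orbT.
by rewrite -mulnA leq_mul2l; apply/orP; right; apply: leq_trans hc; rewrite leq_mul2r hQ orbT.
Qed.

(** A prime q at least y is coprime to the period, so its multiples are spread
    over the buckets like the labels themselves. *)
Lemma bucket_multiples_le y b u x n q : size u = size (small_primes y) ->
  prime q -> 2 < q -> y <= q ->
  count (fun a => bucket (small_primes y) b u a && (q %| a)) (iota x n) <=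
  \prod_(p <- small_primes y) p * (n %/ code_period (small_primes y) %/ q).+1.
Proof.
move=> sz_u pr_q q2 yq; have ok := odd_coprimes_small y.
set L := code_period _; set A := bucket _ b u.
have perA a k : A (a + k * L) = A a by rewrite /A bucket_period.
have L0 : 0 < L := code_period_gt0 ok; have q0 := prime_gt0 pr_q.
have co := coprime_small_period pr_q q2 yq.
have EL : count (fun a => A a && (q %| a)) (iota 0 (L * q)) = \prod_(p <- small_primes y) p.
  rewrite -(count_bucket b ok sz_u) -/L -/A -[RHS]muln1.
  have <- : count (fun a => a == 0) (iota 0 q) = 1.
    by rewrite (eq_count (a2 := fun a => a < 1)) ?count_lt_iota // => a; rewrite ltnS leqn0.
  rewrite -(count_chinese A (fun a => a == 0)) //; apply: eq_count => a.
  by rewrite {1}(divn_eq a L) addnC perA.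
rewrite -divnMA -EL; apply: count_periodic_le; first by rewrite muln_gt0 L0.
by move=> a; rewrite (mulnC L) perA dvdn_addl // dvdn_mulr.
Qed.

Definition share (y c a : nat) : bool := has (fun p => (y <= p) && (p %| a)) (primes c).

Lemma coprime_split y c a : 0 < c -> 0 < a -> odd c || odd a ->
  (forall p, p \in small_primes y -> p %| c -> ~~ (p %| a)) ->
  ~~ share y c a -> coprime c a.
Proof.
move=> c0 a0 odd_ca small big; rewrite coprime_has_primes //; apply/hasPn => p.
rewrite !mem_primes c0 a0 /= => /andP[pr_p pa]; rewrite pr_p /=; apply/negP => pc.
have [p2|odd_p] := even_prime pr_p.
  by move: odd_ca pa pc; rewrite p2 !dvdn2; case: odd; case: odd.
have [lt_py|le_yp] := ltnP p y.
  by have := small p; rewrite mem_small_primes pr_p odd_p lt_py pa => /(_ isT pc).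
by move/hasPn: big => /(_ p); rewrite mem_primes pr_p c0 pc le_yp pa => /(_ isT).
Qed.

Lemma share_sym y c a : 0 < c -> 0 < a -> share y c a = share y a c.
Proof.
move=> c0 a0; apply/hasP/hasP => -[p]; rewrite mem_primes => /and3P[pr _ d1] /andP[yp d2];
  by exists p; rewrite ?mem_primes ?pr ?c0 ?a0 ?d1 ?d2 ?yp.
Qed.

Lemma count_has (I : Type) (T : eqType) (ps : seq T) (P : pred T) (A : pred I) (B : T -> pred I) s :
  count (fun a => A a && has (fun p => P p && B p a) ps) s <=
  \sum_(p <- ps | P p) count (fun a => A a && B p a) s.
Proof.
elim: ps => [|p ps IH].
  by rewrite big_nil (eq_count (a2 := pred0)) ?count_pred0 // => a; rewrite /= andbF.
rewrite big_cons; case: ifP => Pp; last by rewrite /= (eq_count (a2 := fun a => A a && has (fun p => P p && B p a) ps)) // => a; rewrite Pp.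
apply: leq_trans (leq_add (leqnn _) IH).
rewrite -count_predUI; apply: leq_trans (leq_addr _ _).
by apply: sub_count => a /=; rewrite Pp /=; case: (A a).
Qed.

(** For each prime p at least y dividing c, the multiples of p are about one
    p-th of the bucket; tameness bounds the sum of these shares by one D-th. The
    term D * t pays for rounding: c has at most t prime divisors. *)
Lemma bucket_share_le D y b u n t c : size u = size (small_primes y) ->
  0 < D -> 2 < y -> 0 < c -> c < 2 ^ t -> tame D y c ->
  D * count (fun a => bucket (small_primes y) b u a && share y c a) (iota 1 n) <=
  \prod_(p <- small_primes y) p * (n %/ code_period (small_primes y) + D * t).
Proof.
move=> sz_u D0 y2 c0 ct nc; set P0 := \prod_(_ <- _) _; set h := n %/ _.
have step : count (fun a => bucket (small_primes y) b u a && share y c a) (iota 1 n) <=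
    \sum_(p <- primes c | y <= p) P0 * (h %/ p).+1.
  apply: leq_trans (count_has _ _ _ _ _) _.
  rewrite big_seq_cond [leqRHS]big_seq_cond; apply: leq_sum => p /andP[].
  by rewrite mem_primes => /and3P[pr_p _ _] yp; apply: bucket_multiples_le => //; lia.
apply: leq_trans (leq_mul (leqnn D) step) _.
rewrite -big_distrr /= mulnCA leq_mul2l; apply/orP; right.
rewrite (eq_bigr (fun p => h %/ p + 1)); last by move=> p _; rewrite addn1.
rewrite big_split /= mulnDr leq_add // ?leq_mul2l.
  rewrite -(ler_nat rat) natrM natr_sum.
  have D0R : (0 < D%:R :> rat)%R by rewrite ltr0n.
  apply: le_trans (_ : D%:R * (h%:R * reciprocal_sum y c) <= _)%R.
    rewrite ler_wpM2l // /reciprocal_sum mulr_sumr big_seq_cond [leRHS]big_seq_cond.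
    apply: ler_sum => p /andP[]; rewrite mem_primes => /and3P[pr_p _ _] _.
    by rewrite ler_pdivlMr ?ltr0n ?prime_gt0 // -natrM ler_nat leq_divM.
  rewrite mulrCA -[leRHS]mulr1 ler_wpM2l // -ler_pdivlMl // mulr1; exact: nc.
apply/orP; right; rewrite sum1_count; apply: leq_trans (count_size _ _) _.
have : 2 ^ size (primes c) <= c.
  rewrite [leqRHS](prod_prime_decomp c0) prime_decompE big_map /=.
  have: {in primes c, forall p, 2 <= p ^ logn p c}.
    move=> p p_c; move: (p_c); rewrite mem_primes => /and3P[pr_p _ _].
    apply: leq_trans (prime_gt1 pr_p) _; rewrite -{1}(expn1 p) leq_exp2l ?prime_gt1 //.
    by rewrite logn_gt0.
  elim: (primes c) => [|p ps IH] ge2; first by rewrite big_nil.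
  rewrite big_cons /= expnS leq_mul ?ge2 ?mem_head // IH // => q qps.
  by rewrite ge2 // inE qps orbT.
by move=> /leq_ltn_trans/(_ ct); rewrite ltn_exp2l // => /ltnW.
Qed.

Lemma size_large_primes y M w : 16 <= y -> 0 < M -> M < 16 ^ w ->
  count (fun p => y <= p) (primes M) <= w.
Proof.
move=> y16 M0 Mw; rewrite -ltnS -(@ltn_exp2l 16) //; apply: leq_ltn_trans (_ : M < _); last first.
  by apply: ltn_trans Mw _; rewrite ltn_exp2l.
rewrite [leqRHS](prod_prime_decomp M0) prime_decompE big_map /=.
have: {in primes M, forall p, (if y <= p then 16 else 1) <= p ^ logn p M}.
  move=> p p_c; move: (p_c); rewrite mem_primes => /and3P[pr_p _ _].
  case: ifP => yp; last by rewrite expn_gt0 prime_gt0.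
  apply: leq_trans (leq_trans y16 yp) _; rewrite -{1}(expn1 p) leq_exp2l ?prime_gt1 //.
  by rewrite logn_gt0.
elim: (primes M) => [|p ps IH] ge2; first by rewrite big_nil.
rewrite big_cons /= expnD leq_mul //.
  by have := ge2 p (mem_head _ _); case: (y <= p).
by rewrite IH // => q qps; rewrite ge2 // inE qps orbT.
Qed.

(** The sieve with all odd primes below y and all odd primes dividing M. There
    are at most w of the latter that are at least y, because y is at least 16. *)
Lemma pool_ge y b M H w : 16 <= y -> 0 < M -> M < 16 ^ w -> b || odd M ->
  H %/ 4 <= (y + w).+1 *
    (count (fun a => [&& odd a == b, rough (small_primes y) a & coprime a M]) (iota 1 H)
       + 2 ^ (y + w)).
Proof.
move=> y16 M0 Mw bM; set k := H %/ 4.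
pose qs := descending (fun q => prime q && odd q && ((q < y) || (q %| M))) (M + y).+1.
have qsP q : (q \in qs) = [&& prime q, odd q & (q < y) || (q %| M)].
  rewrite mem_descending -!andbA; case: (prime q); case: (odd q) => //=.
  case: ltnP => /= [qy|yq]; first by rewrite ltnS; apply/idP; lia.
  by case dv: (q %| M) => //=; have := dvdn_leq M0 dv; lia.
have sz_qs : size qs <= y + w.
  rewrite -(count_predC (fun p => p < y)) leq_add //.
    rewrite -size_filter -[leqRHS](size_iota 0).
    apply: uniq_leq_size => [|q]; first by rewrite filter_uniq // uniq_desc ?sorted_descending.
    by rewrite mem_filter mem_iota => /andP[].
  apply: leq_trans (size_large_primes y16 M0 Mw).
  rewrite -!size_filter; apply: uniq_leq_size => [|q].
    by rewrite filter_uniq // uniq_desc ?sorted_descending.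
  rewrite !mem_filter /= -leqNgt qsP mem_primes M0 /= => /andP[yq /and3P[-> _]].
  by rewrite yq ltnNge yq.
have := @count_odd_sieved qs k (sorted_descending _ _).
have pr_qs : all prime qs by apply/allP => q; rewrite qsP => /and3P[].
have odd_qs : all odd qs by apply/allP => q; rewrite qsP => /and3P[].
move=> /(_ pr_qs odd_qs) /leq_trans; apply; apply: leq_mul; first by rewrite ltnS.
apply: leq_add; last by rewrite leq_exp2l.
pose m := if b then 1 else 2; pose f i := m * (1 + i * 2).
have m0 : 0 < m by rewrite /m; case: b {bM m f}.
rewrite -(size_filter _ (iota 0 k)) -(size_filter _ (iota 1 H)) -(size_map f).
apply: uniq_leq_size => [|a].
  rewrite map_inj_uniq ?filter_uniq ?iota_uniq // => i j /eqP.
  by rewrite /f eqn_mul2l; lia.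
case/mapP => i; rewrite mem_filter mem_iota /= add0n => /andP[sv lt_i] ->.
have odd_f : odd (f i) == b by rewrite /f /m oddM oddD muln2 odd_double; case: (b).
rewrite mem_filter odd_f mem_iota /=.
have nd q : q \in qs -> ~~ (q %| f i).
  move=> q_qs; move: (q_qs); rewrite qsP => /and3P[pr_q odd_q _].
  rewrite /f Euclid_dvdM // negb_or (allP sv) // andbT.
  by rewrite /m; case: (b); rewrite ?dvdn1 ?dvdn_prime2 //; case: eqP odd_q pr_q => // ->.
have -> /= : rough (small_primes y) (f i).
  apply/allP => q; rewrite mem_small_primes => /and3P[pr_q odd_q qy].
  by apply: nd; rewrite qsP pr_q odd_q qy.
have -> /= : coprime (f i) M.
  rewrite coprime_sym coprime_has_primes //; last by rewrite muln_gt0 m0.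
  apply/hasPn => q; rewrite mem_primes => /and3P[pr_q _ qf]; rewrite mem_primes pr_q M0 /=.
  have [q2|odd_q] := even_prime pr_q; last first.
    by apply: contraL qf => qM; apply: nd; rewrite qsP pr_q odd_q qM orbT.
  move: qf; rewrite q2 !dvdn2; move/eqP: odd_f bM => ->.
  by case: (b) => //= ->.
by move: lt_i; rewrite /f /m /k; case: (b); lia.
Qed.

(** * Rooted forests on an initial segment *)

Section Forest.
Variable n : nat.
Implicit Types (g h : 'I_n -> option 'I_n) (v u x : 'I_n).

(** A forest on the vertices 0, ..., n - 1 is given by a parent map that
    decreases the index, so that induction and greedy choices follow the index. *)
Definition descends g := forall v u, g v = Some u -> u < v.

(** Iterating n times is enough fuel to reach a root. *)
Fixpoint climb g k v : 'I_n :=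
  if k is k'.+1 then if g v is Some u then climb g k' u else v else v.

Definition top g v := climb g n v.

Fixpoint climb_parity g k v : bool :=
  if k is k'.+1 then if g v is Some u then ~~ climb_parity g k' u else false else false.

Definition side g v := climb_parity g n v.

Lemma climb_fuel g j k v : descends g -> v <= j -> v <= k ->
  climb g j v = climb g k v /\ climb_parity g j v = climb_parity g k v.
Proof.
move=> gd; elim: j k v => [|j IH] [|k] v //=; rewrite ?leqn0.
- by move=> /eqP v0 _; case gv: (g v) => [u|] //; have := gd _ _ gv; rewrite v0.
- by move=> _ /eqP v0; case gv: (g v) => [u|] //; have := gd _ _ gv; rewrite v0.
move=> vj vk; case gv: (g v) => [u|] //; have uv := gd _ _ gv.
by have [|| -> ->] := IH k u; [lia | lia |].
Qed.

Lemma topE g v : descends g -> top g v = if g v is Some u then top g u else v.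
Proof.
move=> gd; rewrite /top; have [-> _] := climb_fuel (k := n.+1) gd (ltnW (ltn_ord v)) (leqW (ltnW (ltn_ord v))).
by [].
Qed.

Lemma sideE g v : descends g -> side g v = if g v is Some u then ~~ side g u else false.
Proof.
move=> gd; rewrite /side; have [_ ->] := climb_fuel (k := n.+1) gd (ltnW (ltn_ord v)) (leqW (ltnW (ltn_ord v))).
by [].
Qed.

Lemma ord_lt_ind (P : 'I_n -> Prop) :
  (forall v, (forall u, u < v -> P u) -> P v) -> forall v, P v.
Proof.
move=> step v; have [m] := ubnP (v : nat); elim: m v => // m IH v vm.
by apply: step => u uv; apply: IH; apply: leq_trans uv _.
Qed.

Lemma top_le g v : descends g -> top g v <= v.
Proof.
move=> gd; elim/ord_lt_ind: v => v IH; rewrite topE //.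
by case gv: (g v) => [u|] //; have uv := gd _ _ gv; apply: leq_trans (IH _ uv) (ltnW uv).
Qed.

Lemma eq_top g h v : descends g -> descends h -> (forall u, u <= v -> g u = h u) ->
  top g v = top h v.
Proof.
move=> gd hd; elim/ord_lt_ind: v => v IH gh; rewrite !topE // -gh //.
by case gv: (g v) => [u|] //; have uv := gd _ _ gv; apply: IH => // w wu; apply: gh; lia.
Qed.

(** * Cutting a forest into small pieces *)

Definition prune g (C : {set 'I_n}) v : option 'I_n :=
  if g v is Some u then if u \in C then None else Some u else None.

Lemma descends_prune g C : descends g -> descends (prune g C).
Proof. by move=> gd v u; rewrite /prune; case gv: (g v) => [w|] //; case: ifP => // _ [<-]; apply: gd. Qed.

(** The last vertex is light enough to be merged into its parent, or heavy enough
    to be cut off and pay for itself; weights make this an induction on the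
    number of vertices. *)
Lemma cut_weighted g s k (w : 'I_n -> nat) : descends g -> k <= n ->
  exists C : {set 'I_n},
    [/\ forall v, v \in C -> v < k,
        s.+1 * #|C| <= \sum_(v : 'I_n | v < k) w v &
        forall x, \sum_(v : 'I_n | (v < k) && (v \notin C) && (top (prune g C) v == x)) w v <= s].
Proof.
move=> gd; elim: k w => [|k IH] w lt_kn.
  exists set0; split=> [v|//|x]; [by rewrite inE | by rewrite cards0 muln0 |].
  by rewrite big_pred0.
pose v0 := Ordinal lt_kn.
have ltS (v : 'I_n) : (v < k.+1) = (v == v0) || (v < k).
  by rewrite ltnS leq_eqVlt.
have v0k (v : 'I_n) : (v != v0) && (v < k.+1) = (v < k).
  by rewrite ltS; case: eqVneq => //= ->; rewrite ltnn.
have [le_ws|lt_sw] := leqP (w v0) s; last first.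
  have [C [Ck szC smallC]] := IH w (ltnW lt_kn).
  have v0C : v0 \notin C by apply/negP => /Ck; rewrite ltnn.
  exists (v0 |: C); split=> [v||x].
  - by rewrite !inE ltS => /orP[->|/Ck ->] //; rewrite orbT.
  - rewrite cardsU1 v0C mulnDr muln1 (bigD1 v0) //= leq_add //.
    by apply: leq_trans szC _; apply: eq_leq; apply: eq_bigl => v; rewrite andbC v0k.
  apply: leq_trans (smallC x); apply: eq_leq; apply: eq_bigl => v.
  rewrite !inE negb_or ltS; case: eqVneq => /= [->|_]; first by rewrite ltnn.
  case: ltnP => //= vk; case: (v \in C) => //=; congr (_ == _).
  apply: eq_top; try exact: descends_prune.
  move=> u uv; rewrite /prune; case gu: (g u) => [z|] //; have zu := gd _ _ gu.
  by rewrite !inE (_ : z == v0 = false) //; apply/eqP => zv; rewrite zv /= in zu; lia.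
pose w' v := w v + (if g v0 == Some v then w v0 else 0).
have [C [Ck szC smallC]] := IH w' (ltnW lt_kn).
have v0C : v0 \notin C by apply/negP => /Ck; rewrite ltnn.
exists C; split=> [v /Ck /ltnW //||x].
  apply: leq_trans szC _; rewrite big_split (bigD1 v0 (P := fun v : 'I_n => v < k.+1)) //= addnC.
  apply: leq_add; last by apply: eq_leq; apply: eq_bigl => v; rewrite andbC v0k.
  case gv: (g v0) => [u|]; last by rewrite big1.
  rewrite -big_mkcondr (big_pred1 u) // => v /=.
  by rewrite (inj_eq Some_inj) eq_sym; case: eqVneq => [->|]; rewrite ?andbF //= (gd _ _ gv).
have topk (v : 'I_n) : v < k -> (top (prune g C) v == v0) = false.
  move=> vk; apply/eqP => tv; have := top_le v (descends_prune (C := C) gd).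
  by rewrite tv /=; lia.
have le_ww' : \sum_(v : 'I_n | (v < k) && (v \notin C) && (top (prune g C) v == x)) w v <=
  \sum_(v : 'I_n | (v < k) && (v \notin C) && (top (prune g C) v == x)) w' v.
  by apply: leq_sum => v _; apply: leq_addr.
have [tx|tx] := eqVneq (top (prune g C) v0) x; last first.
  apply: leq_trans (smallC x); apply: leq_trans le_ww'; apply: eq_leq; apply: eq_bigl => v.
  rewrite ltS; case: eqVneq => //= ->; rewrite v0C ltnn /=; exact/negbTE.
rewrite (bigD1 v0) /=; last by rewrite ltnS leqnn v0C tx eqxx.
rewrite (eq_bigl (fun v : 'I_n => (v < k) && (v \notin C) && (top (prune g C) v == x))); last first.
  by move=> v; rewrite -v0k andbC; case: (v != v0); case: (v < k.+1).
case gv: (prune g C v0) => [u|]; last first.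
  move: tx; rewrite topE ?gv => [<-|]; last exact: descends_prune.
  by rewrite big_pred0 ?addn0 // => v; case: ltnP => //= /topk->; rewrite andbF.
have [gv0 uC] : g v0 = Some u /\ u \notin C.
  by move: gv; rewrite /prune; case: (g v0) => // z; case: ifP => // /negbT zC [<-].
have uk : u < k := gd _ _ gv0.
apply: leq_trans (smallC x); rewrite addnC big_split /= leq_add //.
rewrite (bigD1 u) /=; last first.
  by rewrite uk uC -tx (topE v0) ?gv ?eqxx //; exact: descends_prune.
by rewrite gv0 eqxx leq_addr.
Qed.

Lemma cut_forest g s : descends g ->
  exists C : {set 'I_n}, s.+1 * #|C| <= n /\
    forall x, #|[set v | (v \notin C) && (top (prune g C) v == x)]| <= s.
Proof.
move=> gd; have [C [_ szC smallC]] := cut_weighted s (fun=> 1) gd (leqnn n).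
exists C; split=> [|x].
  apply: leq_trans szC _; rewrite (eq_bigl predT) ?sum1_card ?card_ord // => v.
  by rewrite ltn_ord.
apply: leq_trans (smallC x); rewrite -sum1_card; apply: eq_leq; apply: eq_bigl => v.
by rewrite inE ltn_ord.
Qed.

End Forest.

(** * Dealing types evenly *)

(** Within each type the elements are dealt in turn. *)
Lemma round_robin (P K : finType) (tau : P -> K) B : 0 < B ->
  exists sigma : P -> 'I_B, forall k b,
    #|[set x | tau x == k]| <= B * #|[set x | (tau x == k) && (sigma x == b)]| + B /\
    B * #|[set x | (tau x == k) && (sigma x == b)]| <= #|[set x | tau x == k]| + B.
Proof.
move=> B0; pose e x := enum [set x' | tau x' == tau x].
exists (fun x => Ordinal (ltn_pmod (index x (e x)) B0)) => k b.
set m := #|[set x | tau x == k]|.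
pose A := enum [set x | tau x == k].
have mA : m = size A by rewrite /m cardE.
have mapA : map (index^~ A) A = iota 0 m.
  rewrite mA; apply: (@eq_from_nth _ 0); rewrite size_map ?size_iota // => i lt_i.
  have x0 : P by case: {+}A lt_i => [|x].
  by rewrite (nth_map x0) // nth_iota // index_uniq ?enum_uniq.
have -> : #|[set x | (tau x == k) && (Ordinal (ltn_pmod (index x (e x)) B0) == b)]| =
    count (fun i => i %% B == b) (iota 0 m).
  rewrite -mapA count_map -size_filter cardE; apply/perm_size/uniq_perm.
  - exact: enum_uniq.
  - by rewrite filter_uniq // enum_uniq.
  move=> x; rewrite mem_filter !mem_enum !inE; case: eqVneq => xk; rewrite ?andbF //= ?andbT.
  by rewrite -val_eqE /= /e xk.
have per (i : nat) : ((i + B) %% B == b) = (i %% B == b) by rewrite modnDr.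
have one : count (fun i => i %% B == b) (iota 0 B) = 1.
  rewrite (@eq_in_count _ _ (pred1 (b : nat))); last first.
    by move=> i; rewrite mem_iota /= => lt_i; rewrite modn_small.
  by rewrite count_uniq_mem ?iota_uniq // mem_iota ltn_ord.
have := count_periodic_ge 0 m per; have := count_periodic_le 0 m B0 per.
rewrite one !mul1n; have := leq_divM m B; have := ltn_ceil m B0.
move: (count _ _) (m %/ B) => c q; nia.
Qed.

(** * Greedy choice *)

Lemma greedy_choice n (S : pred 'I_n) (f0 : 'I_n -> nat) (Lam : 'I_n -> seq nat)
    (bad : 'I_n -> nat -> ('I_n -> nat) -> bool) :
  (forall (v : 'I_n) a f f', (forall u : 'I_n, ~~ S u || (u < v) -> f u = f' u) -> bad v a f = bad v a f') ->
  (forall (v : 'I_n) f, S v -> (forall u : 'I_n, ~~ S u -> f u = f0 u) ->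
     (forall u : 'I_n, S u -> u < v -> f u \in Lam u) ->
     count (fun a => bad v a f) (Lam v) +
     count (fun a => [exists u : 'I_n, [&& S u, u < v & f u == a]]) (Lam v) < size (Lam v)) ->
  exists f : 'I_n -> nat,
    (forall v, ~~ S v -> f v = f0 v) /\
    forall v : 'I_n, S v -> [/\ f v \in Lam v, ~~ bad v (f v) f
                     & forall u : 'I_n, S u -> u < v -> f u != f v].
Proof.
move=> bad_ext room.
suff step k : k <= n -> exists f : 'I_n -> nat,
    (forall v, ~~ S v -> f v = f0 v) /\
    forall v : 'I_n, v < k -> S v -> [/\ f v \in Lam v, ~~ bad v (f v) f
                     & forall u : 'I_n, S u -> u < v -> f u != f v].
  have [f [f_off f_on]] := step n (leqnn n).
  by exists f; split=> // v; apply: f_on.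
elim: k => [|k IH] lt_kn; first by exists f0; split.
have [f [f_off f_on]] := IH (ltnW lt_kn).
pose v0 := Ordinal lt_kn; have [Sv0|nSv0] := boolP (S v0); last first.
  exists f; split=> // v; rewrite ltnS leq_eqVlt => /orP[/eqP vk|]; last exact: f_on.
  by rewrite (_ : v = v0) ?(negPf nSv0) //; apply: val_inj.
have f_lt (u : 'I_n) : S u -> u < v0 -> f u \in Lam u.
  by move=> Su uk; have [] := f_on u uk Su.
have /hasP[a aL /norP[a_ok a_new]] : has (predC (predU (fun a => bad v0 a f)
     (fun a => [exists u : 'I_n, [&& S u, u < v0 & f u == a]]))) (Lam v0).
  rewrite has_predC; apply/negP; rewrite all_count => /eqP all_bad.
  by have := room v0 f Sv0 f_off f_lt; rewrite -count_predUI all_bad ltnNge leq_addr.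
pose f1 v := if v == v0 then a else f v.
have f1f (u : 'I_n) : u < k -> f1 u = f u by rewrite /f1; case: eqVneq => // ->; rewrite ltnn.
have f1off u : ~~ S u -> f1 u = f u by rewrite /f1; case: eqVneq => // ->; rewrite Sv0.
have f1v0 : f1 v0 = a by rewrite /f1 eqxx.
have ext (v : 'I_n) b : v <= k -> bad v b f1 = bad v b f.
  move=> vk; apply: bad_ext => u /orP[/f1off //|uv]; apply: f1f; lia.
exists f1; split=> [v nSv|v]; first by rewrite f1off ?f_off.
rewrite ltnS leq_eqVlt => /orP[/eqP vk|vk] Sv.
  have {v vk Sv}-> : v = v0 by apply: val_inj.
  rewrite f1v0 ext //; split=> // u Su uk; rewrite f1f //; apply: contraNneq a_new => fu.
  by apply/existsP; exists u; rewrite Su uk fu eqxx.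
have [fL fok fnew] := f_on v vk Sv; rewrite ext ?(ltnW vk) // f1f //; split=> // u Su uv.
by rewrite f1f ?fnew //; lia.
Qed.

(** * Repairing a matching by swaps *)

(** A permutation of Q within the classes with the largest number of good
    vertices is good everywhere: for a bad vertex q, the hypothesis leaves some
    r in its class such that exchanging the images of q and r makes both good. *)
Lemma swap_repair (T : finType) (K : eqType) (cl : T -> K) (Q : {set T}) (bad : T -> T -> bool) :
  (forall q x, q \in Q -> x \in Q -> cl x = cl q ->
    #|[set q' in Q | (cl q' == cl q) && bad q q']| + #|[set q' in Q | (cl q' == cl q) && bad q' x]|
      < #|[set q' in Q | cl q' == cl q]|) ->
  exists pi : {perm T},
    [/\ forall v, v \notin Q -> pi v = v,
        forall q, q \in Q -> pi q \in Q /\ cl (pi q) = cl q &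
        forall q, q \in Q -> ~~ bad q (pi q)].
Proof.
move=> room.
pose adm (pi : {perm T}) := [forall v, if v \in Q then (pi v \in Q) && (cl (pi v) == cl v) else pi v == v].
pose good (pi : {perm T}) := #|[set q in Q | ~~ bad q (pi q)]|.
pose one : {perm T} := 1%g.
have adm1 : adm one by apply/forallP => v; rewrite /one perm1; case: ifP => [->|_]; rewrite eqxx.
case: (@arg_maxnP _ one adm good adm1) => pi adm_pi max_pi.
have pi_off v : v \notin Q -> pi v = v.
  by have := forallP adm_pi v; case: ifP => // _ /eqP.
have pi_on q : q \in Q -> pi q \in Q /\ cl (pi q) = cl q.
  by have := forallP adm_pi q; case: ifP => // _ /andP[? /eqP ?].
exists pi; split=> // q qQ; apply/negP => bad_q.
have [xQ clx] := pi_on q qQ.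
have := room q (pi q) qQ xQ clx.
set A := [set q' in Q | (cl q' == cl q) && bad q (pi q')].
have -> : #|[set q' in Q | (cl q' == cl q) && bad q q']| = #|A|.
  rewrite -(card_imset (mem A) (@perm_inj _ pi)); congr #|pred_of_set _|.
  apply/setP => z; apply/idP/imsetP => [|[z' z'A ->]].
    rewrite inE => /and3P[zQ clz badz]; exists (pi^-1 z)%g; last by rewrite permKV.
    have yQ : (pi^-1 z)%g \in Q.
      by apply: contraLR zQ => yQ; rewrite -(permKV pi z) pi_off.
    have [_] := pi_on _ yQ; rewrite permKV => cly.
    by rewrite inE yQ permKV -cly clz.
  move: z'A; rewrite [in X in X -> _]inE => /and3P[z'Q clz' badz']; have [pQ clp] := pi_on _ z'Q.
  by rewrite inE pQ clp clz' badz'.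
set B := [set q' in Q | (cl q' == cl q) && bad q' (pi q)]; set C := [set q' in Q | _] => lt_C.
have /subsetPn[r rC rAB] : ~~ (C \subset A :|: B).
  by apply: contraL lt_C => /subset_leq_card; rewrite -leqNgt => /leq_trans; apply; rewrite leq_card_setU.
move: rC rAB; rewrite !inE => /andP[rQ clr]; rewrite rQ clr /= => /norP[ok1 ok2].
have rq : r != q by apply: contraNneq ok1 => ->.
pose pi' := (tperm q r * pi)%g.
have pi'E z : pi' z = if z == q then pi r else if z == r then pi q else pi z.
  by rewrite permM; case: tpermP => [->|->|/eqP/negPf-> /eqP/negPf->]; rewrite ?eqxx ?(negPf rq).
have adm' : adm pi'.
  apply/forallP => z; rewrite pi'E; have [rQ' clr'] := pi_on r rQ.
  case: (eqVneq z q) => [->|_]; first by rewrite qQ rQ' clr'.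
  case: (eqVneq z r) => [->|_]; first by rewrite rQ xQ clx eq_sym.
  exact: (forallP adm_pi z).
have := max_pi _ adm'; apply/negP; rewrite -ltnNge; apply: proper_card; apply/properP; split.
  apply/subsetP => z; rewrite !inE => /andP[-> okz] /=; rewrite pi'E.
  case: (eqVneq z q) => [zq|_]; first by rewrite zq bad_q in okz.
  by case: (eqVneq z r) => [->|].
by exists q; rewrite !inE qQ ?bad_q // pi'E eqxx.
Qed.

(** * Assembling a labelling *)

Definition adjacent n (g : 'I_n -> option 'I_n) (v u : 'I_n) : bool :=
  (g v == Some u) || (g u == Some v).

Lemma adjacentC n (g : 'I_n -> option 'I_n) v u : adjacent g v u = adjacent g u v.
Proof. by rewrite /adjacent orbC. Qed.

Lemma adjacent_lt n (g : 'I_n -> option 'I_n) v u : descends g ->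
  adjacent g v u -> u < v -> g v = Some u.
Proof.
move=> gd /orP[/eqP //|/eqP/gd vu] uv.
by have := ltn_trans vu uv; rewrite ltnn.
Qed.

Lemma count_even n : count (fun a => ~~ odd a) (iota 1 n) = n./2.
Proof.
elim: n => // n IH; rewrite -[in iota _ _](addn1 n) iotaD count_cat IH /=.
by rewrite negbK addn0 addnC uphalf_half.
Qed.

Lemma leq_card_bigcup (T J : finType) (A : pred J) (F : J -> {set T}) :
  #|\bigcup_(i in A) F i| <= \sum_(i in A) #|F i|.
Proof.
apply: (big_ind2 (fun (B : {set T}) m => #|B| <= m)) => [|B1 m1 B2 m2 h1 h2|//].
  by rewrite cards0.
exact: leq_trans (leq_card_setU B1 B2) (leq_add h1 h2).
Qed.

(** I is the independent set that receives the even labels. C contains the cut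
    vertices, Z the vertices carrying the labels that are not tame, all of whose
    neighbours are in C, and Q the vertices that are labelled last. X bounds D
    times the number of labels of a bucket that a tame label excludes. *)
Section Assembly.

Variables (n y D t H w : nat) (g : 'I_n -> option 'I_n).
Hypothesis g_desc : descends g.

Let ps := small_primes y.
Let P0 := \prod_(p <- ps) p.
Let X := P0 * (n %/ code_period ps + D * t).

(** Rough labels meet no small prime at all. Those up to H are kept for the
    vertices of C, which may touch several pieces with unrelated codes. *)
Definition pool_label (a : nat) : bool := (a <= H) && rough (small_primes y) a.

Definition bucket_labels (b : bool) (u : seq bool) : seq nat :=
  [seq a <- iota 1 n | [&& bucket (small_primes y) b u a, tame D y a & ~~ pool_label a]].

Definition pool_labels (b : bool) : seq nat :=
  [seq a <- iota 1 n | [&& odd a == b, tame D y a & pool_label a]].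

Variables (I C Z Q : {set 'I_n}) (cd : 'I_n -> seq bool) (f0 : 'I_n -> nat).

Definition slots (b : bool) (u : seq bool) : {set 'I_n} :=
  [set v | [&& v \notin C, v \notin Z, (v \notin I) == b & cd v == u]].

Hypothesis I_indep : forall v u, adjacent g v u -> v \in I -> u \notin I.
Hypothesis I_card : #|I| = n./2.
Hypothesis CZ : forall v, v \in Z -> v \notin C.
Hypothesis QC : forall v, v \in Q -> (v \notin C) && (v \notin Z).
Hypothesis Z_nbr : forall v u, v \in Z -> adjacent g v u -> u \in C.
Hypothesis Q_nbr : forall v u, v \in Q -> adjacent g v u -> [&& u \notin C, u \notin Z & u \notin Q].
Hypothesis Q_deg : forall v, v \in Q -> #|[set u | adjacent g v u]| <= 2.
Hypothesis QZ_few : forall v, #|[set u | adjacent g v u && ((u \in Q) || (u \in Z))]| <= 2.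
Hypothesis cd_size : forall v, size (cd v) = size ps.
Hypothesis cd_adj : forall v u, v \notin C -> u \notin C -> adjacent g v u ->
  cd v = map negb (cd u).
Hypothesis f0_range : forall v, v \in Z -> 0 < f0 v <= n.
Hypothesis f0_inj : {in Z &, injective f0}.
Hypothesis f0_odd : forall v, v \in Z -> odd (f0 v) = (v \notin I).
Hypothesis f0_wild : forall a, 0 < a <= n -> (a \in [seq f0 v | v in Z]) = ~~ tame D y a.

Hypothesis D_gt0 : 0 < D.
Hypothesis y_ge : 16 <= y.
Hypothesis n_lt : n < 2 ^ t.
Hypothesis n_w : n ^ 3 < 16 ^ w.
Hypothesis H_le : H <= n.
Hypothesis pool_big : (y + w).+1 * (#|C| + #|Z| + 2 ^ (y + w)) < H %/ 4.
Hypothesis slots_ge : forall b u, size u = size ps -> size (bucket_labels b u) <= #|slots b u|.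
Hypothesis Q_big : forall b u, size u = size ps ->
  6 * X + D * (#|slots b u| - size (bucket_labels b u)) < D * #|slots b u :&: Q|.

Let lam v := if v \in C then pool_labels (v \notin I) else bucket_labels (v \notin I) (cd v).
Let S : pred 'I_n := [pred v | (v \notin Z) && (v \notin Q)].
Let prior v u := adjacent g v u && ((S u && (u < v)) || (u \in Z)).
Let bad v a (f : 'I_n -> nat) := [exists u, prior v u && ~~ coprime a (f u)].

Let mem_bucket b u a : (a \in bucket_labels b u) =
  [&& 0 < a, a <= n, bucket ps b u a, tame D y a & ~~ pool_label a].
Proof. by rewrite mem_filter mem_iota add1n ltnS andbC -!andbA. Qed.

Let mem_pool b a : (a \in pool_labels b) =
  [&& 0 < a, a <= n, odd a == b, tame D y a & pool_label a].
Proof. by rewrite mem_filter mem_iota add1n ltnS andbC -!andbA. Qed.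

Let lamP v a : a \in lam v -> [/\ 0 < a, a <= n, odd a = (v \notin I) & tame D y a].
Proof.
rewrite /lam; case: ifP => _; rewrite ?mem_pool ?mem_bucket.
  by case/and5P=> -> -> /eqP.
by case/and5P=> -> -> /andP[/eqP].
Qed.

(* An edge with an end in C has a rough label there; any other edge lies in a
   piece, where the codes of its ends are complementary. *)
Let lam_small v u a c p : adjacent g v u ->
  a \in lam v -> c \in lam u -> p \in ps -> p %| c -> ~~ (p %| a).
Proof.
move=> vu; rewrite /lam; case: ifP => vC; case: ifP => uC; rewrite ?mem_pool ?mem_bucket.
- by case/and5P=> _ _ _ _ /andP[_ /allP ra] _ /ra.
- by case/and5P=> _ _ _ _ /andP[_ /allP ra] _ /ra.
- by move=> _ /and5P[_ _ _ _ /andP[_ /allP rc]] /rc/negPf->.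
case/and5P=> _ _ /andP[_ /eqP cda] _ _ /and5P[_ _ /andP[_ /eqP cdc] _ _] p_ps pc.
apply: (@code_coprime ps c a) => //; first exact: odd_coprimes_small.
by rewrite cda cdc; apply: cd_adj; rewrite ?vC ?uC.
Qed.

Let lam_coprime v u a c : adjacent g v u ->
  a \in lam v -> c \in lam u -> ~~ share y c a -> coprime a c.
Proof.
move=> vu av cu; have [a0 _ odd_a _] := lamP av; have [c0 _ odd_c _] := lamP cu.
rewrite coprime_sym; apply: coprime_split => //.
  rewrite odd_a odd_c; apply/orP; have [vI|] := boolP (v \in I); last by right.
  by left; apply: I_indep vu vI.
by move=> p; apply: lam_small vu av cu.
Qed.

Let share_count b u c : size u = size ps -> 0 < c <= n -> tame D y c ->
  D * count (fun a => bucket ps b u a && share y c a) (iota 1 n) <= X.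
Proof.
move=> sz_u /andP[c0 cn] nc; apply: bucket_share_le => //; first by lia.
exact: leq_ltn_trans cn n_lt.
Qed.

(** A vertex of C meets at most three vertices that are already labelled: its
    parent and two of Z; the product of their labels is at most n ^ 3, and
    the sieve finds a coprime label in the pool. Any other vertex meets only its
    parent, whose label is tame and so excludes about one D-th of the bucket,
    while Q keeps a larger part of the bucket unused. *)
Lemma greedy_stage : exists f : 'I_n -> nat,
  [/\ forall v, v \in Z -> f v = f0 v,
      forall v, S v -> f v \in lam v,
      forall v u, S v -> S u -> f v = f u -> v = u &
      forall v u, S v -> (S u || (u \in Z)) -> adjacent g v u -> coprime (f v) (f u)].
Proof.
have [||f [f_off f_on]] := @greedy_choice n S f0 lam bad.
- move=> v a f f' ff'; apply: eq_existsb => u; rewrite /prior.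
  case: (adjacent g v u) => //=; case: (boolP (u \in Z)) => uZ /=.
    by rewrite ff' // /S /= uZ.
  case: (boolP (S u && (u < v))) => //= /andP[Su uv].
  by rewrite ff' // uv orbT.
- move=> v f /andP[/= vZ vQ] f_off f_on.
  have f_lam u : prior v u -> [/\ 0 < f u, f u <= n & odd (f u) = (u \notin I)].
    case/andP=> _ /orP[/andP[Su uv]|uZ]; first by have [? ? ? _] := lamP (f_on u Su uv).
    have nSu : ~~ S u by rewrite /S /= uZ.
    by rewrite f_off // f0_odd //; have /andP[] := f0_range uZ.
  have [vC|vC] := boolP (v \in C).
    have lamE : lam v = pool_labels (v \notin I) by rewrite /lam vC.
    rewrite lamE; pose M := \prod_(u | prior v u) f u.
    have M0 : 0 < M by rewrite prodn_cond_gt0 // => u /f_lam[].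
    have Mw : M < 16 ^ w.
      apply: leq_ltn_trans n_w; apply: leq_trans (_ : n ^ #|prior v| <= _).
        by rewrite -prod_nat_const; apply: leq_prod => u /f_lam[].
      have n0 : 0 < n by case: (n) v {f_lam vZ vQ f_on f_off f M M0 vC lamE} => [[]|].
      rewrite leq_pexp2l // -addn1 addnC.
      apply: leq_trans (_ : #|[set u | g v == Some u]| + #|[set u | adjacent g v u && ((u \in Q) || (u \in Z))]| <= _).
        rewrite -cardsUI; apply: leq_trans (leq_addr _ _); apply: subset_leq_card.
        apply/subsetP => u; rewrite !inE => /andP[vu /orP[/andP[_ uv]|->]]; last by rewrite vu !orbT.
        by rewrite (adjacent_lt g_desc vu uv) eqxx.
      apply: leq_add (QZ_few v).
      case gv: (g v) => [u|]; last by rewrite cards0.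
      by apply: leq_trans (eq_leq (cards1 u)); apply: subset_leq_card; apply/subsetP => z; rewrite !inE => /eqP[->].
    have bM : (v \notin I) || odd M.
      have [vI|//] := boolP (v \in I); rewrite /= /M.
      apply: (big_ind odd) => // [a b oa ob|u vu]; first by rewrite oddM oa.
      have [_ _ ->] := f_lam u vu; apply: I_indep vI; by case/andP: vu.
    have := pool_ge (b := v \notin I) H y_ge M0 Mw bM.
    set K := count _ (iota 1 H) => le_K.
    have K_big : #|C| + #|Z| < K.
      by have := leq_trans pool_big le_K; rewrite ltn_mul2l /= ltn_add2r.
    have K_le : K <= count (coprime M) (pool_labels (v \notin I)) + #|Z|.
      rewrite /K -!size_filter -(size_image f0 Z) -size_cat.
      apply: uniq_leq_size; first by rewrite filter_uniq // iota_uniq.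
      move=> a; rewrite mem_filter mem_iota add1n ltnS mem_cat mem_filter mem_pool.
      case/andP=> /and3P[odd_a rough_a co_a] /andP[a0 aH].
      have an := leq_trans aH H_le; rewrite f0_wild ?a0 ?an //.
      by rewrite odd_a coprime_sym co_a /pool_label aH rough_a /= andbT; case: tame.
    have bad_le : count (fun a => bad v a f) (pool_labels (v \notin I)) <=
        count (predC (coprime M)) (pool_labels (v \notin I)).
      apply: sub_count => a /existsP[u /andP[vu]] /=; apply: contra => co.
      by apply: coprime_dvdr (_ : f u %| M) _; [rewrite /M (bigD1 u) //= dvdn_mulr | rewrite coprime_sym].
    have used_le : count (fun a => [exists u : 'I_n, [&& S u, u < v & f u == a]]) (pool_labels (v \notin I)) <= #|C|.
      rewrite -size_filter -(size_image f C); apply: uniq_leq_size.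
        by rewrite !filter_uniq // iota_uniq.
      move=> a; rewrite mem_filter => /andP[/existsP[u /and3P[Su uv /eqP <-]] fu_pool].
      apply: image_f; have := f_on u Su uv; rewrite /lam; case: ifP => // _.
      by move: fu_pool; rewrite mem_pool mem_bucket => /and5P[_ _ _ _ ->]; rewrite !andbF.
    apply: leq_ltn_trans (leq_add bad_le used_le) _.
    by have := count_predC (coprime M) (pool_labels (v \notin I)); lia.
  have lamE : lam v = bucket_labels (v \notin I) (cd v) by rewrite /lam (negPf vC).
  rewrite lamE.
  have sz_v := cd_size v; set b := v \notin I in lamE *; set u0 := cd v in lamE sz_v *.
  have bad_le : D * count (fun a => bad v a f) (bucket_labels b u0) <= X.
    case gv: (g v) => [u|]; last first.
      rewrite (eq_count (a2 := pred0)) ?count_pred0 ?muln0 // => a.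
      apply/existsP => -[u /andP[/andP[vu /orP[/andP[Su uv]|uZ]]] _]; last first.
        by move: vC; rewrite (Z_nbr uZ) // adjacentC.
      by have := adjacent_lt g_desc vu uv; rewrite gv.
    have vu : adjacent g v u by rewrite /adjacent gv eqxx.
    have uZ : u \notin Z.
      by apply: contraNN vC => uZ; apply: (Z_nbr uZ); rewrite adjacentC.
    have [Su|nSu] := boolP (S u); last first.
      rewrite (eq_count (a2 := pred0)) ?count_pred0 ?muln0 // => a.
      apply/existsP => -[z /andP[/andP[vz /orP[/andP[Sz zv]|zZ]]] _]; last first.
        by move: vC; rewrite (Z_nbr zZ) // adjacentC.
      by have := adjacent_lt g_desc vz zv; rewrite gv => -[uz]; rewrite uz Sz in nSu.
    have fu := f_on u Su (g_desc gv); have [c0 cn _ nc] := lamP fu.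
    apply: leq_trans (share_count b (c := f u) sz_v _ nc); last by rewrite c0.
    rewrite leq_mul2l; apply/orP; right; rewrite -!size_filter; apply: uniq_leq_size.
      by rewrite !filter_uniq // iota_uniq.
    move=> a; rewrite mem_filter => /andP[/existsP[z /andP[/andP[vz zP] nco]] a_b].
    have zu : z = u.
      case/orP: zP => [/andP[Sz zv]|zZ]; last by move: vC; rewrite (Z_nbr zZ) // adjacentC.
      by have := adjacent_lt g_desc vz zv; rewrite gv => -[].
    move: (a_b); rewrite mem_bucket zu in nco *; case/and5P=> a0 an ba _ _.
    rewrite mem_filter mem_iota add1n ltnS a0 an ba /= andbT.
    by apply: contraNT nco => nsh; apply: (lam_coprime vu) => //; rewrite lamE.
  set V := slots b u0.
  have used_le : count (fun a => [exists u : 'I_n, [&& S u, u < v & f u == a]]) (bucket_labels b u0) <= #|V :\: Q|.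
    rewrite -size_filter -(size_image f (V :\: Q)); apply: uniq_leq_size.
      by rewrite !filter_uniq // iota_uniq.
    move=> a; rewrite mem_filter => /andP[/existsP[u /and3P[Su uv /eqP <-]] fu_b].
    apply: image_f; have := f_on u Su uv; have /andP[uZ uQ] := Su; rewrite !inE uQ uZ /=.
    move: fu_b; rewrite mem_bucket => /and5P[_ _ /andP[/eqP oddu /eqP codeu] _ npool].
    have := f_on u Su uv; rewrite /lam; case: ifP => uC; rewrite ?mem_pool ?mem_bucket.
      by rewrite (negPf npool) !andbF.
    by case/and5P=> _ _ /andP[/eqP <- /eqP <-] _ _ _; rewrite oddu codeu !eqxx.
  have := Q_big b sz_v; have := slots_ge b sz_v.
  have : #|V :&: Q| + #|V :\: Q| = #|V| := cardsID Q V.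
  rewrite -/V => hV hS hQ.
  rewrite -(ltn_pmul2l D_gt0) mulnDr.
  apply: leq_ltn_trans (leq_add bad_le (leq_mul (leqnn D) used_le)) _.
  rewrite mulnBr in hQ.
  have : D * size (bucket_labels b u0) <= D * #|V| by rewrite leq_mul2l hS orbT.
  have : D * #|V :&: Q| + D * #|V :\: Q| = D * #|V| by rewrite -mulnDr hV.
  by lia.
have onS v : S v -> f v \in lam v by case/f_on.
have neq v u : S v -> S u -> u < v -> f u <> f v.
  by move=> Sv Su uv; have [_ _ /(_ u Su uv)/eqP] := f_on v Sv.
exists f; split=> //.
- by move=> v vZ; apply: f_off; rewrite /S /= vZ.
- move=> v u Sv Su fvu; apply: val_inj; case: (ltngtP (v : nat) u) => // lt.
    by have := neq u v Su Sv lt.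
  by have := neq v u Sv Su lt; rewrite fvu.
have co v u : S v -> prior v u -> coprime (f v) (f u).
  move=> Sv vu; have [_ nbad _] := f_on v Sv; apply: contraNT nbad => nco.
  by apply/existsP; exists u; rewrite vu.
move=> v u Sv Su_uZ vu; have [uZ|uZ] := boolP (u \in Z).
  by apply: co => //; rewrite /prior vu uZ orbT.
have Su : S u by move: Su_uZ; rewrite (negPf uZ) orbF.
have [uv|] := ltnP u v; first by apply: co; rewrite // /prior vu Su uv.
rewrite leq_eqVlt => /orP[/eqP/val_inj vu_eq|uv].
  move: vu; rewrite vu_eq /adjacent orbb => /eqP/g_desc.
  by rewrite ltnn.
by rewrite coprime_sym; apply: co; rewrite // /prior adjacentC vu Sv uv.
Qed.

Let spare (f : 'I_n -> nat) b u := [seq a <- bucket_labels b u | a \notin image f S].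
Let spare_pool (f : 'I_n -> nat) b := [seq a <- pool_labels b | a \notin image f S].
Let Qc b u := slots b u :&: Q.
(** When a bucket has fewer labels than slots, the last vertices of Q in that
    class take a label from what is left of the pool. *)
Let needy f (q : 'I_n) :=
  size (spare f (q \notin I) (cd q)) <= index q (enum (Qc (q \notin I) (cd q))).
Let Needy f b := [set q in Q | ((q \notin I) == b) && needy f q].

Let in_Qc q : q \in Q -> q \in Qc (q \notin I) (cd q).
Proof. by move=> qQ; have /andP[qC qZ] := QC qQ; rewrite !inE qC qZ qQ !eqxx. Qed.

Let S_Q v : S v -> v \notin Q.
Proof. by case/andP. Qed.

(** The vertices outside Q in a slot class use distinct labels of the bucket, so
    the number of spare labels is known exactly. *)
Let size_spare f b u : size u = size ps ->
  (forall v, S v -> f v \in lam v) ->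
  (forall v u, S v -> S u -> f v = f u -> v = u) ->
  size (spare f b u) + #|slots b u :\: Q| = size (bucket_labels b u).
Proof.
move=> sz_u f_lam f_inj.
rewrite size_filter -(count_predC (fun a => a \notin image f S) (bucket_labels b u)).
congr (_ + _); rewrite -size_filter -(size_image f (slots b u :\: Q)); apply/esym.
apply/perm_size/uniq_perm; first by rewrite !filter_uniq // iota_uniq.
  apply/dinjectiveP => v v'; rewrite !inE => /and5P[vQ _ vZ _ _] /and5P[v'Q _ v'Z _ _].
  by apply: f_inj; rewrite /S /= ?vQ ?v'Q ?vZ ?v'Z.
move=> a; rewrite mem_filter /= negbK; apply/andP/imageP => [[/imageP[v Sv ->] f_b]|[v]].
  exists v => //; have := f_lam v Sv; have /andP[vZ vQ] := Sv.
  move: f_b; rewrite mem_bucket => /and5P[_ _ /andP[/eqP oddv /eqP codev] _ npool].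
  rewrite !inE vQ vZ /lam; case: ifP => vC; rewrite ?mem_pool ?mem_bucket.
    by rewrite (negPf npool) !andbF.
  by case/and5P=> _ _ /andP[/eqP <- /eqP <-] _ _; rewrite oddv codev !eqxx.
rewrite !inE => /and5P[vQ vC vZ /eqP vb /eqP vu] ->; have Sv : S v by rewrite /S /= vQ vZ.
by split; [apply: image_f | have := f_lam v Sv; rewrite /lam (negPf vC) vb vu].
Qed.

Let spare_le f b u : size u = size ps ->
  (forall v, S v -> f v \in lam v) ->
  (forall v u, S v -> S u -> f v = f u -> v = u) ->
  size (spare f b u) <= #|Qc b u|.
Proof.
move=> sz_u f_lam f_inj; have := size_spare b sz_u f_lam f_inj.
have := slots_ge b sz_u; have := cardsID Q (slots b u); rewrite -/(Qc b u); lia.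
Qed.

Let card_needy f b u : size u = size ps ->
  (forall v, S v -> f v \in lam v) ->
  (forall v u, S v -> S u -> f v = f u -> v = u) ->
  #|[set q in Qc b u | needy f q]| <= #|slots b u| - size (bucket_labels b u).
Proof.
move=> sz_u f_lam f_inj.
apply: leq_trans (_ : #|Qc b u| - size (spare f b u) <= _); last first.
  have := size_spare b sz_u f_lam f_inj.
  have := slots_ge b sz_u; have := cardsID Q (slots b u); rewrite -/(Qc b u); lia.
set A := [set q in _ | _]; rewrite -[leqRHS](size_iota (size (spare f b u))).
rewrite -(size_image (index^~ (enum (Qc b u))) A); apply: uniq_leq_size.
  apply/dinjectiveP => q q'; rewrite !inE => /andP[qQ _] /andP[q'Q _] eq_i.
  by rewrite -(nth_index q (_ : q \in enum (Qc b u))) ?eq_i ?nth_index // mem_enum !inE.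
move=> i /imageP[q]; rewrite !inE => /andP[qQ nq] ->; move: (qQ).
move=> /andP[/and4P[_ _ /eqP qb /eqP qu] _]; move: nq; rewrite /needy qb qu mem_iota => -> /=.
by rewrite subnKC ?spare_le // cardE index_mem mem_enum !inE.
Qed.

(** The labels left over are placed on Q without regard to coprimality, keeping
    parity and, except for the few needy vertices, the code. A count of the
    labels of each parity shows that the rest of the pool suffices. *)
Lemma fill_stage (f : 'I_n -> nat) :
  (forall v, v \in Z -> f v = f0 v) ->
  (forall v, S v -> f v \in lam v) ->
  (forall v u, S v -> S u -> f v = f u -> v = u) ->
  exists f1 : 'I_n -> nat,
  [/\ forall v, v \notin Q -> f1 v = f v,
      injective f1,
      forall v, [/\ 0 < f1 v, f1 v <= n & odd (f1 v) = (v \notin I)],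
      forall q, q \in Q -> tame D y (f1 q) /\
        (f1 q \notin pool_labels (q \notin I) -> f1 q \in bucket_labels (q \notin I) (cd q)) &
      forall b u, size u = size ps ->
        #|[set q in Qc b u | f1 q \in pool_labels b]| <= #|slots b u| - size (bucket_labels b u)].
Proof.
move=> f_Z f_lam f_inj.
pose h q := nth 0 (spare f (q \notin I) (cd q)) (index q (enum (Qc (q \notin I) (cd q)))).
pose f1 v := if v \in Q then
    if needy f v then nth 0 (spare_pool f (v \notin I)) (index v (enum (Needy f (v \notin I))))
    else h v
  else f v.
have h_spare q : ~~ needy f q -> h q \in spare f (q \notin I) (cd q).
  by rewrite /needy -ltnNge => ?; apply: mem_nth.
have enough b : #|Needy f b| <= size (spare_pool f b).
  pose labels := [seq a <- iota 1 n | odd a == b].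
  pose pos := [set v : 'I_n | (v \notin I) == b].
  have sz_eq : size labels = #|pos|.
    have cI : #|[set v : 'I_n | v \notin I]| = n - n./2.
      have := cardsC I; rewrite card_ord I_card; have -> : ~: I = [set v : 'I_n | v \notin I].
        by apply/setP => v; rewrite !inE.
      by move=> E; rewrite -[X in X - _]E addKn.
    rewrite size_filter /pos; case: (b).
      have -> : #|[set v | (v \notin I) == true]| = n - n./2.
        by rewrite -cI; apply: eq_card => v; rewrite !inE eqb_id.
      have := count_predC (fun a => ~~ odd a) (iota 1 n); rewrite count_even size_iota => E.
      rewrite -[X in _ = X - _]E addKn; by apply: eq_count => a /=; rewrite negbK eqb_id.
    have -> : #|[set v | (v \notin I) == false]| = n./2.
      by rewrite -I_card; apply: eq_card => v; rewrite !inE eqbF_neg negbK.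
    by rewrite -count_even; apply: eq_count => a /=; rewrite eqbF_neg.
  pose f2 v := if v \in Q then h v else f v.
  have : size labels <= size (image f2 (pos :\: Needy f b) ++ spare_pool f b).
    apply: uniq_leq_size; first by rewrite filter_uniq // iota_uniq.
    move=> a; rewrite mem_filter mem_iota add1n ltnS mem_cat => /and3P[/eqP odd_a a0 an].
    have inS v : S v -> f v = a -> a \in image f2 (pos :\: Needy f b).
      move=> Sv fv; apply/imageP; exists v; last by rewrite /f2 (negPf (S_Q Sv)).
      have [_ _ oddv _] := lamP (f_lam v Sv).
      by rewrite !inE (negPf (S_Q Sv)) /= -oddv fv odd_a eqxx.
    have [ta|nta] := boolP (tame D y a); last first.
      have : a \in [seq f0 v | v in Z] by rewrite f0_wild ?a0.
      case/imageP=> z zZ az; apply/orP; left; apply/imageP; exists z.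
        have zQ : z \notin Q by apply/negP => /QC; rewrite zZ andbF.
        by rewrite !inE (negPf zQ) /= -f0_odd // -az odd_a.
      rewrite /f2 ifF; first by rewrite f_Z.
      by apply/negP => /QC; rewrite zZ andbF.
    have [/imageP[v Sv fv]|aS] := boolP (a \in image f S).
      by rewrite (inS v).
    have [pa|npa] := boolP (pool_label a).
      by apply/orP; right; rewrite mem_filter aS mem_pool a0 an odd_a ta pa eqxx.
    have sz_c : size (code ps a) = size ps by rewrite size_code.
    have a_sp : a \in spare f b (code ps a).
      by rewrite mem_filter aS mem_bucket a0 an ta npa /bucket odd_a !eqxx.
    have lt_i : index a (spare f b (code ps a)) < #|Qc b (code ps a)|.
      by apply: leq_trans (spare_le b sz_c f_lam f_inj); rewrite index_mem.
    have /card_gt0P[v0 _] := leq_ltn_trans (leq0n _) lt_i.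
    pose q := nth v0 (enum (Qc b (code ps a))) (index a (spare f b (code ps a))).
    have qQc : q \in Qc b (code ps a) by rewrite -mem_enum mem_nth // -cardE.
    have /andP[/and4P[_ _ /eqP qb /eqP qu] qQ] : [&& q \notin C, q \notin Z, (q \notin I) == b & cd q == code ps a] && (q \in Q).
      by move: qQc; rewrite !inE.
    have idx : index q (enum (Qc (q \notin I) (cd q))) = index a (spare f b (code ps a)).
      by rewrite qb qu index_uniq ?enum_uniq // -cardE.
    apply/orP; left; apply/imageP; exists q.
      rewrite inE [q \in pos]inE qb eqxx andbT inE qQ /= qb eqxx /= /needy idx qb qu.
      by rewrite -ltnNge index_mem.
    by rewrite /f2 qQ /h idx qb qu nth_index.
  rewrite size_cat size_image sz_eq.
  have -> : #|[in pos :\: Needy f b]| = #|pos :\: Needy f b| by apply: eq_card.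
  move=> le.
  have sub : Needy f b \subset pos.
    by apply/subsetP => q; rewrite !inE => /and3P[].
  have := cardsID (Needy f b) pos; rewrite (setIidPr sub) => E.
  by rewrite -(leq_add2r #|pos :\: Needy f b|) E addnC.
have f1_needy q : q \in Q -> needy f q -> f1 q \in spare_pool f (q \notin I).
  move=> qQ nq; rewrite /f1 qQ nq mem_nth //; apply: leq_trans (enough _).
  by rewrite cardE index_mem mem_enum !inE qQ nq eqxx.
have f1_bucket q : q \in Q -> ~~ needy f q -> f1 q \in spare f (q \notin I) (cd q).
  by move=> qQ nq; rewrite /f1 qQ (negPf nq) h_spare.
have f1_off v : v \notin Q -> f1 v = f v by rewrite /f1 => /negPf->.
have f1_Q q : q \in Q -> [/\ 0 < f1 q, f1 q <= n, odd (f1 q) = (q \notin I), tame D y (f1 q) & f1 q \notin image f S].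
  move=> qQ; have [nq|nq] := boolP (needy f q).
    by have := f1_needy q qQ nq; rewrite mem_filter mem_pool => /andP[-> /and5P[-> -> /eqP-> -> _]].
  by have := f1_bucket q qQ nq; rewrite mem_filter mem_bucket => /andP[-> /and5P[-> -> /andP[/eqP-> _] -> _]].
have dich v : [\/ v \in Q, v \in Z | S v].
  rewrite /S /=; case: (v \in Q); first by constructor 1.
  by case: (v \in Z); [constructor 2 | constructor 3].
have ZQ z : z \in Z -> z \notin Q by move=> zZ; apply/negP => /QC; rewrite zZ andbF.
have f1_Z z : z \in Z -> f1 z = f0 z by move=> zZ; rewrite f1_off ?ZQ // f_Z.
have wild_Z z : z \in Z -> ~~ tame D y (f1 z).
  by move=> zZ; rewrite f1_Z // -f0_wild ?f0_range // image_f.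
have tame_nZ v : v \notin Z -> tame D y (f1 v).
  move=> vZ; case: (dich v) => [vQ|vZ'|Sv]; first by case: (f1_Q v vQ).
    by rewrite vZ' in vZ.
  by rewrite f1_off ?S_Q //; case: (lamP (f_lam v Sv)).
exists f1; split=> //.
- move=> v u fvu; have [vZ|vZ] := boolP (v \in Z).
    have uZ : u \in Z by apply: contraLR (wild_Z v vZ) => /tame_nZ; rewrite fvu negbK.
    by apply: f0_inj; rewrite // -!f1_Z.
  have uZ : u \notin Z by apply: contraL (tame_nZ v vZ); rewrite fvu; apply: wild_Z.
  have [vQ|vQ] := boolP (v \in Q); have [uQ|uQ] := boolP (u \in Q).
  + have [_ _ oddv _ _] := f1_Q v vQ; have [_ _ oddu _ _] := f1_Q u uQ.
    have eqb : (u \notin I) = (v \notin I) by rewrite -oddv -oddu fvu.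
    have [nv|nv] := boolP (needy f v); have [nu|nu] := boolP (needy f u).
    * move: fvu; rewrite /f1 vQ uQ nv nu eqb => /eqP; rewrite nth_uniq ?filter_uniq ?iota_uniq //.
      - move=> /eqP eq_i; have vN : v \in enum (Needy f (v \notin I)) by rewrite mem_enum !inE vQ nv eqxx.
        have uN : u \in enum (Needy f (v \notin I)) by rewrite mem_enum !inE uQ nu eqb eqxx.
        by rewrite -(nth_index v vN) eq_i nth_index.
      - by apply: leq_trans (enough _); rewrite cardE index_mem mem_enum !inE vQ nv eqxx.
      - by apply: leq_trans (enough _); rewrite cardE index_mem mem_enum !inE uQ nu eqb eqxx.
    * have := f1_needy v vQ nv; have := f1_bucket u uQ nu; rewrite -fvu mem_filter mem_bucket mem_filter mem_pool.
      by case/andP=> _ /and5P[_ _ _ _ /negPf->]; rewrite !andbF.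
    * have := f1_needy u uQ nu; have := f1_bucket v vQ nv; rewrite fvu mem_filter mem_bucket mem_filter mem_pool.
      by case/andP=> _ /and5P[_ _ _ _ /negPf->]; rewrite !andbF.
    * have fv := f1_bucket v vQ nv; have fu := f1_bucket u uQ nu.
      have eqc : cd u = cd v.
        move: fv fu; rewrite fvu mem_filter mem_bucket mem_filter mem_bucket => /andP[_ /and5P[_ _ /andP[_ /eqP <-] _ _]].
        by move=> /andP[_ /and5P[_ _ /andP[_ /eqP <-] _ _]].
      move: fvu; rewrite /f1 vQ uQ (negPf nv) (negPf nu) /h eqb eqc => /eqP.
      move: nv nu; rewrite /needy eqb eqc -!ltnNge => nv nu.
      rewrite nth_uniq ?filter_uniq ?iota_uniq // => /eqP eq_i.
      have vN : v \in enum (Qc (v \notin I) (cd v)) by rewrite mem_enum in_Qc.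
      have uN : u \in enum (Qc (v \notin I) (cd v)) by rewrite mem_enum -eqb -eqc in_Qc.
      by rewrite -(nth_index v vN) eq_i nth_index.
  + have Su : S u by rewrite /S /= uZ uQ.
    by have [_ _ _ _ /negP[]] := f1_Q v vQ; rewrite fvu f1_off // image_f.
  + have Sv : S v by rewrite /S /= vZ vQ.
    by have [_ _ _ _ /negP[]] := f1_Q u uQ; rewrite -fvu f1_off // image_f.
  + by move: fvu; rewrite !f1_off //; apply: f_inj; rewrite /S /= ?vZ ?vQ ?uZ ?uQ.
- move=> v; case: (dich v) => [vQ|vZ|Sv]; first by case: (f1_Q v vQ).
    by rewrite f1_Z // f0_odd //; have /andP[] := f0_range vZ.
  by rewrite f1_off ?S_Q //; case: (lamP (f_lam v Sv)).
- move=> q qQ; split; first by case: (f1_Q q qQ).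
  have [nq|nq] := boolP (needy f q).
    by have := f1_needy q qQ nq; rewrite mem_filter => /andP[_ ->].
  by have := f1_bucket q qQ nq; rewrite mem_filter => /andP[_ ->].
move=> b u sz_u; apply: leq_trans (card_needy b sz_u f_lam f_inj).
apply/subset_leq_card/subsetP => q; rewrite !inE => /andP[qQc fq_pool]; rewrite qQc /=.
have qQ : q \in Q by case/andP: qQc.
apply: contraLR fq_pool => nq; have := f1_bucket q qQ nq.
by rewrite mem_filter mem_bucket mem_pool => /andP[_ /and5P[_ _ _ _ /negPf->]]; rewrite !andbF.
Qed.

(** In a class of Q, a vertex q conflicts with few labels: its two neighbours
    are outside Q and have tame labels, each sharing a prime with about one D-th
    of the bucket, and few labels of the class come from the pool. Conversely a
    label conflicts with few vertices of the class, because few vertices carry a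
    label sharing a prime with it and each of these has at most two neighbours
    in Q. Hence swaps inside the classes repair all conflicts on Q. *)
Theorem assembly : exists f : 'I_n -> nat,
  [/\ injective f, forall v, 0 < f v <= n &
      forall v u, g v = Some u -> coprime (f v) (f u)].
Proof.
have [f [f_Z f_lam f_inj f_co]] := greedy_stage.
have [f1 [f1_off f1_inj f1_rng f1_Q f1_pool]] := fill_stage f_Z f_lam f_inj.
pose cl q := (q \notin I, cd q).
pose bad2 q x := [exists r, adjacent g q r && ~~ coprime (f1 r) (f1 x)].
(* A neighbour of Q is an ordinary vertex with the complementary code. *)
have nbrM q r : q \in Q -> adjacent g q r ->
    f1 r \in bucket_labels (r \notin I) (map negb (cd q)) /\ r \notin Q.
  move=> qQ qr; have /and3P[rC rZ rQ] := Q_nbr qQ qr; have /andP[qC _] := QC qQ.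
  have Sr : S r by rewrite /S /= rZ rQ.
  rewrite f1_off //; split=> //; have := f_lam r Sr; rewrite /lam (negPf rC).
  by rewrite (cd_adj rC qC) // adjacentC.
have nbr_co q r x : q \in Q -> x \in Q -> cl x = cl q -> adjacent g q r ->
    ~~ coprime (f1 r) (f1 x) -> share y (f1 r) (f1 x).
  move=> qQ xQ [xI xc] qr; apply: contraNT => nsh.
  have [r0 _ oddr] := f1_rng r; have [x0 _ oddx] := f1_rng x.
  apply: (coprime_split r0 x0 _ _ nsh).
    rewrite oddr oddx xI; have [qI|nqI] := boolP (q \in I); last by rewrite orbT.
    by rewrite (I_indep qr qI).
  move=> p p_ps pr; have [_ xb] := f1_Q x xQ.
  have [xp|/xb] := boolP (f1 x \in pool_labels (x \notin I)).
    by move: xp; rewrite mem_pool => /and5P[_ _ _ _ /andP[_ /allP /(_ p p_ps)]].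
  rewrite mem_bucket => /and5P[_ _ /andP[_ /eqP cx] _ _].
  have [+ _] := nbrM q r qQ qr; rewrite mem_bucket => /and5P[_ _ /andP[_ /eqP cr] _ _].
  apply: (@code_coprime ps (f1 r) (f1 x)) pr => //; first exact: odd_coprimes_small.
  rewrite cx cr xc -map_comp -[LHS]map_id; apply: eq_map => c /=; by rewrite negbK.
have bucket_count b u c (A : {set 'I_n}) : size u = size ps -> 0 < c <= n -> tame D y c ->
    (forall v, v \in A -> bucket ps b u (f1 v) && share y c (f1 v)) -> D * #|A| <= X.
  move=> sz_u c_rng tc AP; apply: leq_trans (share_count b sz_u c_rng tc).
  rewrite leq_mul2l -size_filter -(size_image f1 A); apply/orP; right; apply: uniq_leq_size.
    by apply/dinjectiveP => v v' _ _; apply: f1_inj.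
  move=> a /imageP[v vA ->]; rewrite mem_filter AP // mem_iota add1n ltnS.
  by have [-> -> _] := f1_rng v.
have [|pi [pi_off pi_on pi_ok]] := @swap_repair _ _ cl Q bad2.
  move=> q x qQ xQ clx; set b := q \notin I; set u := cd q.
  have sz_u : size u = size ps := cd_size q.
  have inQc q' : q' \in Q -> cl q' == cl q -> q' \in slots b u :&: Q.
    move=> q'Q /eqP[eI ec]; have /andP[q'C q'Z] := QC q'Q.
    by rewrite !inE q'Q q'C q'Z eI ec !eqxx.
  have -> : #|[set q' in Q | cl q' == cl q]| = #|slots b u :&: Q|.
    apply: eq_card => q'; rewrite inE; apply/andP/idP => [[q'Q]|]; first exact: inQc.
    by rewrite !inE => /andP[/and4P[_ _ /eqP eI /eqP ec] ->]; rewrite /cl eI ec.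
  (* A1: the vertices whose label does not suit q; A2: those that the label
     of x does not suit. *)
  set A1 := [set q' in Q | _ && bad2 q q']; set A2 := [set q' in Q | _].
  have A1_le : D * #|A1| <= 2 * X + D * (#|slots b u| - size (bucket_labels b u)).
    pose A1r r := [set q' in A1 | (f1 q' \notin pool_labels b) && ~~ coprime (f1 r) (f1 q')].
    have A1_sub : #|A1| <= #|[set q' in slots b u :&: Q | f1 q' \in pool_labels b]| +
        \sum_(r in [set r | adjacent g q r]) #|A1r r|.
      apply: leq_trans (leq_add (leqnn _) (leq_card_bigcup _ _)).
      apply: leq_trans (leq_card_setU _ _); apply: subset_leq_card.
      apply/subsetP => q' q'A; move: (q'A); rewrite inE => /and3P[q'Q clq' /existsP[r /andP[qr nco]]].
      rewrite inE [q' \in [set _ in _ | _]]inE (inQc _ q'Q clq') /=.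
      have [//|np] := boolP (f1 q' \in pool_labels b).
      by apply/bigcupP; exists r; rewrite inE // q'A np.
    have A1r_le r : r \in [set r | adjacent g q r] -> D * #|A1r r| <= X.
      rewrite inE => qr; have [fr _] := nbrM q r qQ qr.
      move: (fr); rewrite mem_bucket => /and5P[r0 rn _ tr _].
      apply: (bucket_count b u (f1 r)) => //; first by rewrite r0.
      move=> v; rewrite inE => /andP[vA /andP[np nco]].
      move: vA; rewrite inE => /and3P[vQ /eqP clv _]; have [cb cu] := clv.
      rewrite (nbr_co q r v) // andbT.
      have [_ /(_ _)] := f1_Q v vQ; rewrite cb cu => /(_ np).
      by rewrite mem_bucket => /and5P[].
    have pool_le := f1_pool b u sz_u.
    apply: leq_trans (leq_mul (leqnn D) A1_sub) _; rewrite mulnDr addnC.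
    apply: leq_add; last by rewrite leq_mul2l pool_le orbT.
    rewrite big_distrr /=; apply: leq_trans (leq_sum _ A1r_le) _.
    by rewrite sum_nat_const leq_mul2r Q_deg ?orbT.
  have A2_le : D * #|A2| <= 4 * X.
    pose R b' := [set r | (f1 r \in bucket_labels b' (map negb u)) && share y (f1 x) (f1 r)].
    have [x0 xn _] := f1_rng x; have [tx _] := f1_Q x xQ.
    have R_le b' : D * #|R b'| <= X.
      apply: (bucket_count b' (map negb u) (f1 x)); rewrite ?size_map ?x0 //.
      by move=> v; rewrite inE mem_bucket => /andP[/and5P[_ _ -> _ _] ->].
    have A2_sub : #|A2| <= \sum_(r in R true :|: R false) #|[set q' | adjacent g r q' && ((q' \in Q) || (q' \in Z))]|.
      apply: leq_trans (leq_card_bigcup _ _); apply: subset_leq_card.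
      apply/subsetP => q'; rewrite inE => /and3P[q'Q /eqP clq' /existsP[r /andP[q'r nco]]].
      have [fr _] := nbrM q' r q'Q q'r; have [cb cu] := clq'.
      apply/bigcupP; exists r; last by rewrite inE adjacentC q'r q'Q.
      have [r0 _ _] := f1_rng r.
      have sh : share y (f1 x) (f1 r).
        by rewrite share_sym // (nbr_co q') // clx clq'.
      by rewrite !inE sh !andbT /u -cu; case: (r \notin I) fr => ->; rewrite ?orbT.
    have A2_le2 : #|A2| <= (#|R true| + #|R false|) * 2.
      apply: leq_trans A2_sub _; apply: leq_trans (_ : \sum_(r in R true :|: R false) 2 <= _).
        by apply: leq_sum => r _; apply: QZ_few.
      by rewrite sum_nat_const leq_mul2r leq_card_setU orbT.
    apply: leq_trans (leq_mul (leqnn D) A2_le2) _.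
    rewrite mulnA mulnDr (_ : 4 * X = (X + X) * 2); last by lia.
    by rewrite leq_mul2r leq_add.
  rewrite -(ltn_pmul2l D_gt0) mulnDr; apply: leq_ltn_trans (leq_add A1_le A2_le) _.
  by rewrite addnAC -mulnDl; apply: Q_big.
pose f2 v := f1 (pi v).
have off v : v \notin Q -> f2 v = f v by move=> vQ; rewrite /f2 pi_off // f1_off.
have QNQ q r : q \in Q -> adjacent g q r -> coprime (f2 q) (f2 r).
  move=> qQ qr; have [_ rQ] := nbrM q r qQ qr; rewrite /f2 (pi_off r) //.
  have := pi_ok q qQ; rewrite coprime_sym; apply: contraNT => nco.
  by apply/existsP; exists r; rewrite qr.
exists f2; split=> [v v' /f1_inj/perm_inj //|v|v u gv]; first by have [-> -> _] := f1_rng (pi v).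
have vu : adjacent g v u by rewrite /adjacent gv eqxx.
have uv : adjacent g u v by rewrite adjacentC.
have [vQ|vQ] := boolP (v \in Q); first exact: QNQ.
have [uQ|uQ] := boolP (u \in Q); first by rewrite coprime_sym QNQ.
rewrite !off //; have [vZ|vZ] := boolP (v \in Z).
  have uC := Z_nbr vZ vu; have uZ : u \notin Z by apply: contraL uC; apply: CZ.
  by rewrite coprime_sym f_co ?vZ ?orbT // /S /= uZ.
apply: f_co; rewrite // /S /= ?vZ ?vQ //.
by have [uZ|uZ] := boolP (u \in Z); rewrite ?orbT ?uZ ?uQ.
Qed.

End Assembly.

(** * Spreading the pieces over the codes *)

(** A quantity that depends only on the type is dealt as evenly as the types;
    the error is one element of each type. *)
Lemma round_robin_sum (P K : finType) (tau : P -> K) B (sigma : P -> 'I_B) (F : K -> nat) s b :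
  (forall k, #|[set x | tau x == k]| <= B * #|[set x | (tau x == k) && (sigma x == b)]| + B /\
    B * #|[set x | (tau x == k) && (sigma x == b)]| <= #|[set x | tau x == k]| + B) ->
  (forall k, F k <= s) ->
  \sum_x F (tau x) <= B * \sum_(x | sigma x == b) F (tau x) + B * (s * #|K|) /\
  B * \sum_(x | sigma x == b) F (tau x) <= \sum_x F (tau x) + B * (s * #|K|).
Proof.
move=> even F_le.
have E1 : \sum_x F (tau x) = \sum_k F k * #|[set x | tau x == k]|.
  rewrite (partition_big tau predT) //=; apply: eq_bigr => k _.
  rewrite (eq_bigr (fun=> F k)) => [|x /eqP-> //]; rewrite sum_nat_const mulnC.
  by congr (_ * _); apply: eq_card => x; rewrite inE.
have E2 : \sum_(x | sigma x == b) F (tau x) = \sum_k F k * #|[set x | (tau x == k) && (sigma x == b)]|.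
  rewrite (partition_big tau predT) //=; apply: eq_bigr => k _.
  rewrite (eq_bigr (fun=> F k)) => [|x /andP[_ /eqP->] //]; rewrite sum_nat_const mulnC.
  by congr (_ * _); apply: eq_card => x; rewrite inE andbC.
have E3 : \sum_(k : K) B * s = B * (s * #|K|) by rewrite sum_nat_const mulnCA (mulnC _ s).
rewrite E1 E2 -E3 big_distrr -!big_split /=; split; apply: leq_sum => k _.
  apply: leq_trans (leq_mul (leqnn (F k)) (proj1 (even k))) _.
  by rewrite mulnDr mulnCA leq_add2l mulnC leq_mul2l F_le orbT.
rewrite mulnCA; apply: leq_trans (leq_mul (leqnn (F k)) (proj2 (even k))) _.
by rewrite mulnDr leq_add2l mulnC leq_mul2l F_le orbT.
Qed.

(** The vertices outside C1 form pieces of at most s vertices. A piece gets a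
    code, complemented on one side of its bipartition. Its type records how many
    vertices of each set A j it has on either side; there are few types because
    pieces are small, and dealing the codes to the pieces of each type in turn
    spreads every A j evenly over the codes. *)
Lemma spread_codes n (g : 'I_n -> option 'I_n) (C1 : {set 'I_n}) s m (J : finType) (A : J -> {set 'I_n}) :
  descends g ->
  (forall x, #|[set v | (v \notin C1) && (top (prune g C1) v == x)]| <= s) ->
  (forall j v, v \in A j -> v \notin C1) ->
  exists cd : 'I_n -> seq bool,
  [/\ forall v, size (cd v) = m,
      forall v u, v \notin C1 -> u \notin C1 -> adjacent g v u -> cd v = map negb (cd u) &
      forall j u, size u = m ->
        #|A j| <= 2 ^ m * #|[set v in A j | cd v == u]| + 2 ^ m * (2 * s * s.+1 ^ (2 * #|J|)) /\
        2 ^ m * #|[set v in A j | cd v == u]| <= #|A j| + 2 ^ m * (2 * s * s.+1 ^ (2 * #|J|))].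
Proof.
move=> gd small AC1; pose h := prune g C1; have hd : descends h := descends_prune gd.
pose cell j c x := [set v in A j | (top h v == x) && (side h v == c)].
have cell_le j c x : #|cell j c x| <= s.
  apply: leq_trans (small x); apply/subset_leq_card/subsetP => v.
  by rewrite !inE => /and3P[/AC1-> -> _].
pose tau x : {ffun J * bool -> 'I_s.+1} := [ffun jc => inord #|cell jc.1 jc.2 x|].
have tauE j c x : tau x (j, c) = #|cell j c x| :> nat.
  by rewrite ffunE inordK // ltnS.
have cardU : #|{: m.-tuple bool}| = 2 ^ m by rewrite card_tuple card_bool.
have B_gt0 : 0 < #|{: m.-tuple bool}| by rewrite cardU expn_gt0.
have [sigma sigmaP] := round_robin tau B_gt0.
pose U x : m.-tuple bool := enum_val (sigma x).
pose cd v : seq bool := if side h v then map negb (U (top h v)) else U (top h v).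
exists cd; split=> [v|v u vC uC|j u sz_u].
- by rewrite /cd; case: ifP => _; rewrite ?size_map size_tuple.
- have key v' u' : v' \notin C1 -> u' \notin C1 -> g v' = Some u' -> cd v' = map negb (cd u').
    move=> v'C u'C gv; have hv : h v' = Some u' by rewrite /h /prune gv (negPf u'C).
    rewrite /cd (sideE v' hd) (topE v' hd) hv; case: (side h u') => //=.
    by rewrite mapK //; apply: negbK.
  case/orP=> /eqP; first exact: key.
  by move/(key u v uC vC) ->; rewrite mapK //; apply: negbK.
have half c : exists b, forall x, (sigma x == b) = ((if c then map negb (U x) else U x) == u).
  pose u' : m.-tuple bool := tcast sz_u (in_tuple u).
  have u'E : u' = u :> seq bool by rewrite val_tcast.
  pose nu : m.-tuple bool := [tuple of map negb u'].
  exists (enum_rank (if c then nu else u')) => x.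
  rewrite -[sigma x]enum_valK (inj_eq enum_rank_inj) -/(U x) -val_eqE.
  case: c; rewrite /= u'E //.
  have negK w : map negb (map negb w) = w by rewrite mapK //; apply: negbK.
  by apply/eqP/eqP => [->|<-]; rewrite negK.
pose F c (k : {ffun J * bool -> 'I_s.+1}) : nat := k (j, c).
have F_le c k : F c k <= s by rewrite /F -ltnS.
have totE c : \sum_x F c (tau x) = #|[set v in A j | side h v == c]|.
  rewrite (eq_bigr (fun x => #|cell j c x|)) => [|x _]; last exact: tauE.
  rewrite -[RHS]sum1_card [RHS](partition_big (top h) predT) //=; apply: eq_bigr => x _.
  by rewrite -sum1_card; apply: eq_bigl => v; rewrite !inE -!andbA; congr (_ && _); rewrite andbC.
have codE c b : (forall x, (sigma x == b) = ((if c then map negb (U x) else U x) == u)) ->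
    \sum_(x | sigma x == b) F c (tau x) = #|[set v in A j | (side h v == c) && (cd v == u)]|.
  move=> bE; rewrite (eq_bigr (fun x => #|cell j c x|)) => [|x _]; last exact: tauE.
  rewrite -[RHS]sum1_card [RHS](partition_big (top h) (fun x => sigma x == b)) /=; last first.
    move=> v; rewrite inE => /and3P[_ /eqP sv /eqP cv].
    by rewrite bE -cv /cd sv.
  apply: eq_bigr => x; rewrite bE => /eqP xu.
  rewrite -sum1_card; apply: eq_bigl => v; rewrite !inE; case: (v \in A j) => //=.
  have [sv|_] := eqVneq (side h v) c; last by rewrite andbF.
  have [tv|_] := eqVneq (top h v) x; last by rewrite andbF.
  by rewrite /cd sv tv xu eqxx.
have splitA (B : {set 'I_n}) : #|B| = #|[set v in B | side h v == true]| + #|[set v in B | side h v == false]|.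
  rewrite -(cardsID [set v | side h v] B); congr (_ + _); apply: eq_card => v; rewrite !inE.
    by rewrite eqb_id.
  by rewrite eqbF_neg andbC.
have [bT bTE] := half true; have [bF bFE] := half false.
have [T1 T2] := round_robin_sum (b := bT) (sigmaP ^~ bT) (F_le true).
have [F1 F2] := round_robin_sum (b := bF) (sigmaP ^~ bF) (F_le false).
move: T1 T2 F1 F2; rewrite !totE (codE true bT bTE) (codE false bF bFE) cardU.
have -> : #|{: {ffun J * bool -> 'I_s.+1}}| = s.+1 ^ (2 * #|J|).
  by rewrite card_ffun card_ord card_prod card_bool mulnC.
have cut c : #|[set v in A j | (side h v == c) && (cd v == u)]| =
    #|[set v in [set v in A j | cd v == u] | side h v == c]|.
  by apply: eq_card => v; rewrite !inE -andbA; congr (_ && _); rewrite andbC.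
rewrite !cut (splitA (A j)) (splitA [set v in A j | cd v == u]).
move: (s.+1 ^ _) (2 ^ m) => a B.
move: #|_| #|_| #|_| #|_| => c1 c2 c3 c4 T1 T2 F1 F2.
have -> : B * (2 * s * a) = B * (s * a) + B * (s * a) by lia.
by rewrite !mulnDr; lia.
Qed.

(** * From candidate sets to a labelling *)

Lemma subset_of_size (T : finType) (A : {set T}) k : k <= #|A| ->
  exists B : {set T}, B \subset A /\ #|B| = k.
Proof.
move=> le_k; exists [set x in take k (enum A)]; split.
  by apply/subsetP => x; rewrite inE => /mem_take; rewrite mem_enum.
rewrite cardsE (card_uniqP _) ?size_takel -?cardE //.
by rewrite take_uniq // enum_uniq.
Qed.

Lemma card_nbr_le n (g : 'I_n -> option 'I_n) (A W : {set 'I_n}) d :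
  (forall v, v \in A -> #|[set u | adjacent g v u && (u \in W)]| <= d) ->
  #|[set u in W | [exists v in A, adjacent g v u]]| <= #|A| * d.
Proof.
move=> le_d; apply: leq_trans (_ : \sum_(v in A) #|[set u | adjacent g v u && (u \in W)]| <= _).
  apply: leq_trans (leq_card_bigcup _ _); apply/subset_leq_card/subsetP => u.
  rewrite inE => /andP[uW /existsP[v /andP[vA vu]]]; apply/bigcupP; exists v => //.
  by rewrite inE vu.
by apply: leq_trans (leq_sum _ le_d) _; rewrite sum_nat_const.
Qed.

Definition wild_count (D y n : nat) : nat := count (fun a => ~~ tame D y a) (iota 1 n).

(** The last set outweighs all sources of conflict. Here a is the size of a
    bucket up to the rounding p, k the part of it lost to the pool, V, sz and Qu
    the numbers of slots, labels and slots in the last set, R the error of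
    dealing the codes, E the number of labels that are not tame and c the size
    of the set that contains the cut vertices. *)
Lemma last_set_wins d a p R E c k t V Qu sz :
  V <= a + p + R -> a <= sz + k + p + E -> 40 * a <= d * (Qu + R + 3 * c + E) ->
  d * k <= 5 * a -> 6 * p * d * t + d * (2 * p + 2 * R + 2 * E + 3 * c) < 29 * a ->
  6 * (a + p * (d * t)) + d * (V - sz) < d * Qu.
Proof.
move=> hV hsz hQ hk hs.
have hVs : V - sz <= k + 2 * p + R + E by clear -hV hsz; lia.
have {hVs hV hsz} := leq_mul (leqnn d) hVs.
by clear -hQ hk hs; lia.
Qed.

Section Core.

Variables (n y D0 t s w : nat) (g : 'I_n -> option 'I_n).
Variables (I W0 W1 : {set 'I_n}).

Let D := 20 * D0.
Let H := n %/ (4 * D0).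
Let ps := small_primes y.
Let P0 := \prod_(p <- ps) p.
Let L := code_period ps.
Let h := n %/ L.
Let B := 2 ^ size ps.
Let E := wild_count D y n.
Let R := 2 * s * s.+1 ^ 8.
Let cC := n %/ s.+1 + 2 * E.
Let W := W0 :|: W1.

Hypothesis g_desc : descends g.
Hypothesis I_indep : forall v u, adjacent g v u -> v \in I -> u \notin I.
Hypothesis I_card : #|I| = n./2.
Hypothesis W0I : forall v, v \in W0 -> v \in I.
Hypothesis W1I : forall v, v \in W1 -> v \notin I.
Hypothesis W_indep : forall v u, adjacent g v u -> v \in W -> u \notin W.
Hypothesis W_deg : forall v, v \in W -> #|[set u | adjacent g v u]| <= 2.
Hypothesis W_few : forall v, #|[set u | adjacent g v u && (u \in W)]| <= 2.
Hypothesis W0_big : n <= D0 * #|W0|.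
Hypothesis W1_big : n <= D0 * #|W1|.

Hypothesis D0_gt0 : 0 < D0.
Hypothesis y_ge : 16 <= y.
(** The labels that are not tame go to candidates Z outside the cut set C1, the
    even ones inside I and the odd ones outside; C adds the neighbours of Z to C1, and Q consists of the
    candidates that are neither in C or Z nor adjacent to C. The inequalities say
    that these sets are small against a bucket, while Q is a fixed proportion of
    all vertices and, the codes being dealt evenly, of every class of slots. *)
Theorem core_construct :
  D0 * (E + 3 * (n %/ s.+1)) <= n ->
  y.+1 * (B * P0 + B * R + cC + E) <= B * P0 * (H %/ L) ->
  6 * P0 * D * t + D * (2 * P0 + 2 * R + 2 * E + 3 * cC) < 29 * P0 * h ->
  n < 2 ^ t -> n ^ 3 < 16 ^ w ->
  (y + w).+1 * (cC + E + 2 ^ (y + w)) < H %/ 4 ->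
  exists f : 'I_n -> nat,
  [/\ injective f, forall v, 0 < f v <= n &
      forall v u, g v = Some u -> coprime (f v) (f u)].
Proof.
move=> avail.
have [C1 [szC1 smallC1]] := cut_forest s g_desc.
have C1_le : #|C1| <= n %/ s.+1 by rewrite leq_divRL // mulnC.
pose wl b := [seq a <- iota 1 n | ~~ tame D y a & odd a == b].
have szwl : size (wl false) + size (wl true) = E.
  rewrite !size_filter -count_predUI addnC [X in X + _](_ : _ = 0).
    by apply: eq_count => a /=; case: tame; case: odd.
  by rewrite (eq_count (a2 := pred0)) ?count_pred0 // => a /=; case: tame; case: odd.
have wl_le b : size (wl b) <= E by case: b; rewrite -szwl ?leq_addl ?leq_addr.
pose Wb b := if b then W1 else W0.
have Wb_big b : n <= D0 * #|Wb b| by case: b.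
have WbW b v : v \in Wb b -> v \in W by rewrite inE; case: b => /= ->; rewrite ?orbT.
have WbI b v : v \in Wb b -> (v \notin I) = b.
  by case: b => /= [/W1I|/W0I ->].
have D0m : forall a b, D0 * a <= D0 * b -> a <= b by move=> a b; rewrite leq_pmul2l.
have Zex b : exists Zb : {set 'I_n}, [/\ Zb \subset Wb b, #|Zb| = size (wl b)
   & forall v, v \in Zb -> v \notin C1].
  pose A := [set v in Wb b | v \notin C1].
  have le_A : size (wl b) <= #|A|.
    have := cardsID C1 (Wb b); have -> : Wb b :\: C1 = A.
      by apply/setP => v; rewrite !inE andbC.
    have : #|Wb b :&: C1| <= #|C1| by apply/subset_leq_card/subsetIr.
    have := D0m _ _ (leq_trans avail (Wb_big b)).
    by have := wl_le b; lia.
  have [Zb [sub card_Z]] := subset_of_size le_A; exists Zb; split=> //.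
    by apply: subset_trans sub _; apply/subsetP => v; rewrite inE => /andP[].
  by move=> v /(subsetP sub); rewrite inE => /andP[].
have [Z0 [Z0W szZ0 Z0C]] := Zex false; have [Z1 [Z1W szZ1 Z1C]] := Zex true.
pose Z := Z0 :|: Z1.
have ZW v : v \in Z -> v \in W by rewrite inE => /orP[/(subsetP Z0W)|/(subsetP Z1W)]; apply: WbW.
have Zb_mem v : v \in Z -> v \in (if v \in I then Z0 else Z1).
  rewrite inE; case: ifP => vI /orP[] // /[dup] vZ; [move/(subsetP Z1W)|move/(subsetP Z0W)].
    by move/WbI; rewrite vI.
  by move/WbI; rewrite vI.
have Zin v : (v \in Z) = (v \in Z0) || (v \in Z1) by rewrite inE.
have szZ : #|Z| <= E by rewrite -szwl -szZ0 -szZ1 leq_card_setU.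
pose NZ := [set u | [exists v in Z, adjacent g v u]].
pose C := C1 :|: NZ.
have NZ_le : #|NZ| <= #|Z| * 2.
  have := @card_nbr_le n g Z setT 2; rewrite (_ : [set u in setT | _] = NZ); last first.
    by apply/setP => u; rewrite !inE.
  apply=> v vZ; apply: leq_trans (W_deg (ZW v vZ)).
  by apply/subset_leq_card/subsetP => u; rewrite !inE andbT.
have C_le : #|C| <= cC.
  apply: leq_trans (leq_card_setU _ _) (leq_add C1_le _).
  by apply: leq_trans NZ_le _; rewrite mulnC leq_mul2l szZ orbT.
have CZ v : v \in Z -> v \notin C.
  move=> vZ; rewrite !inE negb_or; apply/andP; split.
    by move: vZ; rewrite inE => /orP[/Z0C|/Z1C].
  apply/existsP => -[u /andP[uZ uv]].
  by have := W_indep uv (ZW u uZ); rewrite ZW.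
have C1C v : v \in C1 -> v \in C by rewrite inE => ->.
have NZC z v : z \in Z -> adjacent g z v -> v \in C.
  by move=> zZ zv; rewrite !inE; apply/orP; right; apply/existsP; exists z; rewrite zZ.
clearbody C; clear NZ NZ_le.
pose Q := [set v in W | [&& v \notin C, v \notin Z & ~~ [exists u in C, adjacent g u v]]].
have QE v : (v \in Q) = [&& v \in W, v \notin C, v \notin Z & ~~ [exists u in C, adjacent g u v]].
  by rewrite inE.
clearbody Q; clearbody Z.
pose A (j : bool * bool) :=
  [set v | [&& v \notin C, v \notin Z, (v \notin I) == j.1 & j.2 ==> (v \in Q)]].
have AC1 j v : v \in A j -> v \notin C1.
  by rewrite inE => /and4P[vC _ _ _]; apply: contra vC; apply: C1C.
have [cd [cd_size cd_adj cd_cnt]] := spread_codes (size ps) g_desc smallC1 AC1.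
have RE : 2 * s * s.+1 ^ (2 * #|{: bool * bool}|) = R by rewrite card_prod card_bool.
rewrite RE -/B in cd_cnt.
pose f0 v := nth 0 (wl (v \notin I)) (index v (enum (if v \in I then Z0 else Z1))).
have f0_idx v : v \in Z -> index v (enum (if v \in I then Z0 else Z1)) < size (wl (v \notin I)).
  move=> /Zb_mem; case: (v \in I) => vZ; rewrite /= -?szZ0 -?szZ1 cardE index_mem mem_enum //.
have f0_wl v : v \in Z -> f0 v \in wl (v \notin I) by move=> vZ; rewrite mem_nth // f0_idx.
have mem_wl b a : (a \in wl b) = [&& 0 < a, a <= n, ~~ tame D y a & odd a == b].
  by rewrite mem_filter mem_iota add1n ltnS andbC -!andbA.
have f0_odd v : v \in Z -> odd (f0 v) = (v \notin I).
  by move=> /f0_wl; rewrite mem_wl => /and4P[_ _ _ /eqP].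
have L_E : L = 2 * (B * P0) by rewrite /L code_periodE mulnA.
have L_gt0 : 0 < L := code_period_gt0 (odd_coprimes_small y).
have B_gt0 : 0 < B by rewrite expn_gt0.
have BP_gt0 : 0 < B * P0 by move: L_gt0; rewrite L_E; lia.
have hn : 2 * (B * P0 * h) <= n by rewrite mulnA -L_E mulnC leq_divM.
have nh : n < 2 * (B * P0 * h.+1) by rewrite mulnA -L_E mulnC ltn_ceil.
have H_le : H <= n by apply: leq_div.
have slotsE b u : slots I C Z cd b u = [set v in A (b, false) | cd v == u].
  apply/setP => v; rewrite !inE /=.
  by case: (v \in C); case: (v \in Z); case: (_ == b); case: (_ == u).
have slotsQE b u : slots I C Z cd b u :&: Q = [set v in A (b, true) | cd v == u].
  apply/setP => v; rewrite !inE /=.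
  by case: (v \in C); case: (v \in Z); case: (_ == b); case: (v \in Q); case: (_ == u).
have parity_card b : n./2 <= #|[set v | (v \notin I) == b]| <= n - n./2.
  have := cardsC I; rewrite card_ord I_card => cI.
  have -> : #|[set v | (v \notin I) == b]| = if b then #|~: I| else n./2.
    rewrite -I_card; case: b; apply: eq_card => v; rewrite !inE ?eqb_id // eqbF_neg negbK.
    by [].
  by case: b; lia.
have A_le b : #|A (b, false)| <= n - n./2.
  have /andP[_] := parity_card b; apply: leq_trans; apply/subset_leq_card/subsetP => v.
  by rewrite !inE => /and4P[].
have A_ge b : n./2 <= #|A (b, false)| + cC + E.
  have /andP[+ _] := parity_card b => /leq_trans; apply.
  apply: leq_trans (_ : #|A (b, false)| + #|C| + #|Z| <= _); last by rewrite leq_add ?leq_add.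
  apply: leq_trans (leq_add (leq_card_setU _ _) (leqnn _)); apply: leq_trans (leq_card_setU _ _).
  apply/subset_leq_card/subsetP => v; rewrite [v \in [set _ | _]]inE => vb.
  rewrite !inE (eqP vb) eqxx /=.
  by case: (v \in C); case: (v \in Z).
have AQ_ge b : #|Wb b| <= #|A (b, true)| + 3 * cC + E.
  apply: leq_trans (_ : #|A (b, true)| + #|C| + #|C| * 2 + #|Z| <= _); last by lia.
  have nb := @card_nbr_le n g C W 2 (fun v _ => W_few v).
  apply: leq_trans (leq_add (leq_add (leqnn _) nb) (leqnn _)).
  apply: leq_trans (leq_add (leq_add (leq_card_setU _ _) (leqnn _)) (leqnn _)).
  apply: leq_trans (leq_add (leq_card_setU _ _) (leqnn _)); apply: leq_trans (leq_card_setU _ _).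
  apply/subset_leq_card/subsetP => v vW.
  rewrite !inE QE (WbI _ _ vW) (WbW _ _ vW) eqxx.
  rewrite (_ : (v \in W0) || (v \in W1)) /=; last by have := WbW _ _ vW; rewrite inE.
  by case: (v \in C); case: (v \in Z) => //=; rewrite ?orbT // ?orbF; case: existsP.
pose cnt b u N := count (bucket ps b u) (iota 1 N).
move=> size1 size2.
have split_pool b u : count (fun a => bucket ps b u a && ~~ pool_label y H a) (iota 1 n) +
    count (fun a => bucket ps b u a && pool_label y H a) (iota 1 n) =
    count (bucket ps b u) (iota 1 n).
  rewrite -!size_filter -(count_predC (pool_label y H) [seq a <- iota 1 n | bucket ps b u a]) addnC.
  by rewrite !count_filter !size_filter; congr (_ + _); apply: eq_count => a /=; rewrite andbC.
have labels_le b u : size u = size ps ->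
    B * size (bucket_labels n y D H b u) + (B * P0 + B * R + cC + E) <= B * (P0 * h.+1).
  move=> sz_u.
  pose r := count (fun a => bucket ps b u a && rough ps a) (iota 1 H).
  have hr : P0 * (H %/ L) <= y.+1 * r := bucket_rough_ge b 1 H sz_u.
  have rB : B * P0 + B * R + cC + E <= B * r.
    rewrite -(@leq_pmul2l y.+1) //; apply: leq_trans size1 _.
    by rewrite -mulnA (mulnCA y.+1) leq_mul2l hr orbT.
  apply: leq_trans (leq_add (leqnn _) rB) _; rewrite -mulnDr leq_mul2l; apply/orP; right.
  apply: leq_trans (bucket_le b 1 n sz_u); rewrite -split_pool; apply: leq_add.
    by rewrite size_filter; apply: sub_count => a /and3P[/= -> _ ->].
  apply: leq_trans (count_iota_leq _ 1 H_le); apply: eq_leq; apply: eq_in_count => a.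
  by rewrite mem_iota add1n ltnS /pool_label => /andP[_ ->].
have labels_ge b u : size u = size ps ->
    P0 * h <= size (bucket_labels n y D H b u) + P0 * (H %/ L).+1 + E.
  move=> sz_u; apply: leq_trans (bucket_ge b 1 n sz_u) _; rewrite -split_pool.
  rewrite addnAC; apply: leq_add; last first.
    apply: leq_trans (bucket_le b 1 H sz_u).
    rewrite -(subnKC H_le) iotaD count_cat [X in _ + X](_ : _ = 0) ?addn0.
      by apply: sub_count => a /andP[].
    apply/eqP; rewrite -leqn0 leqNgt -has_count; apply/hasPn => a.
    by rewrite mem_iota add1n /pool_label ltnNge => /andP[/negPf-> _]; rewrite andbF.
  rewrite size_filter; apply: leq_trans (leq_add (leqnn _) (leqnn _)).
  rewrite -count_predUI; apply: leq_trans (leq_addr _ _); apply: sub_count => a /= /andP[-> ->].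
  by rewrite andbT; case: tame.
have slots_ge b u : size u = size ps -> size (bucket_labels n y D H b u) <= #|slots I C Z cd b u|.
  move=> sz_u; rewrite -(leq_pmul2l B_gt0).
  have [c1 _] := cd_cnt (b, false) u sz_u; rewrite -slotsE in c1.
  have := labels_le b u sz_u; have := A_ge b; rewrite mulnS mulnDr mulnA.
  clear -c1 hn; lia.
have Q_big b u : size u = size ps ->
  6 * (P0 * (h + D * t)) + D * (#|slots I C Z cd b u| - size (bucket_labels n y D H b u)) <
  D * #|slots I C Z cd b u :&: Q|.
  move=> sz_u.
  have [_ c2] := cd_cnt (b, false) u sz_u; rewrite -slotsE in c2.
  have [q1 _] := cd_cnt (b, true) u sz_u; rewrite -slotsQE in q1.
  rewrite (mulnDr P0); apply: (@last_set_wins D (P0 * h) P0 R E cC (P0 * (H %/ L)) t).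
  - rewrite -(leq_pmul2l B_gt0) !mulnDr; apply: leq_trans c2 _.
    rewrite leq_add2r; apply: leq_trans (A_le b) _.
    by move: nh; rewrite mulnS -!mulnA; clear; lia.
  - by have := labels_ge b u sz_u; rewrite mulnS; clear; lia.
  - have : n <= D0 * (B * (#|slots I C Z cd b u :&: Q| + R + 3 * cC + E)).
      apply: leq_trans (Wb_big b) _; rewrite leq_mul2l; apply/orP; right.
      apply: leq_trans (AQ_ge b) _; rewrite [B * _]mulnDr [B * (_ + 3 * cC)]mulnDr [B * (_ + R)]mulnDr.
      apply: leq_add; last by rewrite leq_pmull.
      by apply: leq_add => //; rewrite leq_pmull.
    move/(leq_trans hn); rewrite (mulnCA D0) -!mulnA (mulnCA 2) leq_pmul2l // => le.
    move: le; rewrite /D; clear; lia.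
  - rewrite (mulnCA D) (mulnCA 5) leq_mul2l; apply/orP; right.
    rewrite /H -divnMA mulnC (mulnC _ L) divnMA -/h /D.
    by have := leq_divM h (4 * D0); clear; lia.
  by move: size2; rewrite mulnA.
move=> n_lt n_w size3.
apply: (@assembly n y D t H w g g_desc I C Z Q cd f0) => //.
- by move=> v; rewrite QE => /and4P[_ -> ->].
- move=> v u; rewrite QE => /and4P[vW _ _ /existsP nC] vu.
  have uW := W_indep vu vW; rewrite QE (negPf uW) andbT; apply/andP; split.
    by apply/negP => uC; apply: nC; exists u; rewrite uC adjacentC.
  by apply: contra uW; apply: ZW.
- by move=> v; rewrite QE => /and4P[vW _ _ _]; apply: W_deg.
- move=> v; apply: leq_trans (W_few v); apply/subset_leq_card/subsetP => u.
  by rewrite !inE QE => /andP[-> /orP[/and4P[]|/ZW]]; rewrite ?inE.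
- by move=> v u vC uC; apply: cd_adj; [apply: contra vC|apply: contra uC]; apply: C1C.
- by move=> v /f0_wl; rewrite mem_wl => /and4P[-> ->].
- move=> v v' vZ v'Z eq_f; have eqI : (v \in I) = (v' \in I).
    by apply: negb_inj; rewrite -!f0_odd // eq_f.
  have := f0_idx v vZ; have := f0_idx v' v'Z; have := Zb_mem v vZ; have := Zb_mem v' v'Z.
  move: eq_f; rewrite /f0 eqI; set Zb := if _ then _ else _ => eq_f v'b vb i' i.
  move/eqP: eq_f; rewrite nth_uniq ?filter_uniq ?iota_uniq // => /eqP eq_i.
  by rewrite -(nth_index v (_ : v \in enum Zb)) ?eq_i ?nth_index ?mem_enum.
- move=> a /andP[a0 an]; apply/imageP/idP => [[v vZ ->]|wa].
    by have := f0_wl v vZ; rewrite mem_wl => /and4P[].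
  have a_wl : a \in wl (odd a) by rewrite mem_wl a0 an wa /=.
  have [v vZ [vI fv]] : exists2 v, v \in Z & (v \notin I) = odd a /\ nth 0 (wl (odd a)) (index v (enum (if odd a then Z1 else Z0))) = a.
    have idx : index a (wl (odd a)) < #|if odd a then Z1 else Z0|.
      by case: (odd a) a_wl => a_wl; rewrite ?szZ0 ?szZ1 index_mem.
    have vm := enum_valP (Ordinal idx); set v := enum_val _ in vm.
    exists v; first by rewrite Zin; case: (odd a) vm => ->; rewrite ?orbT.
    split; first by case: (odd a) vm => [/(subsetP Z1W)|/(subsetP Z0W)] /WbI.
    rewrite /v (enum_val_nth v) index_uniq ?enum_uniq -?cardE //= nth_index //.
  exists v => //; rewrite /f0 vI -{1}fv; congr (nth _ _ (index _ _)).
  by rewrite -vI; case: (v \in I).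
- by rewrite muln_gt0.
- by apply: leq_ltn_trans size3; rewrite leq_mul2l !leq_add ?orbT.
Qed.

End Core.

(** * Choice of the parameters *)

Lemma quadratic_le_exp y : 16 <= y -> y * y + 30 * y + 40 <= 2 ^ y.
Proof.
move=> y16; rewrite -(subnK y16); elim: (y - 16) => [|k IH]; first by [].
by rewrite addSn expnS; move: IH; move: (2 ^ _) => X; clear; nia.
Qed.

(** With t about the binary logarithm of n and y that of t, all error terms are
    at most n divided by a power of t, except B, which is at most t; M bounds
    those that do not grow linearly in n. *)
Lemma core_sizes D0 n y t E k M B P0 R :
  1024 * D0 <= t -> 0 < D0 -> y < t ->
  t ^ 4 * E <= 16 * n -> t ^ 2 * k <= n -> t ^ 4 * M <= n ->
  2 * (B * P0) <= M -> B * R <= M -> 0 < B -> B <= t -> 0 < P0 ->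
  [/\ D0 * (E + 3 * k) <= n,
   y.+1 * (B * P0 + B * R + (k + 2 * E) + E) <= B * P0 * (n %/ (4 * D0) %/ (2 * (B * P0))),
   6 * P0 * (20 * D0) * t + 20 * D0 * (2 * P0 + 2 * R + 2 * E + 3 * (k + 2 * E)) <
     29 * P0 * (n %/ (2 * (B * P0))) &
   forall w, w < t -> t * 2 ^ w <= M -> 2 ^ y <= t ->
     (y + w).+1 * (k + 2 * E + E + 2 ^ (y + w)) < n %/ (4 * D0) %/ 4].
Proof.
move=> tD D0_gt0 yt hE hk hM hL hR B0 Bt P00.
have t0 : 0 < t by lia.
have BP0 : 0 < B * P0 by rewrite muln_gt0 B0.
have t2 : 1024 <= t ^ 2 by rewrite expnS expn1; nia.
have tt : 1024 * t <= t ^ 2 by rewrite expnS expn1; nia.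
have t4 : t ^ 4 = t ^ 2 * t ^ 2 by rewrite -expnD.
have hE2 : 16 * (t ^ 2 * E) <= n by move: hE; rewrite t4; move: (t ^ 2) t2 => u; clear; nia.
have hM2 : 1024 * (t ^ 2 * M) <= n by move: hM; rewrite t4; move: (t ^ 2) t2 => u; clear; nia.
have hM3 : t ^ 2 * (t * M) <= n.
  apply: leq_trans hM; rewrite t4 mulnA leq_mul2r leq_mul2l.
  by apply/orP; right; apply/orP; right; lia.
have n_t : t ^ 2 * t <= n.
  by apply: leq_trans hM3; rewrite leq_mul2l leq_pmulr ?orbT //; move: hL BP0; clear; lia.
have tE : t ^ 2 = t * t by rewrite expnS expn1.
have nD : 1024 * (1024 * D0) <= n by apply: leq_trans n_t; apply: leq_mul.
set H := n %/ (4 * D0).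
have HD : n <= 8 * D0 * H.
  have := ltn_ceil n (_ : 0 < 4 * D0); rewrite -/H => /(_ _); rewrite muln_gt0 D0_gt0 => /(_ isT).
  by move: nD; clear; nia.
have tH : 128 * n <= t * H by move: HD tD; clear; nia.
split.
- rewrite -(@leq_pmul2l (t ^ 2)) ?expn_gt0 ?t0 //.
  apply: leq_trans (_ : D0 * (4 * n) <= _); last by move: tD tt t2; clear; nia.
  by rewrite mulnCA leq_mul2l; apply/orP; right; move: hE2 hk; clear; lia.
- set L := 2 * (B * P0); have HL := ltn_ceil H (_ : 0 < L); rewrite muln_gt0 BP0 in HL.
  have {}HL : H < 2 * (B * P0 * (H %/ L)) + L by move: (HL isT); move: (H %/ L) => q; rewrite /L; clear; nia.
  have lhs : t * (y.+1 * (B * P0 + B * R + (k + 2 * E) + E)) <= 4 * n.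
    apply: leq_trans (_ : t ^ 2 * (M + M + (k + 2 * E) + E) <= _).
      rewrite mulnA tE; apply: leq_mul; first by rewrite leq_mul2l yt orbT.
      by move: hL hR; clear; lia.
    by move: hE2 hk hM2; clear; lia.
  have tL : t * L <= n by apply: leq_trans hM2; rewrite /L; move: hL tt t2; clear; nia.
  rewrite -(@leq_pmul2l (2 * t)) ?muln_gt0 //.
  have : t * H <= t * (2 * (B * P0 * (H %/ L))) + t * L by rewrite -mulnDr leq_mul2l ltnW ?orbT.
  by move: lhs tL tH; move: (_.+1 * _) (B * P0 * _) => a b; clear; lia.
- set L := 2 * (B * P0); have HL := ltn_ceil n (_ : 0 < L); rewrite muln_gt0 BP0 in HL.
  have {}HL : n < B * (2 * (P0 * (n %/ L))) + L by move: (HL isT); move: (n %/ L) => q; rewrite /L; clear; nia.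
  have tL : 2 * L <= n by apply: leq_trans hM2; rewrite /L; move: hL t2; clear; nia.
  have P_big : n < 4 * (t * (P0 * (n %/ L))).
    have := leq_mul Bt (leqnn (2 * (P0 * (n %/ L)))).
    by move: HL tL; clear; lia.
  have P_gt : 0 < P0 * (n %/ L) by move: P_big; case: (P0 * _) => //; rewrite muln0.
  have PM : P0 <= M by move: hL B0; clear; nia.
  have RM : R <= M by move: hR B0; clear; nia.
  rewrite -(@ltn_pmul2l (t ^ 2)) ?expn_gt0 ?t0 //.
  apply: leq_ltn_trans (_ : 20 * D0 * (20 * n) < _).
    have a1 : t ^ 2 * (6 * P0 * t) <= 6 * n.
      apply: leq_trans (leq_mul (leqnn 6) hM3).
      by rewrite -mulnA mulnCA (mulnC P0) !leq_mul2l PM !orbT.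
    have a2 : t ^ 2 * (2 * P0 + 2 * R + 2 * E + 3 * (k + 2 * E)) <= 13 * n.
      apply: leq_trans (_ : t ^ 2 * (2 * M + 2 * M + 2 * E + 3 * (k + 2 * E)) <= _).
        by rewrite leq_mul2l; apply/orP; right; move: PM RM; clear; lia.
      by move: hE2 hk hM2; clear; lia.
    rewrite (_ : 6 * P0 * (20 * D0) * t = 20 * D0 * (6 * P0 * t)); last by lia.
    by rewrite -mulnDr mulnCA leq_mul2l mulnDr; apply/orP; right; move: a1 a2; clear; lia.
  rewrite tE -(mulnA 29); move: P_big P_gt tD t0 D0_gt0; move: (P0 * _) => X; clear => P_big X0 tD t0 D00.
  have := leq_mul tD (leqnn (t * X)); have : 0 < t * X by rewrite muln_gt0 t0.
  have := leq_mul (leqnn D0) (ltnW P_big); nia.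
move=> w wt hw yt2.
have Hw : 64 * D0 * (H %/ 4) >= n.
  by have := ltn_ceil H (_ : 0 < 4); move: HD nD; clear; nia.
have tH4 : 16 * n <= t * (H %/ 4) by move: Hw tD; clear; nia.
have n0 : 0 < n by move: nD; clear -D0_gt0; lia.
rewrite -(@ltn_pmul2l t) //; apply: leq_ltn_trans (_ : 8 * n < _); last by lia.
apply: leq_trans (_ : t * (2 * t * (k + 2 * E + E + M)) <= _).
  rewrite leq_mul2l; apply/orP; right; apply: leq_mul; first by lia.
  rewrite leq_add2l; apply: leq_trans hw; rewrite expnD leq_mul2r yt2 orbT //.
rewrite mulnCA mulnA -(mulnA 2) -tE.
by move: hE2 hk hM2; clear; lia.
Qed.

(** With t = 1 + trunc_log 2 n and y = trunc_log 2 t the code period, at most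
    2 * (2 * y) ^ y, is smaller than any fixed power of n, while labels that are
    not tame have density at most 16 ^ - y, of order t ^ - 4. Pieces have at most
    t ^ 2 vertices, so there are polynomially many types in t. *)
Theorem core D0 : 0 < D0 -> exists n0, forall n, n0 <= n ->
  forall (g : 'I_n -> option 'I_n) (I W0 W1 : {set 'I_n}),
  descends g ->
  (forall v u, adjacent g v u -> v \in I -> u \notin I) -> #|I| = n./2 ->
  (forall v, v \in W0 -> v \in I) -> (forall v, v \in W1 -> v \notin I) ->
  (forall v u, adjacent g v u -> v \in W0 :|: W1 -> u \notin W0 :|: W1) ->
  (forall v, v \in W0 :|: W1 -> #|[set u | adjacent g v u]| <= 2) ->
  (forall v, #|[set u | adjacent g v u && (u \in W0 :|: W1)]| <= 2) ->
  n <= D0 * #|W0| -> n <= D0 * #|W1| ->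
  exists f : 'I_n -> nat,
  [/\ injective f, forall v, 0 < f v <= n &
      forall v u, g v = Some u -> coprime (f v) (f u)].
Proof.
move=> D0_gt0; have D_gt0 : 0 < 20 * D0 by rewrite muln_gt0.
have [y1 rare] := @untame_rare (20 * D0) 16 D_gt0 isT.
pose y0 := y1 + 16 + 1024 * D0; exists (2 ^ 2 ^ y0) => n n_ge g I W0 W1.
have n_gt0 : 0 < n by apply: leq_trans n_ge; rewrite expn_gt0.
have [/= lo_n hi_n] := andP (@trunc_log_bounds 2 n isT n_gt0).
have : 2 ^ y0 <= trunc_log 2 n by rewrite trunc_log_max.
move: lo_n hi_n; set T := trunc_log 2 n => lo_n hi_n T_ge.
have [/= lo_t hi_t] := andP (@trunc_log_bounds 2 T.+1 isT isT).
have : y0 <= trunc_log 2 T.+1 by rewrite trunc_log_max // leqW.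
move: lo_t hi_t; set y := trunc_log 2 T.+1 => lo_t hi_t y_ge.
have y16 : 16 <= y by apply: leq_trans y_ge; rewrite /y0; lia.
have quad := leq_trans (quadratic_le_exp y16) lo_t.
set t := T.+1 in hi_n hi_t lo_t quad *.
have pow_t k : t ^ k <= 2 ^ (y.+1 * k) by case: k => [|k]; rewrite ?muln0 // expnM leq_exp2r // ltnW.
have le_n m : m < t -> 2 ^ m <= n by move=> mt; apply: leq_trans lo_n; rewrite leq_exp2l.
(* n ^ 3 < 2 ^ (3 * t), and 2 ^ w stays below n by a factor 2 ^ (t / 4). *)
pose w := t - t %/ 4; pose s := t ^ 2; pose R := 2 * s * s.+1 ^ 8.
pose ps := small_primes y; pose B := 2 ^ size ps; pose P0 := \prod_(p <- ps) p.
have y_gt0 : 0 < y by apply: leq_trans y16.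
have B_t : B <= t by apply: leq_trans lo_t; rewrite leq_exp2l // size_descending.
have B0 : 0 < B by rewrite expn_gt0.
have P00 : 0 < P0.
  have := code_period_gt0 (odd_coprimes_small y); rewrite code_periodE -mulnA !muln_gt0.
  by case/and3P.
pose M := 2 ^ (y * y + 25 * y + 30) + t * 2 ^ w.
have M_n : t ^ 4 * M <= n.
  have half_n m : m.+2 <= t -> 2 * 2 ^ m <= n by move=> mt; rewrite -expnS le_n.
  rewrite -(@leq_pmul2l 2) // [t ^ 4 * M]mulnDr [2 * _]mulnDr.
  apply: leq_trans (_ : n + n <= _); last by rewrite addnn mul2n.
  apply: leq_add.
    apply: leq_trans (half_n (y.+1 * 4 + (y * y + 25 * y + 30)) _); last by move: quad; clear; lia.
    by rewrite leq_mul2l (expnD 2 (y.+1 * 4)) leq_mul2r pow_t orbT.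
  apply: leq_trans (half_n (y.+1 * 5 + w) _); last by rewrite /w; move: quad; clear; lia.
  by rewrite leq_mul2l expnD mulnA -expnSr leq_mul2r pow_t orbT.
have L_M : 2 * (B * P0) <= M.
  rewrite mulnA -code_periodE; apply: leq_trans (code_period_le y_gt0) _.
  apply: leq_trans (leq_addr _ _); rewrite -[X in X * _]expn1.
  apply: leq_trans (_ : 2 ^ (1 + y * y) <= _); last by rewrite leq_exp2l //; clear; lia.
  rewrite expnD expnM leq_mul2l leq_exp2r //=.
  by rewrite -(prednK y_gt0) expnS leq_pmul2l // ltn_expl.
have BR_M : B * R <= M.
  apply: leq_trans (leq_addr _ _); apply: leq_trans (_ : 2 ^ 9 * t ^ 19 <= _).
    rewrite (_ : 2 ^ 9 * t ^ 19 = t * (2 * s * (2 * s) ^ 8)).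
      by rewrite leq_mul // leq_mul2l leq_exp2r // mul2n -addnn -addn1 leq_add2l expn_gt0 orbT.
    by rewrite expnMn /s -!expnM mulnACA -expnS -expnD mulnCA -expnS.
  apply: leq_trans (_ : 2 ^ (9 + y.+1 * 19) <= _); first by rewrite expnD leq_mul2l pow_t orbT.
  by rewrite leq_exp2l //; clear; lia.
have E_n : t ^ 4 * wild_count (20 * D0) y n <= 16 * n.
  apply: leq_trans (_ : 2 ^ (y.+1 * 4) * wild_count (20 * D0) y n <= _).
    by rewrite leq_mul2r pow_t orbT.
  rewrite mulSn expnD -mulnA leq_pmul2l // (mulnC y) expnM.
  by apply: rare; apply: leq_trans y_ge; rewrite /y0 -addnA leq_addr.
have k_n : t ^ 2 * (n %/ s.+1) <= n.
  by rewrite mulnC; apply: leq_trans (leq_divM n s.+1); rewrite leq_mul2l leqnSn orbT.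
have tD : 1024 * D0 <= t.
  by apply: leq_trans (_ : y <= _); [apply: leq_trans y_ge; rewrite /y0; lia|lia].
have yt : y < t by lia.
have [avail size1 size2 size3] := core_sizes tD D0_gt0 yt E_n k_n M_n L_M BR_M B0 B_t P00.
move=> gd Ii Ic W0I W1I Wi Wd Wf W0b W1b.
have n_w : n ^ 3 < 16 ^ w.
  apply: leq_trans (_ : (2 ^ t) ^ 3 <= _); first by rewrite ltn_exp2r.
  by rewrite -expnM -[16]/(2 ^ 4) -expnM leq_exp2l // /w; clear; lia.
apply: (core_construct gd Ii Ic W0I W1I Wi Wd Wf W0b W1b D0_gt0 y16 avail _ _ hi_n n_w _).
- by rewrite code_periodE -(mulnA 2 _ (\prod_(p <- _) p)); apply: size1.
- by rewrite code_periodE -(mulnA 2 _ (\prod_(p <- _) p)); apply: size2.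
apply: size3 lo_t; last exact: leq_addl.
by rewrite /w; move: quad; clear; lia.
Qed.

(** * Candidates in a forest *)

Lemma subset_between (T : finType) (A B : {set T}) k : A \subset B ->
  #|A| <= k <= #|B| -> exists C : {set T}, [/\ A \subset C, C \subset B & #|C| = k].
Proof.
move=> AB /andP[Ak kB].
have [|C [CB szC]] := @subset_of_size T (B :\: A) (k - #|A|).
  by rewrite leq_subLR; have := cardsID A B; rewrite (setIidPr AB) => ->.
exists (A :|: C); split; first exact: subsetUl.
  by rewrite subUset AB (subset_trans CB) // subsetDl.
rewrite cardsU szC (_ : A :&: C = set0) ?cards0; first by lia.
apply/setP => v; rewrite !inE; case: (boolP (v \in A)) => //= vA.
by apply/negP => /(subsetP CB); rewrite inE vA.
Qed.

Section Candidates.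

Variables (n : nat) (g : 'I_n -> option 'I_n).
Hypothesis g_desc : descends g.

Definition kids x := [set c | g c == Some x].
Definition forest_roots := [set x | g x == None].
Definition stable (A : {set 'I_n}) := forall v u, adjacent g v u -> v \in A -> u \notin A.

Lemma adjacent_top v u : adjacent g v u -> top g v = top g u.
Proof. by case/orP => /eqP gv; [rewrite topE // gv | rewrite [RHS]topE // gv]. Qed.

Lemma adjacent_side v u : adjacent g v u -> side g u = ~~ side g v.
Proof.
by case/orP => /eqP gv; [rewrite [in RHS]sideE // gv negbK | rewrite sideE // gv].
Qed.

Lemma top_root v : top g v \in forest_roots.
Proof.
elim/ord_lt_ind: v => v IH; rewrite topE //; case gv: (g v) => [u|].
  exact: IH (g_desc gv).
by rewrite inE gv.
Qed.

Lemma root_top x : x \in forest_roots -> top g x = x.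
Proof. by rewrite inE => /eqP gx; rewrite topE // gx. Qed.

Lemma parent_card_le v : #|[set u | g v == Some u]| <= 1.
Proof.
rewrite -[X in _ <= X](cards1 v); case gv: (g v) => [u|]; last first.
  by rewrite (_ : [set _ | _] = set0) ?cards0 //; apply/setP => u; rewrite !inE.
by rewrite cards1 -(cards1 u); apply/subset_leq_card/subsetP => z; rewrite !inE => /eqP[->].
Qed.

Section ManyRoots.

(** The vertex of largest index in the tree rooted at x. It has no children, so
    it is a leaf or isolated. *)
Definition final x := [arg max_(w > x | top g w == x) (w : nat)].

Lemma finalP x : x \in forest_roots ->
  top g (final x) = x /\ forall w, top g w = x -> w <= final x.
Proof.
move=> /root_top tx; rewrite /final; case: arg_maxnP => [|w /eqP tw max_w]; first exact/eqP.
by split=> // z /eqP; apply: max_w.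
Qed.

Lemma final_nbr x u : x \in forest_roots -> adjacent g (final x) u -> g (final x) = Some u.
Proof.
move=> /finalP[tl max_l] /[dup] /adjacent_top tu /orP[/eqP //|/eqP/g_desc].
by rewrite ltnNge max_l // -tu tl.
Qed.

Lemma final_inj : {in forest_roots &, injective final}.
Proof. by move=> x z /finalP[tx _] /finalP[tz _] eq_l; rewrite -tx eq_l tz. Qed.

(** A larger colour class of a tree stays large when one leaf is forced out of
    it or into it: together the two sets cover as many vertices as the tree. *)
Lemma component_pair x : x \in forest_roots -> exists AB : {set 'I_n} * {set 'I_n},
  [/\ forall v, v \in AB.1 -> top g v = x, forall v, v \in AB.2 -> top g v = x,
      stable AB.1 /\ stable AB.2, final x \notin AB.1 /\ final x \in AB.2 &
      #|[set v | top g v == x]| <= #|AB.1| + #|AB.2|].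
Proof.
move=> xr; have [tl max_l] := finalP xr.
pose K b := [set v | (top g v == x) && (side g v == b)].
have szK : #|[set v | top g v == x]| = #|K (side g (final x))| + #|K (~~ side g (final x))|.
  rewrite -(cardsID [set v | side g v == side g (final x)]); congr (_ + _); apply: eq_card => v.
    by rewrite !inE.
  by rewrite !inE andbC; case: (side g v); case: side.
have K_stable b : stable (K b).
  move=> v u vu; rewrite !inE (adjacent_side vu) => /andP[_ /eqP->].
  by rewrite negb_and; apply/orP; right; case: b.
have [big|small] := ltnP #|K (~~ side g (final x))| #|K (side g (final x))|.
  exists (K (side g (final x)) :\ final x, K (side g (final x))); split=> /=.
  - by move=> v; rewrite !inE => /and3P[_ /eqP].
  - by move=> v; rewrite !inE => /andP[/eqP].
  - split=> // v u vu; rewrite in_setD1 => /andP[_ vK].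
    by rewrite in_setD1 (negPf (K_stable _ _ _ vu vK)) andbF.
  - by rewrite !inE tl !eqxx.
  have := cardsD1 (final x) (K (side g (final x))); rewrite [_ \in K _]inE tl !eqxx /=.
  rewrite szK; move: big; move: #|K (~~ _)| #|K (side _ _)| #|_ :\ _| => a b c; clear; lia.
pose K' := K (~~ side g (final x)).
exists (K', final x |: [set v in K' | ~~ adjacent g (final x) v]); split=> /=.
- by move=> v; rewrite !inE => /andP[/eqP].
- by move=> v; rewrite !inE => /orP[/eqP->|/andP[/andP[/eqP]]].
- split; first exact: K_stable.
  move=> v u vu; rewrite !in_setU1 !(in_setI, inE) => /orP[/eqP vl|].
    rewrite vl in vu; rewrite vu andbF orbF; apply/eqP => ul.
    by move: (adjacent_side vu); rewrite ul; case: side.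
  case/andP => vK nv; rewrite negb_or; apply/andP; split.
    by apply: contra nv => /eqP <-; rewrite adjacentC.
  have : v \in K' by rewrite inE.
  by move/(K_stable _ _ _ vu); rewrite inE => /negPf->.
- by rewrite !inE eqxx; case: side; rewrite ?andbF.
rewrite szK addnC; apply: leq_trans (_ : #|K'| + #|K'| <= _); first by rewrite leq_add2l.
rewrite leq_add2l cardsU1 !inE (_ : (side g (final x) == _) = false); last by case: side.
rewrite andbF /= -(cardsID [set v | g (final x) == Some v]); apply: leq_add.
  apply: leq_trans (parent_card_le (final x)).
  by apply/subset_leq_card/subsetP => v; rewrite !inE => /andP[_].
apply/subset_leq_card/subsetP => v; rewrite !inE => /andP[nv ->] /=.
by apply: contra nv => /(final_nbr xr)->.
Qed.

Lemma card_by_top (A : {set 'I_n}) :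
  #|A| = \sum_(x in forest_roots) #|[set v in A | top g v == x]|.
Proof.
rewrite -sum1_card (partition_big (top g) (mem forest_roots)) => [|v _]; last exact: top_root.
by apply: eq_bigr => x _; rewrite -sum1_card; apply: eq_bigl => v; rewrite inE.
Qed.

(** The candidates are the final vertices of the trees. Half of the trees use
    their independent set that contains the final vertex, the others the one
    that avoids it; exchanging the halves if necessary gives an independent set
    of at least half of the vertices. *)
Lemma many_roots_candidates D0 : n <= D0 * (#|forest_roots|./2) ->
  exists I W0 W1 : {set 'I_n},
  [/\ stable I /\ #|I| = n./2,
      (forall v, v \in W0 -> v \in I) /\ (forall v, v \in W1 -> v \notin I),
      stable (W0 :|: W1) /\ (forall v, v \in W0 :|: W1 -> #|[set u | adjacent g v u]| <= 2),
      forall v, #|[set u | adjacent g v u && (u \in W0 :|: W1)]| <= 2 &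
      n <= D0 * #|W0| /\ n <= D0 * #|W1|].
Proof.
move=> nD.
have [x|AB hAB] := @fin_all_exists 'I_n _ (fun x (AB : {set 'I_n} * {set 'I_n}) => x \in forest_roots ->
  [/\ forall v, v \in AB.1 -> top g v = x, forall v, v \in AB.2 -> top g v = x,
      stable AB.1 /\ stable AB.2, final x \notin AB.1 /\ final x \in AB.2 &
      #|[set v | top g v == x]| <= #|AB.1| + #|AB.2|]).
  case: (boolP (x \in forest_roots)) => [/component_pair[AB hAB]|_]; first by exists AB.
  by exists (set0, set0).
have [|J [Jr szJ]] := @subset_of_size _ forest_roots (#|forest_roots|./2).
  by move: #|forest_roots|; clear; lia.
pose pick b x := if (x \in J) == b then (AB x).2 else (AB x).1.
pose S b := [set v | v \in pick b (top g v)].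
have pick_top b x v : x \in forest_roots -> v \in pick b x -> top g v = x.
  by move=> /hAB[h1 h2 _ _ _]; rewrite /pick; case: ifP => _; [apply: h2 | apply: h1].
have S_stable b : stable (S b).
  move=> v u vu; rewrite !inE (adjacent_top vu).
  have [_ _ [st1 st2] _ _] := hAB _ (top_root u).
  by rewrite /pick; case: ifP => _; [apply: st2 vu | apply: st1 vu].
have szS : n <= #|S true| + #|S false|.
  rewrite -[n in n <= _]card_ord -cardsT !card_by_top -big_split; apply: leq_sum => x xr.
  have Sx b : [set v in S b | top g v == x] = pick b x.
    apply/setP => v; rewrite !inE; have [<-|tx] := eqVneq; first by rewrite andbT.
    by rewrite andbF; apply/esym/negbTE/negP => /(pick_top _ _ _ xr)/eqP; apply/negP.
  rewrite !Sx /pick; have [_ _ _ _] := hAB _ xr.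
  rewrite (_ : [set v in [set: _] | _] = [set v | top g v == x]); last by apply/setP => v; rewrite !inE.
  by case: (x \in J); rewrite //= addnC.
pose F b := [set final x | x in [set x in forest_roots | (x \in J) == b]].
have F_root b v : v \in F b -> exists x, [/\ x \in forest_roots, (x \in J) = b & v = final x].
  by case/imsetP => x; rewrite inE => /andP[xr /eqP xJ] ->; exists x.
have szF b : #|forest_roots|./2 <= #|F b|.
  rewrite card_in_imset; last by move=> x z; rewrite !inE => /andP[xr _] /andP[zr _]; apply: final_inj; rewrite inE.
  have -> : [set x in forest_roots | (x \in J) == b] = if b then J else forest_roots :\: J.
    apply/setP => x; rewrite inE; case: b; rewrite ?inE ?eqb_id ?eqbF_neg; last by rewrite andbC.
    by case: (boolP (x \in J)) => [/(subsetP Jr)|]; rewrite ?andbT ?andbF // inE.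
  case: b; first by rewrite szJ.
  by rewrite cardsD (setIidPr Jr) szJ; clear; lia.
have FS b v : v \in F b -> v \in S b.
  case/F_root => x [xr xJ ->]; have [_ _ _ [_ h2] _] := hAB _ xr.
  by have [tx _] := finalP xr; rewrite inE tx /pick xJ eqxx.
have FnS b v : v \in F (~~ b) -> v \notin S b.
  case/F_root => x [xr xJ ->]; have [_ _ _ [h1 _] _] := hAB _ xr.
  by have [tx _] := finalP xr; rewrite inE tx /pick xJ; case: b xJ.
have [b bigS] : exists b, n./2 <= #|S b|.
  have [|] := leqP n./2 #|S true|; first by exists true.
  by move=> lt_S; exists false; move: lt_S szS; move: #|S true| #|S false| => p q; clear; lia.
have [W0 [W0F szW0]] := subset_of_size (szF b).
have W0S : W0 \subset S b by apply/subsetP => v /(subsetP W0F)/FS.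
have [|I [W0I IS szI]] := @subset_between _ W0 (S b) n./2 W0S.
  by rewrite bigS szW0 andbT half_leq // -[X in _ <= X]card_ord max_card.
pose W := W0 :|: F (~~ b).
have W_root v : v \in W -> exists2 x, x \in forest_roots & v = final x.
  by rewrite inE => /orP[/(subsetP W0F)|] /F_root[x [xr _ ->]]; exists x.
exists I, W0, (F (~~ b)); split.
- split=> // v u vu /(subsetP IS)/(S_stable _ _ _ vu); apply: contra; exact: (subsetP IS).
- split=> [v|v /FnS]; first exact: (subsetP W0I).
  by apply: contra; apply: (subsetP IS).
- split=> [v u vu /W_root[x xr vx]|v /W_root[x xr ->]].
    apply/negP => /W_root[z zr uz].
    have := adjacent_top vu; rewrite vx uz; have [-> _] := finalP xr; have [-> _] := finalP zr.
    by move=> xz; have := adjacent_side vu; rewrite vx uz xz; case: side.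
  apply: leq_trans (_ : 1 <= _) => //; apply: leq_trans (parent_card_le (final x)).
  by apply/subset_leq_card/subsetP => u; rewrite !inE => /(final_nbr xr)->.
- move=> v; apply: leq_trans (_ : 1 <= _) => //; rewrite -(cards1 (final (top g v))).
  apply/subset_leq_card/subsetP => u; rewrite inE => /andP[/adjacent_top vu /W_root[x xr ux]].
  by rewrite vu ux; have [-> _] := finalP xr; rewrite inE.
by rewrite szW0; split=> //; apply: leq_trans nD _; rewrite leq_mul2l szF orbT.
Qed.

End ManyRoots.

(** A vertex with k children has k - 1 children that are not the first. *)
Lemma late_card :
  #|[set v | [exists x, (g v == Some x) && [exists c in kids x, c < v]]]| <= \sum_x (#|kids x| - 1).
Proof.
set late := [set v | _].
apply: leq_trans (_ : #|\bigcup_(x in 'I_n) [set v in late | g v == Some x]| <= _).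
  apply/subset_leq_card/subsetP => v vl; apply/bigcupP.
  move: (vl); rewrite inE => /existsP[x /andP[gv _]]; exists x => //.
  by rewrite inE vl.
apply: leq_trans (leq_card_bigcup _ _) _; apply: leq_sum => x _.
have [->|[c ck]] := set_0Vmem [set v in late | g v == Some x]; first by rewrite cards0.
have ckx : c \in kids x by move: ck; rewrite !inE => /andP[].
have [m mx min_m] := @arg_minnP 'I_n c (mem (kids x)) (fun v : 'I_n => v : nat) ckx.
rewrite (cardsD1 m (kids x)) [m \in _]mx addKn; apply/subset_leq_card/subsetP => v.
rewrite in_setD1 inE => /andP[vl gv]; rewrite [v \in kids x]inE gv andbT.
apply/eqP => vm; move: vl; rewrite inE => /existsP[z /andP[gz /existsP[d /andP[dz dv]]]].
have /min_m : d \in kids x by move: dz; rewrite !inE -(eqP gz) (eqP gv).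
by rewrite leqNgt -vm dv.
Qed.

Section FewRoots.

Hypothesis few_kids : \sum_x (#|kids x| - 1) <= 2 * #|forest_roots|.

(** A vertex with at most one child that is the first child of its parent. A
    vertex has at most two neighbours of this kind: its parent and its first
    child. *)
Definition light v :=
  (#|kids v| <= 1) && [exists x, (g v == Some x) && [forall c in kids x, v <= c]].

Lemma light_degree v : light v -> #|[set u | adjacent g v u]| <= 2.
Proof.
move=> /andP[k1 _]; apply: leq_trans (leq_add (parent_card_le v) k1).
apply: leq_trans (leq_card_setU _ _); apply/subset_leq_card/subsetP => u.
by rewrite !inE.
Qed.

Lemma light_few v (W : {set 'I_n}) : (forall u, u \in W -> light u) ->
  #|[set u | adjacent g v u && (u \in W)]| <= 2.
Proof.
move=> Wl; pose A := [set u in kids v | u \in W].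
have A1 : #|A| <= 1.
  apply/card_le1_eqP => u w; rewrite !inE => /andP[gu /Wl lu] /andP[gw /Wl lw].
  case/andP: lu => _ /existsP[x /andP[gux /forall_inP min_u]].
  case/andP: lw => _ /existsP[x' /andP[gwx /forall_inP min_w]].
  apply/val_inj/eqP; rewrite eqn_leq min_w ?min_u ?inE //.
    by rewrite (eqP gw) -(eqP gu).
  by rewrite (eqP gu) -(eqP gw).
apply: leq_trans (leq_add (parent_card_le v) A1).
apply: leq_trans (leq_card_setU _ _); apply/subset_leq_card/subsetP => u.
by rewrite !inE => /andP[/orP[->|->] ->]; rewrite ?orbT.
Qed.

(** A vertex that is not light is a root, has at least two children, or has an older
    sibling. *)
Lemma not_light_card : #|[set v | ~~ light v]| <= 5 * #|forest_roots|.
Proof.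
pose heavy := [set v | 1 < #|kids v|].
pose late := [set v | [exists x, (g v == Some x) && [exists c in kids x, c < v]]].
have heavy_le : #|heavy| <= \sum_x (#|kids x| - 1).
  rewrite -sum1_card big_mkcond /=; apply: leq_sum => x _.
  by rewrite inE; case: #|kids x| => [|[|k]].
have late_le : #|late| <= \sum_x (#|kids x| - 1) := late_card.
apply: leq_trans (_ : #|heavy| + #|late| + #|forest_roots| <= _); last first.
  by move: few_kids heavy_le late_le; move: (\sum_x _) #|heavy| #|late| #|forest_roots| => a b c d; clear; lia.
apply: leq_trans (leq_add (leq_card_setU _ _) (leqnn _)); apply: leq_trans (leq_card_setU _ _).
apply/subset_leq_card/subsetP => v; rewrite !inE negb_and -ltnNge.
case: (1 < _) => //= nex; case gv: (g v) => [x|]; last by rewrite orbT.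
rewrite orbF; apply/existsP; exists x; rewrite eqxx /=.
move/existsPn: nex => /(_ x); rewrite gv eqxx /= negb_forall => /existsP[c].
by rewrite negb_imply -ltnNge => cx; apply/existsP; exists c.
Qed.

(** Each vertex of one side that is not a root is a child of a vertex of the
    other side, and few vertices have more than one child. *)
Lemma side_balanced b :
  #|[set v | side g v == b]| <= #|[set v | side g v == ~~ b]| + 3 * #|forest_roots|.
Proof.
pose K b := [set v | side g v == b].
apply: leq_trans (_ : #|forest_roots :|: \bigcup_(x in K (~~ b)) kids x| <= _).
  apply/subset_leq_card/subsetP => v; rewrite !inE sideE //; case gv: (g v) => [u|] //= su.
  by apply/bigcupP; exists u; rewrite !inE ?gv // -(eqP su) negbK.
apply: leq_trans (leq_card_setU _ _) _.
apply: leq_trans (leq_add (leqnn _) (leq_card_bigcup _ _)) _.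
apply: leq_trans (_ : #|forest_roots| + (#|K (~~ b)| + \sum_x (#|kids x| - 1)) <= _).
  rewrite leq_add2l -sum1_card; apply: leq_trans (_ : \sum_(x in K (~~ b)) (1 + (#|kids x| - 1)) <= _).
    by apply: leq_sum => x _; rewrite -leq_subLR.
  rewrite big_split leq_add2l /= big_mkcond; apply: leq_sum => x _; by case: ifP.
by move: few_kids; move: (\sum_x _) #|K _| #|forest_roots| => p q r; clear; lia.
Qed.

(** Almost all vertices are light. The candidates are light vertices of the two
    colour classes, the even ones few enough to leave many odd ones that
    are not adjacent to them. *)
Lemma few_roots_candidates : 100 * #|forest_roots| <= n -> 16 <= n ->
  exists I W0 W1 : {set 'I_n},
  [/\ stable I /\ #|I| = n./2,
      (forall v, v \in W0 -> v \in I) /\ (forall v, v \in W1 -> v \notin I),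
      stable (W0 :|: W1) /\ (forall v, v \in W0 :|: W1 -> #|[set u | adjacent g v u]| <= 2),
      forall v, #|[set u | adjacent g v u && (u \in W0 :|: W1)]| <= 2 &
      n <= 32 * #|W0| /\ n <= 32 * #|W1|].
Proof.
move=> few n16.
pose K b := [set v | side g v == b].
have szK b : #|K b| + #|K (~~ b)| = n.
  rewrite -[RHS]card_ord -cardsT -(cardsID (K b) setT); congr (_ + _); apply: eq_card => v.
    by rewrite !inE.
  by rewrite !inE andbT; case: b; case: side.
have [b bigK] : exists b, n <= 2 * #|K b|.
  have [|lt_K] := leqP n (2 * #|K true|); first by exists true.
  exists false; move: lt_K (szK false); rewrite /=; move: #|K true| #|K false| => p q; clear; lia.
have [|I [IK szI]] := @subset_of_size _ (K b) n./2.
  by move: bigK; move: #|K b| => p; clear; lia.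
have nl := not_light_card; have sb := side_balanced b; rewrite -/(K b) -/(K (~~ b)) in sb.
have lights (A : {set 'I_n}) : #|A| <= #|[set v in A | light v]| + 5 * #|forest_roots|.
  apply: leq_trans (leq_add (leqnn _) nl); apply: leq_trans (leq_card_setU _ _).
  by apply/subset_leq_card/subsetP => v; rewrite !inE => ->; case: light.
have [|W0 [W0I szW0]] := @subset_of_size _ [set v in I | light v] (n %/ 16).
  by move: (lights I) few; rewrite szI; move: #|[set v in I | _]| #|forest_roots| => p q; clear; lia.
have {}W0I v : v \in W0 -> (v \in I) && light v by move/(subsetP W0I); rewrite inE.
pose W1 := [set v in K (~~ b) | light v] :\: [set u | [exists v in W0, adjacent g v u]].
have W1P v : v \in W1 -> [/\ v \in K (~~ b), light v & forall u, u \in W0 -> ~~ adjacent g u v].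
  rewrite !inE => /andP[/existsP nW /andP[-> ->]]; split=> // u uW.
  by apply/negP => uv; apply: nW; exists u; rewrite uW.
have W_light v : v \in W0 :|: W1 -> light v.
  by rewrite inE => /orP[/W0I/andP[]|/W1P[]].
have K_stable c : stable (K c).
  by move=> v u vu; rewrite !inE (adjacent_side vu) => /eqP->; case: c.
have nK v : v \in K (~~ b) -> v \notin K b by rewrite !inE => /eqP->; case: (b).
exists I, W0, W1; split.
- split=> // v u vu /(subsetP IK)/(K_stable _ _ _ vu); apply: contra; exact: (subsetP IK).
- split=> [v /W0I/andP[]//|v /W1P[vK _ _]].
  by apply: contra (nK _ vK); apply: (subsetP IK).
- split=> [v u vu|v /W_light]; last exact: light_degree.
  rewrite in_setU => /orP[vW|vW]; apply/negP; rewrite in_setU => /orP[uW|uW].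
  + have /andP[/(subsetP IK) vK _] := W0I _ vW; have /andP[/(subsetP IK) uK _] := W0I _ uW.
    by have := K_stable _ _ _ vu vK; rewrite uK.
  + by have [_ _ /(_ v vW)] := W1P _ uW; rewrite vu.
  + by have [_ _ /(_ u uW)] := W1P _ vW; rewrite adjacentC vu.
  have [vK _ _] := W1P _ vW; have [uK _ _] := W1P _ uW.
  by have := K_stable _ _ _ vu vK; rewrite uK.
- by move=> v; apply: light_few => u; apply: W_light.
rewrite szW0; split; first by move: n16; clear; lia.
have nb : #|[set u | [exists v in W0, adjacent g v u]]| <= n %/ 16 * 2.
  rewrite -szW0; have := @card_nbr_le n g W0 setT 2; rewrite (_ : [set u in setT | _] = [set u | [exists v in W0, adjacent g v u]]); last first.
    by apply/setP => u; rewrite !inE.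
  apply=> v /W0I/andP[_ /light_degree dv]; apply: leq_trans dv.
  by apply/subset_leq_card/subsetP => u; rewrite !inE andbT.
have W1_ge : #|[set v in K (~~ b) | light v]| <= #|W1| + n %/ 16 * 2.
  rewrite -(cardsID [set u | [exists v in W0, adjacent g v u]]) addnC leq_add2l.
  by apply: leq_trans nb; apply/subset_leq_card/subsetIr.
move: (lights (K (~~ b))) W1_ge sb (szK b) few n16.
move: #|K b| #|K (~~ b)| #|W1| #|[set v in K _ | _]| #|forest_roots|; clear; lia.
Qed.

End FewRoots.
End Candidates.

(** * Coprime labellings of forests with few branchings *)

(** The dichotomy on the number of roots: a forest with many roots has many
    trees, a forest with few roots and few branchings is nearly a union of
    paths. *)
Theorem forest_labelling : exists n0, forall n, n0 <= n ->
  forall g : 'I_n -> option 'I_n, descends g ->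
  \sum_x (#|kids g x| - 1) <= 2 * #|forest_roots g| ->
  exists f : 'I_n -> nat,
  [/\ injective f, forall v, 0 < f v <= n &
      forall v u, g v = Some u -> coprime (f v) (f u)].
Proof.
have [n0 coreP] := @core 300 isT; exists (n0 + 400) => n n_ge g gd few.
suff [I [W0 [W1 [[st szI] [W0I W1I] [stW dW] fW [b0 b1]]]]] :
  exists I W0 W1 : {set 'I_n},
  [/\ stable g I /\ #|I| = n./2,
      (forall v, v \in W0 -> v \in I) /\ (forall v, v \in W1 -> v \notin I),
      stable g (W0 :|: W1) /\ (forall v, v \in W0 :|: W1 -> #|[set u | adjacent g v u]| <= 2),
      forall v, #|[set u | adjacent g v u && (u \in W0 :|: W1)]| <= 2 &
      n <= 300 * #|W0| /\ n <= 300 * #|W1|].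
  by apply: (coreP n _ g I W0 W1) => //; apply: leq_trans n_ge; apply: leq_addr.
have [le_r|lt_r] := leqP (100 * #|forest_roots g|) n.
  have [|I [W0 [W1 [h1 h2 h3 h4 [b0 b1]]]]] := few_roots_candidates gd few le_r.
    by apply: leq_trans n_ge; lia.
  exists I, W0, W1; split=> //.
  by split; [apply: leq_trans b0 _ | apply: leq_trans b1 _]; rewrite leq_mul2r orbT.
by apply: many_roots_candidates => //; move: lt_r n_ge; move: #|forest_roots g|; clear; lia.
Qed.

(** * From trees to forests *)

Section TreeForest.

Variables (n : nat) (par : 'I_n -> option 'I_n).
Hypothesis par_desc : descends par.

Definition older c := if par c is Some v then [set d in kids par v | d < c] else set0.

(** One pair of neighbours is chosen at each vertex of degree at least two, and
    the later one gets the earlier one as its mate: the two first children of a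
    branching vertex, or else the parent and the only child. *)
Definition mate c : option 'I_n :=
  if par c is Some v then
    if #|kids par v| == 1 then par v
    else if #|older c| == 1 then [pick d in older c] else None
  else None.

Lemma descends_mate : descends mate.
Proof.
move=> c u; rewrite /mate; case pc: (par c) => [v|] //; have vc := par_desc pc.
case: ifP => [_ /par_desc uv|_]; first exact: ltn_trans uv vc.
case: ifP => // _; case: pickP => // d; rewrite /older pc inE => /andP[_ dc] [<-].
exact: dc.
Qed.

Lemma sum_fibres (h : 'I_n -> option 'I_n) (A : {set 'I_n}) :
  \sum_x #|[set c in A | h c == Some x]| <= #|A|.
Proof.
rewrite -sum1_card [X in _ <= X](eq_bigr (fun c => \sum_(x : 'I_n) (h c == Some x) + (h c == None))) => [|c _].
  rewrite big_split /= exchange_big /=; apply: leq_trans (leq_addr _ _).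
  apply: leq_sum => x _; rewrite -sum1_card big_mkcond [X in _ <= X]big_mkcond /=.
  by apply: leq_sum => c _; rewrite inE; case: (c \in A) => //=; case: eqP.
case: (h c) => [x|]; last by rewrite big1.
rewrite (bigD1 x) //= eqxx big1 // => z zx.
by rewrite (inj_eq Some_inj) eq_sym (negPf zx).
Qed.

Lemma kid_older c v : par c = Some v -> older c = [set d in kids par v | d < c].
Proof. by rewrite /older => ->. Qed.

(** All children of a branching vertex but the second one are roots. *)
Lemma branching_le_roots : \sum_v (#|kids par v| - 1) <= #|forest_roots mate|.
Proof.
apply: leq_trans (sum_fibres par (forest_roots mate)); apply: leq_sum => v _.
have [->|ch1] := eqVneq #|kids par v| 1; first by [].
rewrite leq_subLR addnC -(cardsID (forest_roots mate) (kids par v)); apply: leq_add.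
  by apply/subset_leq_card/subsetP => c; rewrite !inE andbC.
apply/card_le1_eqP => c d; rewrite !inE /mate => /andP[nc /eqP pc] /andP[nd /eqP pd].
move: nc nd; rewrite pc pd (negPf ch1); case: ifP => // /eqP oc _; case: ifP => // /eqP od _.
have older_lt (a b : 'I_n) : par a = Some v -> par b = Some v -> a < b -> #|older a| < #|older b|.
  move=> pa pb ab; apply: proper_card; rewrite (kid_older pa) (kid_older pb).
  apply/properP; split.
    by apply/subsetP => z; rewrite !inE => /andP[-> za]; apply: ltn_trans za ab.
  by exists a; rewrite !inE ?pa ?eqxx ?ab ?ltnn.
apply/val_inj/eqP; case: (ltngtP c d) => // lt.
  by have := older_lt _ _ pc pd lt; rewrite oc od.
by have := older_lt _ _ pd pc lt; rewrite oc od.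
Qed.

(** A vertex is the mate of an only grandchild at most once per child, and of its
    next sibling at most once; the siblings are counted by the branchings of the
    tree, which are in turn counted by the roots of the forest. *)
Lemma mate_few_kids : \sum_x (#|kids mate x| - 1) <= 2 * #|forest_roots mate|.
Proof.
pose late := [set v | [exists x, (par v == Some x) && [exists c in kids par x, c < v]]].
apply: leq_trans (_ : \sum_x ((#|kids par x| - 1) + #|[set c in late | mate c == Some x]|) <= _).
  apply: leq_sum => x _; rewrite leq_subLR addnA.
  apply: leq_trans (_ : #|kids par x| + #|[set c in late | mate c == Some x]| <= _); last first.
    by rewrite leq_add2r -leq_subLR.
  rewrite -(cardsID late) addnC; apply: leq_add; last first.
    by apply/subset_leq_card/subsetP => c; rewrite !inE andbC.
  have only_kid c : c \in kids mate x :\: late ->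
      exists v, [/\ par c = Some v, #|kids par v| = 1 & par v = Some x].
    rewrite inE => /andP[cl]; rewrite inE /mate; case pc: (par c) => [v|] //.
    case: ifP => [/eqP k1 /eqP pv|_]; first by exists v.
    case: ifP => // _; case: pickP => // d dc _; case/negP: cl; rewrite inE.
    apply/existsP; exists v; rewrite pc eqxx; apply/existsP; exists d.
    by move: dc; rewrite (kid_older pc) inE.
  rewrite -(card_in_imset (f := fun c => odflt c (par c))).
    apply/subset_leq_card/subsetP => v /imsetP[c /only_kid[u [pc _ pu]] ->].
    by rewrite pc inE pu.
  move=> c d /only_kid[v [pc k1 _]] /only_kid[u [pd _ _]]; rewrite pc pd /= => uv.
  by apply: (card_le1_eqP (eq_leq k1)); rewrite inE ?pc ?pd ?uv.
rewrite big_split /= mul2n -addnn; apply: leq_add; first exact: branching_le_roots.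
apply: leq_trans (sum_fibres mate late) _; apply: leq_trans branching_le_roots; exact: late_card.
Qed.

(** The mates are what neighbourhood-primeness asks for: coprime labels on mates
    already make the greatest common divisor over the neighbours of v equal to
    one. *)
Lemma mate_neighbors v : 1 < #|[set u | adjacent par v u]| ->
  exists a b, [/\ adjacent par v a, adjacent par v b & mate b = Some a].
Proof.
move=> deg2.
have [k2|k1] := ltnP 1 #|kids par v|.
  have /card_gt0P[c0 c0v] : 0 < #|kids par v| by apply: leq_trans k2.
  have [a av min_a] := @arg_minnP 'I_n c0 (mem (kids par v)) (fun v : 'I_n => v : nat) c0v.
  have /card_gt0P[c1 c1v] : 0 < #|kids par v :\ a|.
    by move: k2; rewrite (cardsD1 a) [a \in _]av.
  have [b bv min_b] := @arg_minnP 'I_n c1 (mem (kids par v :\ a)) (fun v : 'I_n => v : nat) c1v.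
  move: bv; rewrite /= in_setD1 => /andP[ba bv].
  have pb : par b = Some v by move: bv; rewrite inE => /eqP.
  have ob : older b = [set a].
    apply/setP => d; rewrite (kid_older pb) in_set1 inE; apply/andP/eqP => [[dv db]|->].
      apply/eqP; apply: contraLR db => da; rewrite -leqNgt; apply: min_b.
      by rewrite /= in_setD1 da.
    by split=> //; rewrite ltn_neqAle eq_sym min_a // andbT.
  exists a, b; rewrite /adjacent; move: av; rewrite !inE => ->; rewrite pb eqxx !orbT; split=> //.
  rewrite /mate pb ob cards1 eqxx; case: eqP => [k|_]; first by rewrite k in k2.
  by case: pickP => [d|/(_ a)]; rewrite inE ?eqxx // => /eqP->.
have [u pv] : exists u, par v = Some u.
  case pv: (par v) => [u|]; first by exists u.
  exfalso; move: deg2; rewrite ltnNge => /negP; apply; apply: leq_trans k1.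
  by apply/subset_leq_card/subsetP => z; rewrite !inE /adjacent pv.
have /card_gt0P[c] : 0 < #|kids par v|.
  rewrite lt0n; apply/eqP => k0; move: deg2; rewrite ltnNge => /negP; apply.
  apply: leq_trans (parent_card_le par v); apply/subset_leq_card/subsetP => z.
  by rewrite !inE => /orP[//|pz]; have /setP/(_ z) := cards0_eq k0; rewrite !inE pz.
rewrite inE => /eqP pc; have kc : #|kids par v| == 1.
  by rewrite eqn_leq k1 card_gt0; apply/set0Pn; exists c; rewrite inE pc.
by exists u, c; rewrite /adjacent pv pc !eqxx orbT /mate pc kc.
Qed.

End TreeForest.

(** * Exploring a tree *)

Section Explore.

Variables (T : finType) (e : rel T).
Hypothesis e_tree : is_tree e.

(** Paths inside s, for the invariant that the explored part is connected. *)
Definition within (s : seq T) : rel T := [rel x y | [&& x \in s, y \in s & e x y]].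

Lemma within_path s x p : path (within s) x p -> path e x p /\ {subset p <= s}.
Proof.
elim: p x => [|y p IH] x //= /andP[/and3P[_ ys xy] /IH[yp ps]].
rewrite xy yp; split=> // z; rewrite inE => /orP[/eqP->|] //.
exact: ps.
Qed.

Lemma boundary_edge (s : seq T) x z : x \in s -> z \notin s -> exists a b, [/\ a \in s, b \notin s & e a b].
Proof.
have [_ [_ conn] _] := e_tree; have /connectP[p xp ->] := conn x z.
elim: p x xp => [|y p IH] x /= => [_ -> //|/andP[xy yp] xs].
have [ys|ys _] := boolP (y \in s); first exact: IH.
by exists x, y.
Qed.

(** Two neighbours of a new vertex inside a connected set would close a cycle. *)
Lemma unique_contact s b a a' : (forall x y, x \in s -> y \in s -> connect (within s) x y) ->
  b \notin s -> a \in s -> a' \in s -> e a b -> e a' b -> a = a'.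
Proof.
move=> conn bs aS a's ab a'b; have [[sym _] _ acyc] := e_tree.
apply/eqP/negPn/negP => aa'; have /connectP[p ap eq_a'] := conn a a' aS a's.
move: a's a'b aa'; rewrite {}eq_a'; case/shortenP: ap => p' ap' uniq_p' _ _ lb al.
have [ep p's] := within_path ap'.
apply: (acyc (b :: a :: p')); first by case: p' al {ap' uniq_p' lb ep p's}; rewrite //= eqxx.
rewrite /ucycle /= rcons_path sym ab ep lb /= -[X in _ && X]/(uniq (a :: p')) uniq_p' andbT.
by rewrite inE negb_or; apply/andP; split; [apply: contraNneq bs => -> | apply: contra bs => /p's].
Qed.

(** Connectedness gives an edge that leaves the explored part; by the absence of
    cycles its inner end is the only explored neighbour of its outer end. *)
Lemma explore k : 0 < k <= #|T| -> exists s : seq T,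
  [/\ uniq s, size s = k, forall x y, x \in s -> y \in s -> connect (within s) x y &
      forall x0 i, 0 < i < k -> exists j, [/\ j < i, e (nth x0 s i) (nth x0 s j) &
        forall j', j' < i -> e (nth x0 s i) (nth x0 s j') -> j' = j]].
Proof.
have [[sym _] _ _] := e_tree.
elim: k => // -[|k] IH /andP[_ kT].
  have /card_gt0P[x _] := kT; exists [:: x]; split=> // [y z|x0 [|i] //].
  by rewrite !inE => /eqP-> /eqP->.
have [s [us szs conn prec]] := IH (ltnW kT).
have [z zs] : exists z, z \notin s.
  apply/existsP; rewrite -negb_forall; apply/negP => /forallP all_s.
  move: kT; rewrite -szs -(card_uniqP us) ltnNge => /negP; apply.
  by apply/subset_leq_card/subsetP => x _; have := all_s x.
have [x xs] : exists x, x \in s by case: s szs {us conn prec zs} => // x s _; exists x; rewrite mem_head.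
have [a [b [aS bs ab]]] := boundary_edge xs zs.
have sub_w x' y : connect (within s) x' y -> connect (within (rcons s b)) x' y.
  apply: connect_sub => u v /and3P[us' vs uv]; apply: connect1.
  by rewrite /within /= !mem_rcons !inE us' vs uv !orbT.
have ab_w : within (rcons s b) a b by rewrite /within /= !mem_rcons !inE aS eqxx ab orbT.
have ba_w : within (rcons s b) b a by rewrite /within /= !mem_rcons !inE aS eqxx sym ab orbT.
exists (rcons s b); split; rewrite ?rcons_uniq ?bs ?size_rcons ?szs //.
  move=> u v; rewrite !mem_rcons !inE => /orP[/eqP->|us'] /orP[/eqP->|vs].
  - exact: connect0.
  - exact: connect_trans (connect1 ba_w) (sub_w _ _ (conn _ _ aS vs)).
  - exact: connect_trans (sub_w _ _ (conn _ _ us' aS)) (connect1 ab_w).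
  exact: sub_w (conn _ _ us' vs).
move=> x0 i /andP[i0]; rewrite ltnS leq_eqVlt => /orP[/eqP ik|ik].
  rewrite ik nth_rcons szs ltnn eqxx; exists (index a s); split.
  - by rewrite -szs index_mem.
  - by rewrite nth_rcons index_mem aS nth_index // sym.
  move=> j' j'k; rewrite nth_rcons szs j'k sym => j'b.
  have j's : nth x0 s j' \in s by rewrite mem_nth ?szs.
  by rewrite (unique_contact conn bs aS j's ab j'b) index_uniq ?szs.
have [|j [ji ej uj]] := prec x0 i; first by rewrite i0.
have nth_s m : m <= i -> nth x0 (rcons s b) m = nth x0 s m.
  by move=> mi; rewrite nth_rcons szs (leq_ltn_trans mi).
exists j; rewrite !nth_s //; last exact: ltnW; split=> // j' j'i.
by rewrite nth_s; [exact: uj | exact: ltnW].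
Qed.

(** From here on a tree is a parent map on indices, to which the results on
    forests apply. *)
Lemma tree_parent : exists (phi : 'I_#|T| -> T) (par : 'I_#|T| -> option 'I_#|T|),
  [/\ bijective phi, descends par & forall i j, e (phi i) (phi j) = adjacent par i j].
Proof.
have [[sym irr] [T0 _] _] := e_tree.
have [|s [us szs _ prec]] := @explore #|T|; first by rewrite T0 leqnn.
have /card_gt0P[x0 _] := T0.
pose phi (i : 'I_#|T|) := nth x0 s i.
pose par (i : 'I_#|T|) := [pick j : 'I_#|T| | (j < i) && e (phi i) (phi j)].
have par_desc : descends par by move=> v u; rewrite /par; case: pickP => // j /andP[ji _] [<-].
have parE (i j : 'I_#|T|) : j < i -> e (phi i) (phi j) = (par i == Some j).
  move=> ji; apply/idP/eqP => [eij|]; rewrite /par; case: pickP => [k /andP[ki eik]|no].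
  - have [|m [mi _ um]] := prec x0 i; first by rewrite (leq_ltn_trans _ ji) //= ltn_ord.
    by congr Some; apply: val_inj; rewrite /= (um k ki eik) (um j ji eij).
  - by have := no j; rewrite ji eij.
  - by case=> <-.
  by [].
exists phi, par; split=> //.
  apply: inj_card_bij; last by rewrite card_ord.
  by move=> i j /eqP; rewrite nth_uniq ?szs // => /eqP/val_inj.
have par_lt (i j : 'I_#|T|) : i <= j -> par i == Some j = false.
  by move=> ij; apply/eqP => /par_desc; rewrite ltnNge ij.
move=> i j; case: (ltngtP i j) => [ij|ji|/val_inj->].
- by rewrite sym parE // /adjacent (par_lt i j (ltnW ij)).
- by rewrite parE // /adjacent (par_lt j i (ltnW ji)) ?orbF.
by rewrite irr /adjacent !par_lt.
Qed.

End Explore.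

Lemma biggcd_coprime (T : finType) (A : {set T}) (F : T -> nat) a b :
  a \in A -> b \in A -> coprime (F a) (F b) -> \big[gcdn/0]_(u in A) F u = 1.
Proof.
move=> aA bA co; apply/eqP; rewrite -dvdn1 -(eqP co) dvdn_gcd.
by rewrite (biggcdn_inf a) ?(biggcdn_inf b).
Qed.

Theorem theorem43 :
  exists n' : nat, forall (T : finType) (e : rel T),
    is_tree e -> n' <= #|T| -> neighborhood_prime e.
Proof.
have [n0 label] := forest_labelling; exists n0 => T e e_tree n_ge.
have [phi [par [phi_bij par_desc edgeE]]] := tree_parent e_tree.
have [f [f_inj f_rng f_co]] := label _ n_ge _ (descends_mate par_desc) (mate_few_kids par).
have [psi phiK psiK] := phi_bij.
have lt_f t : (f (psi t)).-1 < #|T| by have /andP[f0 fn] := f_rng (psi t); rewrite prednK.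
have fE t : (f (psi t)).-1.+1 = f (psi t) by have /andP[f0 _] := f_rng (psi t); rewrite prednK.
exists (fun t => Ordinal (lt_f t)); split.
  apply: inj_card_bij; last by rewrite card_ord.
  move=> t u /(congr1 val) /= eq_f; apply: (can_inj psiK); apply: f_inj.
  by rewrite -fE eq_f fE.
move=> v deg_v.
have deg2 : 1 < #|[set u | adjacent par (psi v) u]|.
  apply: leq_trans deg_v _; rewrite -(card_imset _ (can_inj phiK)).
  apply/subset_leq_card/subsetP => u; rewrite inE => vu; apply/imsetP; exists (psi u) => //.
  by rewrite inE -edgeE !psiK.
have [a [b [va vb ab]]] := mate_neighbors deg2.
rewrite (eq_bigr (fun u => f (psi u))) => [|u _]; last exact: fE.
have in_nbr c : adjacent par (psi v) c -> phi c \in neighbors e v.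
  by rewrite inE -edgeE psiK.
apply: (@biggcd_coprime _ _ (fun u => f (psi u)) _ _ (in_nbr b vb) (in_nbr a va)).
by rewrite !phiK; apply: f_co.
Qed.
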